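(* Let $k=\bar{\mathbf F}_2$ and let $E$ be the supersingular elliptic curve over $k$ given by the affine Weierstrass equation $Y^2+Y=X^3$, with identity $0_E$. Let $\rho:E\to\mathbf P^1_k$ be the cover $(X,Y)\mapsto (X^4+X)^3$, which is an explicit model of the projection $E\to E/\mathrm{Isom}_k(E)$ and restricts to a finite cover $E-\{0_E\}\to\mathbf A^1_k$. Then $\rho$ induces a bijection between the set of isomorphism classes of Lamé curves defined over $k$ and the set $\mathbf A^1(k)$, and this bijection commutes with the Galois action (the action of $\mathrm{Gal}(k/\mathbf F_2)$). The induced map sends the class of a Lamé curve that is isomorphic to $(E,P)$, with $P\in E(k)-\{0_E\}$, to $\rho(P)$.
   Context: $\mathrm{Isom}_k(E)$ is the group of $k$-automorphisms of the elliptic curve $E$ (fixing $0_E$); it has order $24$. Lamé curves: let $E'$ be an elliptic curve over $k$ with identity $0_{E'}$ and let $P\in E'(k)$ be a torsion point of exact order $n>1$, $n$ not divisible by the characteristic of $k$. There is $f_P\in k(E')$, unique up to a multiplicative constant, with divisor $n(P)-n(0_{E'})$; it induces a degree $n$ cover $f_P:E'\to\mathbf P^1_k$. The pair $(E',P)$ is a Lamé curve of order $n$ if $f_P$ is tamely ramified and is ramified exactly at $0_{E'}$ and $P$, with ramification index $n$, and at one third point $Q$, with ramification index $3$. Lamé curves of all orders are considered, up to $k$-isomorphism of pairs $(E',P)$; the Galois group acts on classes by $(E',P)\mapsto(E'^\sigma,P^\sigma)$. *)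

(* Defs.v *)
From HB Require Import structures.
From mathcomp Require Import all_boot all_algebra all_field ring zify.

Set Implicit Arguments.
Unset Strict Implicit.
Unset Printing Implicit Defensive.

Import GRing.Theory.
Local Open Scope ring_scope.

Lemma fracE (R : idomainType) (r : {fraction R}) :
  exists n d : R, d != 0 /\ r * FracField.tofrac d = FracField.tofrac n.
Proof.
elim/quotW: r => f; exists (\n_f), (\d_f); split; first exact: denom_ratioP.
unlock FracField.tofrac; rewrite -[LHS]FracField.pi_mul.
rewrite /FracField.mulf !numden_Ratio ?oner_neq0 // mulr1.
apply/eqmodP; rewrite /= FracField.equivfE.
rewrite !numden_Ratio ?mulf_neq0 ?oner_neq0 ?denom_ratioP //.
by rewrite !mulr1 mulrC.
Qed.

Lemma cubic_no_root (k : fieldType) (b c n d : {poly k}) :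
  (size b <= 2)%N -> size c = 4%N -> d != 0 ->
  n ^+ 2 + b * n * d = c * d ^+ 2 -> False.
Proof.
move=> sb sc d0 /(congr1 (fun p : {poly k} => size p)).
have c0 : c != 0 by rewrite -size_poly_gt0 sc.
have sd : (0 < size d)%N by rewrite size_poly_gt0.
rewrite !expr2 !size_mul ?mulf_neq0 // sc.
move=> /= heq; have h2 := size_polyMleq b n.
have h3 := size_polyMleq (b * n) d.
have h4 := size_polyMleq n n.
have [le | gt] := leqP (size n) (size d).+1.
  have := size_polyD (n * n) (b * n * d); rewrite heq leq_max.
  move: h2 h3 h4 le sd sb; clear.
  move: (size (n * n)) (size (b * n)) (size (b * n * d)).
  move: (size b) (size n) (size d).
  by move=> s1 s2 s3 s4 s5 s6; clear; lia.
have n0 : n != 0 by rewrite -size_poly_gt0; lia.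
have h5 := size_mul n0 n0.
have : (size (b * n * d)%R < size (n * n)%R)%N.
  rewrite h5; move: h2 h3 gt sd sb; clear.
  move: (size (b * n)) (size (b * n * d)) (size b) (size n) (size d).
  by move=> s2 s3 s4 s5 s6; clear; lia.
move=> /size_polyDl e; move: heq; rewrite e h5.
by move: (size n) (size d) gt sd; clear; move=> s5 s6; lia.
Qed.

(* An elliptic curve over k is the smooth projective plane cubic with         *)
(*   Y^2 + a1 X Y + a3 Y = X^3 + a2 X^2 + a4 X + a6                           *)
(* of nonzero discriminant, pointed by its unique point at infinity.          *)
Section EllipticCurves.
Variable k : fieldType.

Definition discr (a1 a2 a3 a4 a6 : k) : k :=
  let b2 := a1 ^+ 2 + 4 * a2 in
  let b4 := 2 * a4 + a1 * a3 in
  let b6 := a3 ^+ 2 + 4 * a6 in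
  let b8 := a1 ^+ 2 * a6 + 4 * a2 * a6 - a1 * a3 * a4
            + a2 * a3 ^+ 2 - a4 ^+ 2 in
  - b2 ^+ 2 * b8 - 8 * b4 ^+ 3 - 27 * b6 ^+ 2 + 9 * b2 * b4 * b6.

Record ellcurve := EllCurve {
  a1 : k; a2 : k; a3 : k; a4 : k; a6 : k;
  discr_neq0 : discr a1 a2 a3 a4 a6 != 0
}.

(* [None] stands for the point at infinity. *)
Definition oncurve (E : ellcurve) (p : option (k * k)) : bool :=
  if p is Some (x, y) then
    y ^+ 2 + a1 E * x * y + a3 E * y
      == x ^+ 3 + a2 E * x ^+ 2 + a4 E * x + a6 E
  else true.

Definition point (E : ellcurve) := {p : option (k * k) | oncurve E p}.

Definition zeropt (E : ellcurve) : point E := exist _ None isT.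

Variable E : ellcurve.

(* The chord-and-tangent law, on coordinates. *)
Definition addpt (p q : option (k * k)) : option (k * k) :=
  match p, q with
  | None, _ => q
  | _, None => p
  | Some (x1, y1), Some (x2, y2) =>
    if (x1 == x2) && (y1 + y2 + a1 E * x2 + a3 E == 0) then None else
    let l := if x1 == x2
             then (3 * x1 ^+ 2 + 2 * a2 E * x1 + a4 E - a1 E * y1)
                    / (2 * y1 + a1 E * x1 + a3 E)
             else (y2 - y1) / (x2 - x1) in
    let x3 := l ^+ 2 + a1 E * l - a2 E - x1 - x2 in
    Some (x3, l * (x1 - x3) - y1 - a1 E * x3 - a3 E)
  end.

Definition mulpt (n : nat) (P : point E) : option (k * k) :=
  iter n (addpt (val P)) None.

Definition exact_order (P : point E) (n : nat) : Prop :=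
  [/\ (0 < n)%N, mulpt n P = None
    & forall m, (0 < m < n)%N -> mulpt m P <> None].

(* For k algebraically closed of characteristic p: E has no point of order p. *)
Definition supersingular : Prop :=
  forall p, p \in [pchar k] ->
  forall P : point E, mulpt p P = None -> P = zeropt E.

(* The function field k(E) is k(x)[y] modulo the Weierstrass equation. *)
Definition weierstrass : {poly {fraction {poly k}}} :=
  let c a := FracField.tofrac a%:P in
  let x := FracField.tofrac 'X in
  'X^2 + (c (a1 E) * x + c (a3 E)) *: 'X
  - (x ^+ 3 + c (a2 E) * x ^+ 2 + c (a4 E) * x + c (a6 E))%:P.

Lemma weierstrass_irr : monic_irreducible_poly weierstrass.
Proof.
pose b : {poly k} := (a1 E)%:P * 'X + (a3 E)%:P.
pose c : {poly k} := 'X^3 + ((a2 E)%:P * 'X^2 + (a4 E)%:P * 'X + (a6 E)%:P).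
have sl : (size ((a2 E)%:P * 'X^2 + (a4 E)%:P * 'X + (a6 E)%:P)%R < 4)%N.
  apply: leq_ltn_trans (_ : (3 < 4)%N) => //.
  rewrite !mul_polyC -addrA (leq_trans (size_polyD _ _)) // geq_max.
  rewrite (leq_trans (size_scale_leq _ _)) ?size_polyXn //=.
  rewrite (leq_trans (size_polyD _ _)) // geq_max.
  rewrite (leq_trans (size_scale_leq _ _)) ?size_polyX //=.
  by rewrite (leq_trans (size_polyC_leq1 _)).
have sb : (size b <= 2)%N.
  rewrite /b mul_polyC (leq_trans (size_polyD _ _)) // geq_max.
  rewrite (leq_trans (size_scale_leq _ _)) ?size_polyX //=.
  by rewrite (leq_trans (size_polyC_leq1 _)).
have sc : size c = 4%N by rewrite /c size_polyDl size_polyXn.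
have wE : weierstrass = 'X^2
    + (FracField.tofrac b *: 'X - (FracField.tofrac c)%:P).
  by rewrite /weierstrass /b /c !(tofracD, tofracXn, tofracM) !addrA.
have s2 : (size (FracField.tofrac b *: 'X - (FracField.tofrac c)%:P)%R < 3)%N.
  rewrite ltnS (leq_trans (size_polyD _ _)) // geq_max size_polyN.
  rewrite (leq_trans (size_scale_leq _ _)) ?size_polyX //=.
  by rewrite (leq_trans (size_polyC_leq1 _)).
split; last first.
  by rewrite wE monicE lead_coefDl ?size_polyXn // lead_coefXn.
apply: cubic_irreducible; first by rewrite wE size_polyDl size_polyXn.
move=> r; apply/negP => /rootP; rewrite wE => h.
have {}h : r ^+ 2 + FracField.tofrac b * r = FracField.tofrac c.
  by apply/eqP; rewrite -subr_eq0 -h !hornerE.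
have [n [d [d0 rd]]] := fracE r.
clear sl s2; clearbody b c.
apply: (@cubic_no_root k b c n d sb sc d0).
apply/eqP; rewrite -tofrac_eq !(tofracD, tofracXn, tofracM) -rd -h.
by apply/eqP; ring.
Qed.

Definition funfield : fieldType := {poly %/ weierstrass with weierstrass_irr}.

Definition cst (c : k) : funfield :=
  in_qpoly weierstrass (FracField.tofrac c%:P)%:P.
Definition fx : funfield := in_qpoly weierstrass (FracField.tofrac 'X)%:P.
Definition fy : funfield := in_qpoly weierstrass 'X.

Definition eval1 (g : {poly k}) (u : funfield) : funfield :=
  (map_poly cst g).[u].
Definition eval2 (g : {poly {poly k}}) (u v : funfield) : funfield :=
  (map_poly (map_poly cst) g).[u, v].

(* Around an affine point we use the coordinates (x, y); around infinity, the *)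
(* coordinates (X/Y, Z/Y) = (x/y, 1/y), in which infinity is (0, 0).          *)
Definition chart (R : point E) : funfield * funfield :=
  if val R is Some _ then (fx, fy) else (fx / fy, fy^-1).
Definition coords (R : point E) : k * k :=
  if val R is Some ab then ab else (0, 0).

(* f = g/h near R, with g and h polynomials in the coordinates and h(R) <> 0; *)
(* the value of f at R is then g(R)/h(R).                                     *)
Definition quotient_at (R : point E) (f : funfield) (g h : {poly {poly k}}) :=
  let: (u, v) := chart R in let: (a, b) := coords R in
  h.[a, b] != 0 /\ f = eval2 g u v / eval2 h u v.

Definition regular_at (R : point E) (f : funfield) : Prop :=
  exists g h, quotient_at R f g h.

Definition vanishes_at (R : point E) (f : funfield) : Prop :=
  exists g h, quotient_at R f g h /\
    (let: (a, b) := coords R in g.[a, b] = 0).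

(* t generates the maximal ideal of the local ring at R. *)
Definition uniformizer (R : point E) (t : funfield) : Prop :=
  vanishes_at R t /\
  forall f, vanishes_at R f -> exists2 u, regular_at R u & f = u * t.

(* The order of f at R is m. *)
Definition ord_at (R : point E) (f : funfield) (m : int) : Prop :=
  exists t u, [/\ uniformizer R t, regular_at R u, ~ vanishes_at R u
                & f = u * t ^ m].

Definition has_divisor (f : funfield) (D : point E -> int) : Prop :=
  forall R, ord_at R f (D R).

(* The cover E -> P^1 induced by f has ramification index e at R: e is the    *)
(* order at R of f - f(R), or of 1/f if R is a pole. The constants c other    *)
(* than f(R) do not contribute, since e > 0.                                  *)
Definition ram_index (f : funfield) (R : point E) (e : nat) : Prop :=
  (0 < e)%N /\
  (ord_at R f^-1 e%:Z \/ exists c, ord_at R (f - cst c) e%:Z).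

Definition ramified_at (f : funfield) (R : point E) : Prop :=
  exists2 e, (1 < e)%N & ram_index f R e.

Definition prime_to_char (n : nat) : Prop :=
  forall p, p \in [pchar k] -> ~~ (p %| n)%N.

(* As k is algebraically closed, residue extensions are trivial and tameness  *)
(* only concerns the indices.                                                 *)
Definition tamely_ramified (f : funfield) : Prop :=
  forall R e, ram_index f R e -> prime_to_char e.

(* The function f_P is unique up to a constant factor, on which the           *)
(* ramification does not depend.                                              *)
Definition lame_of_order (P : point E) (n : nat) : Prop :=
  let O := zeropt E in
  [/\ (1 < n)%N, prime_to_char n, exact_order P n
    & exists f : funfield, exists Q : point E,
      [/\ has_divisor f (fun R => n%:Z *+ (R == P) - n%:Z *+ (R == O)),
          tamely_ramified f,
          Q != O /\ Q != P,
          forall R, ramified_at f R <-> (R = O \/ R = P \/ R = Q)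
        & [/\ ram_index f O n, ram_index f P n & ram_index f Q 3%N]]].

(* The restriction E - {0} -> A^1 of the cover given by r is finite: r is     *)
(* regular on E - {0}, whose ring of functions is a finite k[r]-module.       *)
Definition finite_off_zero (r : funfield) : Prop :=
  let reg f := forall R, R <> zeropt E -> regular_at R f in
  reg r /\
  exists n (s : 'I_n -> funfield), (forall i, reg (s i)) /\
    forall f, reg f -> exists c : 'I_n -> {poly k},
      f = \sum_i eval1 (c i) r * s i.

End EllipticCurves.

(* A k-isomorphism of elliptic curves, as an isomorphism of the underlying    *)
(* curves (a bijection on points, an isomorphism of function fields over k    *)
(* and the compatibility of the local rings) preserving the origin.           *)
Record ec_iso (k : fieldType) (E1 E2 : ellcurve k) := EcIso {
  ptmap : point E1 -> point E2;
  pullback : {rmorphism funfield E2 -> funfield E1};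
  ptmap_bij : bijective ptmap;
  pullback_bij : bijective pullback;
  pullback_cst : forall c, pullback (cst E2 c) = cst E1 c;
  pullback_reg : forall R f,
    regular_at R (pullback f) <-> regular_at (ptmap R) f;
  ptmap_zero : ptmap (zeropt E1) = zeropt E2
}.

(* r is a model of the projection E -> E/Isom_k(E): k(r) is the field of      *)
(* invariants of Isom_k(E) in k(E).                                           *)
Definition quotient_by_isom (k : fieldType) (E : ellcurve k) (r : funfield E) :=
  forall f : funfield E,
    (forall phi : ec_iso E E, pullback phi f = f) <->
    exists g h : {poly k}, eval1 h r != 0 /\ f = eval1 g r / eval1 h r.

Section Pairs.
Variable k : fieldType.

Record ecpair := EcPair { ecurve : ellcurve k; ecpoint : point ecurve }.

Definition is_lame (L : ecpair) : Prop :=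
  exists n, lame_of_order (ecpoint L) n.

Definition isomorphic (L1 L2 : ecpair) : Prop :=
  exists phi : ec_iso (ecurve L1) (ecurve L2),
    ptmap phi (ecpoint L1) = ecpoint L2.

Variable s : {rmorphism k -> k}.

Lemma discr_conj (E : ellcurve k) :
  discr (s (a1 E)) (s (a2 E)) (s (a3 E)) (s (a4 E)) (s (a6 E)) != 0.
Proof.
suff -> : discr (s (a1 E)) (s (a2 E)) (s (a3 E)) (s (a4 E)) (s (a6 E))
        = s (discr (a1 E) (a2 E) (a3 E) (a4 E) (a6 E)).
  by rewrite fmorph_eq0 discr_neq0.
by rewrite /discr; ring.
Qed.

Definition conj_curve (E : ellcurve k) : ellcurve k := EllCurve (discr_conj E).

Definition conj_coords (p : option (k * k)) : option (k * k) :=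
  omap (fun xy => (s xy.1, s xy.2)) p.

Lemma oncurve_conj (E : ellcurve k) (P : point E) :
  oncurve (conj_curve E) (conj_coords (val P)).
Proof.
case: P => -[[x y]|] //= /eqP h.
by apply/eqP; rewrite -!(rmorphXn, rmorphM) -!rmorphD h.
Qed.

Definition conj_point (E : ellcurve k) (P : point E) : point (conj_curve E) :=
  exist (oncurve (conj_curve E)) _ (oncurve_conj P).

Definition conj_pair (L : ecpair) : ecpair := EcPair (conj_point (ecpoint L)).

End Pairs.

Section TheCurve.
Variables (k : fieldType) (iota : {rmorphism 'F_2 -> k}).

Lemma discr_E0 : discr (0 : k) 0 1 0 0 != 0.
Proof.
have two0 : 2 = 0 :> k.
  by rewrite -(rmorph_nat iota) -(rmorph0 iota); congr (iota _); apply/val_inj.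
have -> : discr (0 : k) 0 1 0 0 = 1 - 2 * 14.
  rewrite /discr; ring.
by rewrite two0 mul0r subr0 oner_neq0.
Qed.

(* Y^2 + Y = X^3 *)
Definition E0 : ellcurve k := EllCurve discr_E0.

Definition rho_poly : {poly k} := ('X^4 + 'X) ^+ 3.

Definition rho : funfield E0 := eval1 rho_poly (fx E0).

(* The value of rho at an affine point; the value at 0 is irrelevant. *)
Definition rho_at (P : point E0) : k :=
  if val P is Some (x, y) then rho_poly.[x] else 0.

End TheCurve.

(* Main.v *)
From HB Require Import structures.
From mathcomp Require Import all_boot all_order all_algebra all_field ring zify.
Require Import Defs.
Set Implicit Arguments.
Unset Strict Implicit.
Unset Printing Implicit Defensive.
Import Order.TTheory GRing.Theory Num.Theory.
Local Open Scope ring_scope.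

(** Why the theorem is true.

    Let P be an affine point of E: y^2 + a1 xy + a3 y = x^3 + ..., in
    characteristic 2, and let f have divisor n(P) - n(O) with n odd. The lines
    through -P make k(E) a quadratic extension of k(u), u the slope: with
    Z = X - x(P) one has Z^2 = T(u) Z + S(u), where T = u^2 + a1 u + const
    and S is linear with leading coefficient b = a1 x(P) + a3. The conjugation
    over k(u) exchanges O and P, so f = A(u) + B(u) Z has constant norm:
      A^2 + A B T + B^2 S = c0     ([pencil_form]).
    Differentiating this equation in characteristic 2 kills the squares and
    leaves A (B' T + a1 B) = B (A' T + b B) with A and B coprime. Hence there is
    a polynomial v = X - tau with B' T + a1 B = v B and A' T + b B = v A, and it
    follows that B = v B' and T = v (v + a1) ([ram_slope]): the slope tau is one at which the two
    intersection points of the line coincide, in a point Q. Comparing the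
    multiplicities of tau in the norm equation gives the ramification of f at Q.
    - If a1 <> 0, the index is even ([wild_index]), so that f is not tame. Thus
      the curve of a Lame pair has a1 = 0 ([lame_a1_eq0]).
    - If a1 = 0, the index is 3 ([tame_index]); moreover T f' = v f for the
      derivation with u' = 1, so that f has no further ramification
      ([unramified]).
    On a curve with a1 = 0 no point has order 2, every point is torsion because
    k is algebraic over F_2 ([torsion_exists]), and the functions f exist by
    Miller's construction ([torsion_fun]). So the Lame pairs are exactly the
    pairs (E, P) with a1 = 0 and P <> O ([is_lameP]).

    Comparing poles at O, every isomorphism between curves with a1 = 0 is a
    substitution (x, y) -> (w^2 x + r, w^3 y + w^2 s x + t) ([miso_subst]), and
    conversely ([subst_iso]). Such substitutions take all these curves to
    Y^2 + Y = X^3 ([rel_to_E0]), and they preserve the invariant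
      (x(P) + x(2P))^3 / a3^2
    of a pair ([lame_inv]), which is a rational function over F_2 of the
    coefficients of E and of P and equals (x^4 + x)^3 on Y^2 + Y = X^3. Two
    points of this last curve with the same invariant are exchanged by an
    automorphism x -> w^2 x + r, where w^3 = 1 and r^4 = r ([E0_fiber]). This
    gives the bijection and its compatibility with the Galois action.

    The field of invariants of these automorphisms is k(rho) because x^4 + x is
    the monic polynomial with root set F_4, so that a polynomial in x invariant
    under x -> x + r is a constant plus a multiple of it ([inv_poly],
    [quotient_M]). Finiteness is division with remainder by the monic
    polynomial rho in k[x], together with k[E - O] = k[x] + k[x] y
    ([reg_affine], [finite_M]). *)

(** * The function field and its abstract model *)

Section FunctionField.
Variables (k : fieldType) (E : ellcurve k).
Local Notation K := (funfield E).

Definition infun (p : {poly {fraction {poly k}}}) : K := in_qpoly (weierstrass E) p.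

HB.instance Definition _ := GRing.RMorphism.copy infun (in_qpoly (weierstrass E)).

Definition kx (p : {poly k}) : K := infun (FracField.tofrac p)%:P.
HB.instance Definition _ := GRing.RMorphism.copy kx
  (infun \o (polyC \o @FracField.tofrac {poly k})).
HB.instance Definition _ := GRing.RMorphism.copy (cst E) (kx \o polyC).

Lemma kxC c : kx c%:P = cst E c. Proof. by []. Qed.
Lemma kxX : kx 'X = fx E. Proof. by []. Qed.

Lemma size_weierstrass : size (weierstrass E) = 3%N.
Proof.
have [_ m] := weierstrass_irr E.
rewrite /weierstrass -addrA size_polyDl size_polyXn //.
rewrite ltnS (leq_trans (size_polyD _ _)) // geq_max size_polyN.
rewrite (leq_trans (size_scale_leq _ _)) ?size_polyX //=.
by rewrite (leq_trans (size_polyC_leq1 _)).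
Qed.

Lemma mk_weierstrass : mk_monic (weierstrass E) = weierstrass E.
Proof.
by have [_ m] := weierstrass_irr E; rewrite /mk_monic size_weierstrass m.
Qed.

Definition wlin : {poly k} := a1 E *: 'X + (a3 E)%:P.
Definition wcub : {poly k} :=
  'X^3 + a2 E *: 'X^2 + a4 E *: 'X + (a6 E)%:P.


Lemma kxZ c p : kx (c *: p) = cst E c * kx p.
Proof. by rewrite -mul_polyC (rmorphM kx). Qed.
Lemma kxXn n : kx 'X^n = fx E ^+ n.
Proof. exact: (rmorphXn kx). Qed.
Lemma kxD p q : kx (p + q) = kx p + kx q.
Proof. exact: (rmorphD kx). Qed.
Lemma kxM p q : kx (p * q) = kx p * kx q.
Proof. exact: (rmorphM kx). Qed.
Lemma kx0 : kx 0 = 0. Proof. exact: (rmorph0 kx). Qed.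
Lemma kxlin : kx wlin = cst E (a1 E) * fx E + cst E (a3 E).
Proof. by rewrite /wlin kxD kxZ kxC kxX. Qed.
Lemma kxcub : kx wcub = fx E ^+ 3 + cst E (a2 E) * fx E ^+ 2
   + cst E (a4 E) * fx E + cst E (a6 E).
Proof. by rewrite /wcub !kxD !kxZ !kxXn kxC kxX. Qed.

Lemma infunD p q : infun (p + q) = infun p + infun q.
Proof. exact: (rmorphD infun). Qed.
Lemma infunM p q : infun (p * q) = infun p * infun q.
Proof. exact: (rmorphM infun). Qed.
Lemma infunB p q : infun (p - q) = infun p - infun q.
Proof. exact: (rmorphB infun). Qed.
Lemma infunXn n : infun 'X^n = fy E ^+ n.
Proof. exact: (rmorphXn infun). Qed.
Lemma infun_weierstrass : infun (weierstrass E) = 0.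
Proof.
apply/val_inj; rewrite /infun /= mk_weierstrass.
have m : weierstrass E \is monic by have [] := weierstrass_irr E.
exact: (Pdiv.RingMonic.rmodpp m).
Qed.

Lemma fy_sqr : fy E ^+ 2 = kx wcub - kx wlin * fy E.
Proof.
have tD (p q : {poly k}) : FracField.tofrac (p + q) = FracField.tofrac p + FracField.tofrac q.
  exact: rmorphD.
have tM (p q : {poly k}) : FracField.tofrac (p * q) = FracField.tofrac p * FracField.tofrac q.
  exact: rmorphM.
have tX n : FracField.tofrac ('X^n : {poly k}) = FracField.tofrac 'X ^+ n.
  exact: rmorphXn.
have wE : weierstrass E = 'X^2 + (FracField.tofrac wlin)%:P * 'X - (FracField.tofrac wcub)%:P.
  by rewrite /wlin /wcub /weierstrass -!mul_polyC !tD !(tM _%:P) !tX.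
apply/eqP; rewrite -subr_eq0 opprB addrA; apply/eqP.
rewrite -infun_weierstrass wE.
have e (p q : {poly {fraction {poly k}}}) :
    infun ('X^2 + p * 'X - q) = fy E ^+ 2 + infun p * fy E - infun q.
  by rewrite infunB infunD infunXn infunM.
by rewrite (e (_)%:P (_)%:P).
Qed.

Definition wpe (a b : {poly k}) : K := kx a + kx b * fy E.

Lemma in_qpoly_lin (r s : {fraction {poly k}}) : 
  (in_qpoly (weierstrass E) (r%:P + s *: 'X) : {poly _}) = r%:P + s *: 'X.
Proof.
rewrite in_qpoly_small // mk_weierstrass size_weierstrass.
rewrite ltnS (leq_trans (size_polyD _ _)) // geq_max.
rewrite (leq_trans (size_polyC_leq1 _)) //=.
by rewrite (leq_trans (size_scale_leq _ _)) ?size_polyX.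
Qed.

Lemma wpeE a b : wpe a b = in_qpoly (weierstrass E)
   ((FracField.tofrac a)%:P + FracField.tofrac b *: 'X).
Proof. by rewrite /wpe in_qpolyD -mul_polyC in_qpolyM. Qed.

Lemma lin_eq0 (F : fieldType) (r t : F) :
  r%:P + t *: 'X = 0 -> r = 0 /\ t = 0.
Proof.
move=> h; split.
  by have := congr1 (coefp 0) h; rewrite /= !coefE mulr0 addr0.
by have := congr1 (coefp 1) h; rewrite /= !coefE mulr1 add0r.
Qed.

Lemma tofrac_eq00 (p : {poly k}) : FracField.tofrac p = 0 -> p = 0.
Proof. by move/eqP; rewrite tofrac_eq0 => /eqP. Qed.

Lemma wpe_eq0 a b : wpe a b = 0 -> a = 0 /\ b = 0.
Proof.
rewrite wpeE => /(congr1 (fun q : {poly %/ _} => (q : {poly _}))).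
rewrite in_qpoly_lin => /lin_eq0 [h1 h2].
by split; apply: tofrac_eq00.
Qed.

Lemma kx_eq0 p : (kx p == 0) = (p == 0).
Proof.
apply/eqP/eqP => [h|->]; last exact: kx0.
by have [] := @wpe_eq0 p 0; rewrite // /wpe h kx0 mul0r addr0.
Qed.

Lemma size2_lin (F : fieldType) (g : {poly F}) :
  (size g <= 2)%N -> g = (g`_0)%:P + g`_1 *: 'X.
Proof.
move=> sg; apply/polyP => [[|[|i]]]; rewrite !coefE ?mulr0 ?addr0 ?mulr1 ?add0r //.
by rewrite nth_default ?mulr0 // (leq_trans sg).
Qed.

Lemma lin_mulC (F : fieldType) (r t u v : F) :
  (r%:P + t *: 'X) * (u * v)%:P = (r * u * v)%:P + (t * v * u) *: 'X.
Proof. by rewrite -!mul_polyC !polyCM; ring. Qed.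

Lemma infun_surj (f : K) : exists r t, f = infun (r%:P + t *: 'X).
Proof.
pose g : {poly {fraction {poly k}}} := (f : {poly %/ weierstrass E}).
have sg : (size g < size (mk_monic (weierstrass E)))%N.
  exact: (size_mk_monic (f : {poly %/ weierstrass E})).
have fE : f = infun g by apply/val_inj; rewrite /infun [RHS]in_qpoly_small.
have {}sg : (size g <= 2)%N by move: sg; rewrite mk_weierstrass size_weierstrass.
by exists g`_0, g`_1; rewrite -(size2_lin sg).
Qed.

Lemma funfield_repr (f : K) : exists a b d, d != 0 /\ f = wpe a b / kx d.
Proof.
have [r [t ->]] := infun_surj f.
have [n0 [d0 [d00 e0]]] := fracE r.
have [n1 [d1 [d10 e1]]] := fracE t.
exists (n0 * d1), (n1 * d0), (d0 * d1); split; first by rewrite mulf_neq0.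
apply/esym; apply: (canLR (mulfK _)); first by rewrite kx_eq0 mulf_neq0.
have tM (p q : {poly k}) : FracField.tofrac (p * q) = FracField.tofrac p * FracField.tofrac q.
  exact: rmorphM.
rewrite wpeE /kx -infunM; congr infun; rewrite !tM -e0 -e1 {e0 e1}.
move: r t (FracField.tofrac d0) (FracField.tofrac d1) => r t u v.
by rewrite lin_mulC.
Qed.


Lemma eval1_fx p : eval1 p (fx E) = kx p.
Proof.
elim/poly_ind: p => [|p c IH]; first by rewrite /eval1 rmorph0 horner0 kx0.
rewrite /eval1 rmorphD rmorphM /= map_polyX map_polyC hornerD hornerM hornerX hornerC.
by rewrite -/(eval1 p _) IH kxD kxM.
Qed.

End FunctionField.

(** A function field of E is described by its constants, its two generators,
    their equation, and the fact that 1 and Y form a basis over k(X). Everything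
    below is proved for such a model: computations then take place in an opaque
    field instead of a quotient of a polynomial ring over a fraction field. *)
Record funmodel (k : fieldType) (E : ellcurve k) := FunModel {
  mfield :> fieldType;
  mcst : {rmorphism k -> mfield};
  mX : mfield;
  mY : mfield;
  m_eq : mY ^+ 2 + mcst (a1 E) * mX * mY + mcst (a3 E) * mY =
   mX ^+ 3 + mcst (a2 E) * mX ^+ 2 + mcst (a4 E) * mX + mcst (a6 E);
  m_repr : forall f : mfield, exists a b d : {poly k}, d != 0 /\
     f = ((map_poly mcst a).[mX] + (map_poly mcst b).[mX] * mY)
          / (map_poly mcst d).[mX];
  m_free : forall a b : {poly k},
     (map_poly mcst a).[mX] + (map_poly mcst b).[mX] * mY = 0 -> a = 0 /\ b = 0
}.

Lemma sqr_cub_eq (R : comPzRingType) (y q1 q2 q3 : R) :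
  y ^+ 2 = q1 - (q2 + q3) * y -> y ^+ 2 + q2 * y + q3 * y = q1.
Proof. by move=> ->; ring. Qed.

Lemma funfield_eq (k : fieldType) (E : ellcurve k) : let c := cst E in
 fy E ^+ 2 + c (a1 E) * fx E * fy E + c (a3 E) * fy E =
   fx E ^+ 3 + c (a2 E) * fx E ^+ 2 + c (a4 E) * fx E + c (a6 E).
Proof.
move=> c; have := fy_sqr E; rewrite kxlin kxcub => /sqr_cub_eq e.
exact: e.
Qed.

Lemma funfield_repr1 (k : fieldType) (E : ellcurve k) (f : funfield E) :
  exists a b d : {poly k}, d != 0 /\
     f = (eval1 a (fx E) + eval1 b (fx E) * fy E) / eval1 d (fx E).
Proof.
have [a [b [d [d0 ->]]]] := funfield_repr f.
by exists a, b, d; split=> //; rewrite !eval1_fx.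
Qed.

Lemma funfield_free (k : fieldType) (E : ellcurve k) (a b : {poly k}) :
  eval1 a (fx E) + eval1 b (fx E) * fy E = 0 -> a = 0 /\ b = 0.
Proof. by rewrite !eval1_fx; apply: wpe_eq0. Qed.

Definition Mfun (k : fieldType) (E : ellcurve k) : funmodel E :=
  @FunModel k E (funfield E) (cst E) (fx E) (fy E) (funfield_eq E)
    (@funfield_repr1 k E) (@funfield_free k E).

(** * Values of functions at points *)
Section PolySize.
Variable R : fieldType.
Implicit Types p q r : {poly R}.
Lemma szD p q n : (size p <= n)%N -> (size q <= n)%N -> (size (p + q)%R <= n)%N.
Proof. by move=> hp hq; rewrite (leq_trans (size_polyD _ _)) // geq_max hp. Qed.
Lemma szN p n : (size p <= n)%N -> (size (- p)%R <= n)%N.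
Proof. by rewrite size_polyN. Qed.
Lemma szM p q n :
  ((0 < size p)%N -> (0 < size q)%N -> ((size p + size q).-1 <= n)%N) ->
  (size (p * q)%R <= n)%N.
Proof.
have [->|p0] := eqVneq p 0; first by rewrite mul0r size_poly0.
have [->|q0] := eqVneq q 0; first by rewrite mulr0 size_poly0.
by rewrite !size_poly_gt0 size_mul // => /(_ p0 q0).
Qed.
Lemma szM3 p q r n :
  ((0 < size p)%N -> (0 < size q)%N -> (0 < size r)%N ->
   ((size p + size q).-1 + size r).-1 <= n)%N ->
  (size (p * q * r)%R <= n)%N.
Proof.
move=> h; apply: szM => + hr.
have [->|p0] := eqVneq p 0; first by rewrite mul0r size_poly0.
have [->|q0] := eqVneq q 0; first by rewrite mulr0 size_poly0.
by rewrite size_mul // => _; apply: h => //; rewrite size_poly_gt0.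
Qed.
Lemma szZ a p n : (size p <= n)%N -> (size (a *: p)%R <= n)%N.
Proof. exact: leq_trans (size_scale_leq _ _). Qed.
End PolySize.

Section Evaluation.
Variables (k K : fieldType) (c : {rmorphism k -> K}).

Definition ev1 (g : {poly k}) (u : K) : K := (map_poly c g).[u].
Definition ev2 (g : {poly {poly k}}) (u v : K) : K :=
  (map_poly (map_poly c) g).[u, v].

Lemma ev1D u p q : ev1 (p + q) u = ev1 p u + ev1 q u.
Proof. by rewrite /ev1 rmorphD hornerD. Qed.
Lemma ev1N u p : ev1 (- p) u = - ev1 p u.
Proof. by rewrite /ev1 rmorphN hornerN. Qed.
Lemma ev1M u p q : ev1 (p * q) u = ev1 p u * ev1 q u.
Proof. by rewrite /ev1 rmorphM hornerM. Qed.
Lemma ev1Z u a p : ev1 (a *: p) u = c a * ev1 p u.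
Proof. by rewrite /ev1 linearZ hornerZ. Qed.
Lemma ev1C u a : ev1 a%:P u = c a.
Proof. by rewrite /ev1 map_polyC hornerC. Qed.
Lemma ev1X u : ev1 'X u = u.
Proof. by rewrite /ev1 map_polyX hornerX. Qed.
Lemma ev1Xn u n : ev1 'X^n u = u ^+ n.
Proof. by rewrite /ev1 map_polyXn hornerXn. Qed.
Lemma ev1_exp u p n : ev1 (p ^+ n) u = ev1 p u ^+ n.
Proof. by rewrite /ev1 rmorphXn horner_exp. Qed.
Lemma ev1_0 u : ev1 0 u = 0. Proof. by rewrite /ev1 rmorph0 horner0. Qed.
Lemma ev1_1 u : ev1 1 u = 1. Proof. by rewrite /ev1 rmorph1 hornerC. Qed.

Lemma ev2D u v p q : ev2 (p + q) u v = ev2 p u v + ev2 q u v.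
Proof. by rewrite /ev2 rmorphD !hornerD. Qed.
Lemma ev2M u v p q : ev2 (p * q) u v = ev2 p u v * ev2 q u v.
Proof. by rewrite /ev2 rmorphM !hornerM. Qed.
Lemma ev2C u v q : ev2 q%:P u v = ev1 q v.
Proof. by rewrite /ev2 map_polyC hornerC. Qed.
Lemma ev2X u v : ev2 'X u v = u.
Proof. by rewrite /ev2 map_polyX hornerX hornerC. Qed.
Lemma ev2N u v p : ev2 (- p) u v = - ev2 p u v.
Proof. by rewrite /ev2 rmorphN !hornerN. Qed.
Lemma ev2_0 u v : ev2 0 u v = 0. Proof. by rewrite -polyC0 ev2C ev1_0. Qed.

End Evaluation.

Section Model.
Variables (k : fieldType) (E : ellcurve k) (M : funmodel E).
Local Notation K := (mfield M).
Local Notation c := (mcst M).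
Local Notation X := (mX M).
Local Notation Y := (mY M).
Local Notation "p @ u" := (ev1 (mcst M) p u) (at level 10).

(** These are the local notions of the theorem, stated over a model; at the
    model [Mfun E] they are convertible to the original ones. *)
Definition mchart (R : point E) : K * K :=
  if val R is Some _ then (X, Y) else (X / Y, Y^-1).
Definition mquot (R : point E) (f : K) (g h : {poly {poly k}}) :=
  let: (u, v) := mchart R in let: (a, b) := coords R in
  h.[a, b] != 0 /\ f = ev2 c g u v / ev2 c h u v.
Definition mreg (R : point E) (f : K) : Prop := exists g h, mquot R f g h.
Definition mvan (R : point E) (f : K) : Prop :=
  exists g h, mquot R f g h /\ (let: (a, b) := coords R in g.[a, b] = 0).
Definition munif (R : point E) (t : K) : Prop :=
  mvan R t /\ forall f, mvan R f -> exists2 u, mreg R u & f = u * t.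
Definition mord (R : point E) (f : K) (m : int) : Prop :=
  exists t u, [/\ munif R t, mreg R u, ~ mvan R u & f = u * t ^ m].

(** Y satisfies Y^2 + linp(X) Y = cubp(X). The definitions are locked because
    the normalization of ring expressions would otherwise expand them. *)
Definition linp : {poly k} := locked (a1 E *: 'X + (a3 E)%:P).
Definition cubp : {poly k} :=
  locked ('X^3 + a2 E *: 'X^2 + a4 E *: 'X + (a6 E)%:P).

Lemma size_linp : (size linp <= 2)%N.
Proof.
rewrite /linp -lock (leq_trans (size_polyD _ _)) // geq_max.
by rewrite (leq_trans (size_scale_leq _ _)) ?size_polyX // (leq_trans (size_polyC_leq1 _)).
Qed.
Lemma size_cubp : size cubp = 4%N.
Proof.
rewrite /cubp -lock -!addrA size_polyDl size_polyXn //.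
rewrite ltnS !(leq_trans (size_polyD _ _)) // geq_max.
rewrite (leq_trans (size_scale_leq _ _)) ?size_polyXn //=.
rewrite (leq_trans (size_polyD _ _)) // geq_max.
rewrite (leq_trans (size_scale_leq _ _)) ?size_polyX //=.
by rewrite (leq_trans (size_polyC_leq1 _)).
Qed.
Lemma ev1lin (L : fieldType) (d : {rmorphism k -> L}) u :
  ev1 d linp u = d (a1 E) * u + d (a3 E).
Proof. by rewrite /linp -lock ev1D ev1Z ev1X ev1C. Qed.
Lemma ev1cub (L : fieldType) (d : {rmorphism k -> L}) u :
  ev1 d cubp u = u ^+ 3 + d (a2 E) * u ^+ 2 + d (a4 E) * u + d (a6 E).
Proof. by rewrite /cubp -lock !ev1D !ev1Z ev1X !ev1Xn ev1C. Qed.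
Lemma horner_linp x : linp.[x] = a1 E * x + a3 E.
Proof. by rewrite /linp -lock !hornerE. Qed.
Lemma horner_cubp x : cubp.[x] = x ^+ 3 + a2 E * x ^+ 2 + a4 E * x + a6 E.
Proof. by rewrite /cubp -lock !hornerE. Qed.

Lemma m_sqr : Y ^+ 2 = cubp @ X - linp @ X * Y.
Proof. by rewrite ev1cub ev1lin -(m_eq M); ring. Qed.

Definition pe (a b : {poly k}) : K := a @ X + b @ X * Y.

Lemma pe_free a b : pe a b = 0 -> a = 0 /\ b = 0.
Proof. exact: m_free. Qed.
Lemma pe_repr f : exists a b d, d != 0 /\ f = pe a b / d @ X.
Proof. exact: m_repr. Qed.
Lemma peD a b a' b' : pe (a + a') (b + b') = pe a b + pe a' b'.
Proof. by rewrite /pe !ev1D; ring. Qed.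
Lemma peB a b a' b' : pe (a - a') (b - b') = pe a b - pe a' b'.
Proof. by rewrite /pe !ev1D !ev1N; ring. Qed.
Lemma pe_inj a b a' b' : pe a b = pe a' b' -> a = a' /\ b = b'.
Proof.
move/eqP; rewrite -subr_eq0 -peB => /eqP/pe_free [h h'].
by split; apply/subr0_eq.
Qed.
Lemma peM a b a' b' : pe a b * pe a' b' =
  pe (a * a' + b * b' * cubp) (a * b' + a' * b - b * b' * linp).
Proof. rewrite /pe !(ev1D, ev1N, ev1M); ring: m_sqr. Qed.
Lemma pe0 p : pe p 0 = p @ X.
Proof. by rewrite /pe ev1_0 mul0r addr0. Qed.
Lemma pe_ev1M q a b : q @ X * pe a b = pe (q * a) (q * b).
Proof. by rewrite /pe !ev1M; ring. Qed.
Lemma peY a b : pe a b * Y = pe (b * cubp) (a - b * linp).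
Proof. rewrite /pe !(ev1D, ev1N, ev1M); ring: m_sqr. Qed.
Lemma peC a : pe a%:P 0 = c a. Proof. by rewrite pe0 ev1C. Qed.
Lemma pe_01 : pe 0 1 = Y. Proof. by rewrite /pe ev1_0 ev1_1; ring. Qed.
Lemma evX_eq0 p : (p @ X == 0) = (p == 0).
Proof.
apply/eqP/eqP => [h|->]; last exact: ev1_0.
by have [] := @pe_free p 0; rewrite // pe0.
Qed.
Lemma evX_inj p q : p @ X = q @ X -> p = q.
Proof. by rewrite -!pe0 => /pe_inj []. Qed.
Lemma mY_neq0 : Y != 0.
Proof.
apply/eqP; rewrite -pe_01 => /pe_free [_ /eqP]; by rewrite oner_eq0.
Qed.


Lemma ev1_Y_pe q : exists A B : {poly k}, q @ Y = pe A B /\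
  forall x y, oncurve E (Some (x, y)) -> A.[x] + B.[x] * y = q.[y].
Proof.
elim/poly_ind: q => [|q a [A [B [e h]]]].
  exists 0, 0; split; first by rewrite ev1_0 pe0 ev1_0.
  by move=> x y _; rewrite !hornerE.
exists (B * cubp + a%:P), (A - B * linp); split.
  by rewrite ev1D ev1M ev1X ev1C e peY -peC -peD addr0.
move=> x y xy; rewrite !hornerE horner_cubp horner_linp -(h _ _ xy).
by move: xy => /= /eqP xy; rewrite -xy; ring.
Qed.

(** Reduction modulo the Weierstrass equation is compatible with evaluation at
    the points of the curve. *)
Lemma ev2_pe G : exists A B : {poly k}, ev2 c G X Y = pe A B /\
  forall x y, oncurve E (Some (x, y)) -> A.[x] + B.[x] * y = G.[x, y].
Proof.
elim/poly_ind: G => [|G q [A [B [e h]]]].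
  exists 0, 0; split; first by rewrite ev2_0 pe0 ev1_0.
  by move=> x y _; rewrite !hornerE.
have [A' [B' [e' h']]] := ev1_Y_pe q.
exists ('X * A + A'), ('X * B + B'); split.
  by rewrite ev2D ev2M ev2X ev2C e e' peD -pe_ev1M ev1X mulrC.
by move=> x y xy; rewrite !hornerE -(h _ _ xy) -(h' _ _ xy); ring.
Qed.

(** X has a double and Y a triple pole at infinity; the bounds on the degrees
    say that the numerator has a smaller pole there than the denominator. This
    is the vanishing at infinity, phrased without a local ring. *)
Definition minf (f : K) : Prop := exists A B d : {poly k},
  [/\ (size A < size d)%N, ((size B).+1 < size d)%N & f = pe A B / d @ X].

Lemma minfD f g : minf f -> minf g -> minf (f + g).
Proof.
move=> [A [B [d [h1 h2 ->]]]] [A' [B' [d' [h1' h2' ->]]]].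
have d0 : d != 0 by rewrite -size_poly_gt0; lia.
have d0' : d' != 0 by rewrite -size_poly_gt0; lia.
exists (d' * A + d * A'), (d' * B + d * B'), (d * d').
have -> : size (d * d') = (size d + size d').-1 by exact: size_mul.
split.
- apply: leq_ltn_trans (_ : (size d + size d').-2 < _)%N; last by lia.
  by apply: szD; apply: szM; lia.
- by apply: leq_ltn_trans (_ : (size d + size d').-2 < _)%N; [ | lia];
  have -> : (size d + size d').-2 = (size d + size d').-2.-1.+1 by [lia];
  rewrite ltnS; apply: szD; apply: szM; lia.
rewrite peD -!pe_ev1M ev1M.
have := evX_eq0 d; have := evX_eq0 d'; rewrite (negPf d0) (negPf d0').
by move=> /negbT e1 /negbT e2; field; rewrite e1 e2.
Qed.

Lemma minfM f g : minf f -> minf g -> minf (f * g).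
Proof.
move=> [A [B [d [h1 h2 ->]]]] [A' [B' [d' [h1' h2' ->]]]].
have d0 : d != 0 by rewrite -size_poly_gt0; lia.
have d0' : d' != 0 by rewrite -size_poly_gt0; lia.
exists (A * A' + B * B' * cubp), (A * B' + A' * B - B * B' * linp), (d * d').
have -> : size (d * d') = (size d + size d').-1 by exact: size_mul.
have s7 := size_linp; have s8 := size_cubp.
split.
- apply: leq_ltn_trans (_ : (size d + size d').-2 < _)%N; last by lia.
  by apply: szD; [apply: szM | apply: szM3]; lia.
- apply: leq_ltn_trans (_ : (size d + size d').-2 < _)%N; last by lia.
  have -> : (size d + size d').-2 = (size d + size d').-2.-1.+1 by lia.
  rewrite ltnS; apply: szD; [apply: szD; apply: szM | apply/szN/szM3]; lia.
by rewrite -peM ev1M mulf_div.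
Qed.

Lemma minfZ a f : minf f -> minf (c a * f).
Proof.
move=> [A [B [d [h1 h2 ->]]]]; exists (a *: A), (a *: B), d; split.
- by rewrite (leq_ltn_trans (size_scale_leq _ _)).
- by rewrite (leq_ltn_trans _ h2) // ltnS size_scale_leq.
by rewrite -!mul_polyC -pe_ev1M ev1C mulrA.
Qed.

Lemma minf0 : minf 0.
Proof.
by exists 0, 0, 'X; rewrite size_poly0 size_polyX; split; rewrite // pe0 ev1_0 mul0r.
Qed.

Lemma minf_cst a : minf (c a) -> a = 0.
Proof.
move=> [A [B [d [h1 h2 h3]]]].
have d0 : d != 0 by rewrite -size_poly_gt0; lia.
have : d @ X * pe a%:P 0 = pe A B.
  by rewrite peC h3 mulrCA mulfV ?mulr1 // evX_eq0.
rewrite pe_ev1M => /pe_inj [e _]; apply/eqP/negPn/negP => a0.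
by move: h1; rewrite -e mulrC mul_polyC size_scale // ltnn.
Qed.

Lemma invY : Y^-1 = pe linp 1 / cubp @ X.
Proof.
have c0 : cubp @ X != 0 by rewrite evX_eq0 -size_poly_gt0 size_cubp.
apply: (mulfI mY_neq0); rewrite mulfV ?mY_neq0 // mulrA [Y * _]mulrC peY.
by rewrite !mul1r subrr pe0 mulfV.
Qed.

Lemma minf_w : minf Y^-1.
Proof.
exists linp, 1, cubp; rewrite size_cubp size_poly1 invY; split => //.
exact: leq_trans size_linp _.
Qed.
Lemma minf_z : minf (X / Y).
Proof.
exists ('X * linp), ('X * 1), cubp; rewrite mulr1 size_cubp size_polyX invY; split => //.
  by rewrite ltnS; apply: szM => _ _; rewrite size_polyX; have := size_linp; lia.
by rewrite mulrA -{2}(mulr1 'X) -pe_ev1M ev1X.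
Qed.

Lemma minf_ev1 q : minf (q @ Y^-1 - c q.[0]).
Proof.
elim/poly_ind: q => [|q a IH].
  by rewrite ev1_0 horner0 rmorph0 subrr; apply: minf0.
rewrite ev1D ev1M ev1X ev1C hornerD hornerM hornerX hornerC mulr0 add0r addrK.
rewrite -(subrK (c q.[0]) (q @ _)) mulrDl; apply: minfD.
  by apply: minfM => //; apply: minf_w.
by apply: minfZ; apply: minf_w.
Qed.

Lemma minf_ev2 G : minf (ev2 c G (X / Y) Y^-1 - c G.[0, 0]).
Proof.
elim/poly_ind: G => [|G q IH].
  by rewrite ev2_0 !horner0 rmorph0 subrr; apply: minf0.
rewrite ev2D ev2M ev2X ev2C !(hornerD, hornerM, hornerX, hornerC) mulr0 add0r.
rewrite -addrA; apply: minfD; last exact: minf_ev1.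
rewrite -(subrK (c G.[0, 0]) (ev2 _ _ _ _)) mulrDl; apply: minfD.
  by apply: minfM => //; apply: minf_z.
by apply: minfZ; apply: minf_z.
Qed.

(** The value of a function at R does not depend on the fraction that
    represents it: a polynomial in the coordinates that is zero as a function
    takes the value zero at R. At an affine point this is the freeness of
    k[X, Y] over k[X]; at infinity the constant term would be a constant
    vanishing at infinity in the sense of [minf]. *)
Lemma chart_eval0 R G :
  ev2 c G (mchart R).1 (mchart R).2 = 0 -> G.[(coords R).1, (coords R).2] = 0.
Proof.
case: R => -[[x y]|] xy; rewrite /mchart /coords /=.
  have [A [B [-> h]]] := ev2_pe G => /pe_free [A0 B0].
  by rewrite -(h _ _ xy) A0 B0 !hornerE.
move=> e; apply: minf_cst; have := minfZ (-1) (minf_ev2 G).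
by rewrite e sub0r rmorphN rmorph1 mulN1r opprK.
Qed.

Section Local.
Variable R : point E.
Local Notation u := (mchart R).1.
Local Notation v := (mchart R).2.
Local Notation a := (coords R).1.
Local Notation b := (coords R).2.

Definition mval (f : K) (y : k) : Prop := exists g h,
  [/\ h.[a, b] != 0, f = ev2 c g u v / ev2 c h u v & g.[a, b] = y * h.[a, b]].

Lemma mquotP f g h :
  mquot R f g h <-> h.[a, b] != 0 /\ f = ev2 c g u v / ev2 c h u v.
Proof. by rewrite /mquot; case: (mchart R) (coords R) => ? ? []. Qed.

Lemma mregP f : mreg R f <-> exists y, mval f y.
Proof.
split=> [[g [h /mquotP [h0 ->]]]|[y [g [h [h0 -> _]]]]].
  by exists (g.[a, b] / h.[a, b]), g, h; rewrite mulfVK.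
by exists g, h; apply/mquotP.
Qed.

Lemma mvanP f : mvan R f <-> mval f 0.
Proof.
split=> [[g [h [/mquotP [h0 ->]]]]|[g [h [h0 fE ge]]]].
  by rewrite [coords R]surjective_pairing => e; exists g, h; rewrite mul0r.
exists g, h; split; first by apply/mquotP.
by rewrite [coords R]surjective_pairing ge mul0r.
Qed.

Lemma chart_eval_neq0 h : h.[a, b] != 0 -> ev2 c h u v != 0.
Proof. by apply: contraNneq => /chart_eval0/eqP. Qed.

Lemma val_uniq f y z : mval f y -> mval f z -> y = z.
Proof.
move=> [g [h [h0 -> e]]] [g' [h' [h0' e1 e']]].
have := chart_eval_neq0 h0; have := chart_eval_neq0 h0' => n' n.
have := @chart_eval0 R (g * h' - g' * h).
rewrite ev2D ev2N !ev2M.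
move: e1 => /eqP; rewrite eqr_div // => /eqP ->; rewrite subrr => /(_ erefl).
rewrite !(hornerE, hornerM) e e' => /eqP.
have -> : y * h.[a, b] * h'.[a, b] - z * h'.[a, b] * h.[a, b]
   = (y - z) * (h.[a, b] * h'.[a, b]) by ring.
by rewrite !mulf_eq0 (negPf h0) (negPf h0') !orbF subr_eq0 => /eqP.
Qed.

Lemma val_cst y : mval (c y) y.
Proof.
exists (y%:P)%:P, 1%:P%:P; rewrite !ev2C !ev1C !hornerC rmorph1 divr1 mulr1.
by rewrite oner_neq0.
Qed.

Lemma val_add f g y z : mval f y -> mval g z -> mval (f + g) (y + z).
Proof.
move=> [g1 [h [h0 -> e]]] [g2 [h' [h0' -> e']]].
exists (g1 * h' + g2 * h), (h * h'); rewrite !(hornerD, hornerM) mulf_neq0 //.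
rewrite ev2D !ev2M e e' addf_div ?chart_eval_neq0 //; split=> //; ring.
Qed.

Lemma val_mul f g y z : mval f y -> mval g z -> mval (f * g) (y * z).
Proof.
move=> [g1 [h [h0 -> e]]] [g2 [h' [h0' -> e']]].
exists (g1 * g2), (h * h'); rewrite !hornerM mulf_neq0 // !ev2M mulf_div e e'.
by split=> //; ring.
Qed.

Lemma val_inv f y : mval f y -> y != 0 -> mval f^-1 y^-1.
Proof.
move=> [g [h [h0 -> e]]] y0; exists h, g; split.
- by rewrite e mulf_neq0.
- by rewrite invf_div.
by rewrite e mulKf.
Qed.

Lemma val_opp f y : mval f y -> mval (- f) (- y).
Proof.
by move=> h; rewrite -mulN1r -[- y]mulN1r; apply: val_mul => //;
  rewrite -(rmorph1 c) -rmorphN; apply: val_cst.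
Qed.

Lemma val_sub f g y z : mval f y -> mval g z -> mval (f - g) (y - z).
Proof. by move=> h1 h2; apply: val_add => //; apply: val_opp. Qed.

Lemma val_neq0 f y : mval f y -> y != 0 -> f != 0.
Proof.
move=> h; apply: contraNneq => f0; apply/eqP; apply: val_uniq h _.
by rewrite f0 -(rmorph0 c); apply: val_cst.
Qed.

Lemma val_0 : mval 0 0.
Proof. by rewrite -(rmorph0 c); apply: val_cst. Qed.

Lemma val_exp f y n : mval f y -> mval (f ^+ n) (y ^+ n).
Proof.
move=> h; elim: n => [|n IH]; last by rewrite !exprS; apply: val_mul.
by rewrite !expr0 -(rmorph1 c); apply: val_cst.
Qed.

Lemma val_ev1 p f y : mval f y -> mval (ev1 c p f) p.[y].
Proof.
move=> h; elim/poly_ind: p => [|p q IH].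
  by rewrite ev1_0 horner0; apply: val_0.
rewrite ev1D ev1M ev1X ev1C hornerD hornerM hornerX hornerC.
by apply: val_add; [apply: val_mul | apply: val_cst].
Qed.

Lemma val_ev2 G f g y z : mval f y -> mval g z -> mval (ev2 c G f g) G.[y, z].
Proof.
move=> h h'; elim/poly_ind: G => [|p q IH].
  by rewrite ev2_0 !horner0; apply: val_0.
rewrite ev2D ev2M ev2X ev2C !(hornerD, hornerM, hornerX, hornerC).
by apply: val_add; [apply: val_mul | apply: val_ev1].
Qed.

Lemma val_chart : mval u a /\ mval v b.
Proof.
split; [exists 'X, 1%:P%:P | exists ('X)%:P, 1%:P%:P];
  rewrite ?(ev2X, ev2C, ev1X, ev1C, hornerX, hornerC, rmorph1) divr1 mulr1;
  by rewrite oner_neq0.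
Qed.

Lemma mreg_val f y : mval f y -> mreg R f.
Proof. by move=> h; apply/mregP; exists y. Qed.

Lemma mreg_mul f g : mreg R f -> mreg R g -> mreg R (f * g).
Proof.
by move=> /mregP [y hy] /mregP [z hz]; apply: mreg_val (val_mul hy hz).
Qed.
Lemma mreg_add f g : mreg R f -> mreg R g -> mreg R (f + g).
Proof.
by move=> /mregP [y hy] /mregP [z hz]; apply: mreg_val (val_add hy hz).
Qed.
Lemma mreg_cst y : mreg R (c y). Proof. exact: mreg_val (val_cst y). Qed.
Lemma mval_sub_cst f y : mval f y <-> mvan R (f - c y).
Proof.
split=> [h|/mvanP h]; first by apply/mvanP; rewrite -(subrr y); apply: val_sub (val_cst _).
by have := val_add h (val_cst y); rewrite subrK add0r.
Qed.
Lemma mvan_mul f g : mreg R f -> mvan R g -> mvan R (f * g).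
Proof.
move=> /mregP [y hy] /mvanP hg; apply/mvanP.
by rewrite -(mulr0 y); apply: val_mul.
Qed.
Lemma unitP f : mreg R f -> ~ mvan R f -> exists2 y, y != 0 & mval f y.
Proof.
move=> /mregP [y hy] nv; exists y => //; apply/eqP => y0; apply: nv.
by apply/mvanP; rewrite -y0.
Qed.

(** The maximal ideal of the local ring is generated by the two local
    coordinates, so by the first one alone as soon as it divides the second
    ([munif_chart]). *)
Lemma chart_decomp G : exists r1 r2, [/\ mreg R r1, mreg R r2 &
  ev2 c G u v - c G.[a, b] = r1 * (u - c a) + r2 * (v - c b)].
Proof.
have [hu hv] := val_chart.
have r0 : mreg R 0 := mreg_val val_0.
have ev1_dec q : exists2 r, mreg R r & ev1 c q v - c q.[b] = r * (v - c b).
  elim/poly_ind: q => [|q y [r rr e]].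
    by exists 0; rewrite // ev1_0 horner0 rmorph0 subrr mul0r.
  exists (r * v + c q.[b]).
    by apply: mreg_add (mreg_cst _); apply: mreg_mul rr (mreg_val hv).
  rewrite ev1D ev1M ev1X ev1C hornerD hornerM hornerX hornerC.
  rewrite -[ev1 c q v](subrK (c q.[b])) e rmorphD rmorphM /=; ring.
elim/poly_ind: G => [|G q [r1 [r2 [h1 h2 e]]]].
  by exists 0, 0; rewrite ev2_0 !horner0 rmorph0 subrr !mul0r addr0.
have [r rr eq] := ev1_dec q.
exists (r1 * u + c G.[a, b]), (r2 * u + r); split.
- by apply: mreg_add (mreg_cst _); apply: mreg_mul h1 (mreg_val hu).
- by apply: mreg_add rr; apply: mreg_mul h2 (mreg_val hu).
rewrite ev2D ev2M ev2X ev2C !(hornerD, hornerM, hornerX, hornerC).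
rewrite -[ev2 c G u v](subrK (c G.[a, b])) e -[ev1 c q v](subrK (c q.[b])) eq.
rewrite rmorphD rmorphM /=; ring.
Qed.

Lemma munif_chart r :
  mreg R r -> v - c b = r * (u - c a) -> munif R (u - c a).
Proof.
move=> rr e; have [hu hv] := val_chart; split; first exact/mval_sub_cst.
move=> f /mvanP [g [h [h0 fE ge]]].
have [r1 [r2 [h1 h2]]] := chart_decomp g.
rewrite ge mul0r rmorph0 subr0 e => gE.
have ih : mval (ev2 c h u v)^-1 h.[a, b]^-1 by apply: val_inv => //; apply: val_ev2.
exists ((r1 + r2 * r) * (ev2 c h u v)^-1).
  apply: mreg_mul (mreg_val ih); apply: mreg_add h1 _; exact: mreg_mul.
by rewrite fE gE; ring.
Qed.

End Local.
End Model.

(** * Orders at points *)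
Section Orders.
Variables (k : fieldType) (E : ellcurve k) (M : funmodel E).
Local Notation K := (mfield M).
Local Notation c := (mcst M).
Local Notation X := (mX M).
Local Notation Y := (mY M).
Implicit Types (R : point E) (f g t : K) (m n : int).

Lemma mX_cst_neq0 a : X - c a != 0.
Proof.
rewrite -[X](ev1X c) -(ev1C c X) -ev1N -ev1D evX_eq0.
by rewrite polyXsubC_eq0.
Qed.
Lemma mX_neq0 : X != 0.
Proof. by have := mX_cst_neq0 0; rewrite rmorph0 subr0. Qed.

Definition munit R f : Prop := exists2 y, y != 0 & mval R f y.

Lemma munitP R f : munit R f <-> mreg R f /\ ~ mvan R f.
Proof.
split=> [[y y0 h]|[h1 h2]]; last exact: unitP.
split; first exact: mreg_val h.
by move/mvanP => h'; move: y0; rewrite (val_uniq h h') eqxx.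
Qed.

Lemma munit_neq0 R f : munit R f -> f != 0.
Proof. by move=> [y y0 h]; apply: val_neq0 h y0. Qed.
Lemma munit_mul R f g : munit R f -> munit R g -> munit R (f * g).
Proof.
by move=> [y y0 h] [z z0 h']; exists (y * z); [rewrite mulf_neq0 | apply: val_mul].
Qed.
Lemma munit_inv R f : munit R f -> munit R f^-1.
Proof. by move=> [y y0 h]; exists y^-1; [rewrite invr_eq0 | apply: val_inv]. Qed.
Lemma munit_cst R y : y != 0 -> munit R (c y).
Proof. by move=> y0; exists y => //; apply: val_cst. Qed.
Lemma munit_1 R : munit R 1.
Proof. by rewrite -(rmorph1 c); apply: munit_cst; rewrite oner_neq0. Qed.
Lemma munit_exp R f n : munit R f -> munit R (f ^ n).
Proof.
have nat_exp j g : munit R g -> munit R (g ^+ j).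
  by move=> [y y0 h]; exists (y ^+ j); [rewrite expf_neq0 | apply: val_exp].
by case: n => j h; [apply: nat_exp | apply/munit_inv/nat_exp].
Qed.
Lemma munit_reg R f : munit R f -> mreg R f.
Proof. by case/munitP. Qed.

Lemma munif_neq0 R t : munif R t -> t != 0.
Proof.
move=> [_ ht]; apply/eqP => t0.
have [g vg] : exists2 g : K, mvan R g & g != 0.
  case: R ht => -[[x y]|] xy ht.
    exists (X - c x); last exact: mX_cst_neq0.
    apply/mval_sub_cst; have := val_chart M (exist _ (Some (x, y)) xy).
    by case.
  exists (X / Y); last by rewrite mulf_neq0 ?invr_eq0 ?mX_neq0 ?mY_neq0.
  apply/mvanP; have := val_chart M (exist _ None xy); by case.
by have [r _ ->] := ht _ vg; rewrite t0 mulr0 eqxx.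
Qed.

Lemma munif_rel R t t' : munif R t -> munif R t' ->
  exists2 w, munit R w & t' = w * t.
Proof.
move=> ht ht'; have [w rw e] := ht.2 _ ht'.1; exists w => //.
have [w' rw' e'] := ht'.2 _ ht.1; apply/munitP; split=> // vw.
have ww : w' * w = 1.
  by apply: (mulIf (munif_neq0 ht)); rewrite mul1r -mulrA -e.
have /mvanP h := mvan_mul rw' vw; have := val_cst M R 1.
rewrite rmorph1 -ww => /val_uniq /(_ h) /eqP; by rewrite oner_eq0.
Qed.

(** The order of f at R is at least m; unlike [mord], this admits f = 0. *)
Definition mge R f m : Prop := exists t r, [/\ munif R t, mreg R r & f = r * t ^ m].

Lemma mordP R t f m : munif R t ->
  mord R f m <-> exists2 r, munit R r & f = r * t ^ m.
Proof.
move=> ht; split=> [[t' [r [ht' rr nv ->]]]|[r /munitP [rr nv] ->]].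
  have [w uw ->] := munif_rel ht ht'.
  exists (r * w ^ m); first by apply: munit_mul; [apply/munitP | apply: munit_exp].
  by rewrite expfzMl mulrA.
by exists t, r.
Qed.

Lemma mgeP R t f m : munif R t ->
  mge R f m <-> exists2 r, mreg R r & f = r * t ^ m.
Proof.
move=> ht; split=> [[t' [r [ht' rr ->]]]|[r rr ->]]; last by exists t, r.
have [w uw ->] := munif_rel ht ht'.
exists (r * w ^ m); first by apply: mreg_mul => //; apply/munit_reg/munit_exp.
by rewrite expfzMl mulrA.
Qed.

Lemma mord_unif R f m : mord R f m -> exists t, munif R t.
Proof. by move=> [t [r [ht _ _ _]]]; exists t. Qed.
Lemma mge_unif R f m : mge R f m -> exists t, munif R t.
Proof. by move=> [t [r [ht _ _]]]; exists t. Qed.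

Lemma mord_neq0 R f m : mord R f m -> f != 0.
Proof.
move=> h; have [t ht] := mord_unif h; have [r ur ->] := (mordP _ _ ht).1 h.
by rewrite mulf_neq0 ?(munit_neq0 ur) // expfz_neq0 // (munif_neq0 ht).
Qed.

Lemma mord_mge R f m : mord R f m -> mge R f m.
Proof.
move=> h; have [t ht] := mord_unif h; have [r ur ->] := (mordP _ _ ht).1 h.
by exists t, r; split=> //; apply: munit_reg.
Qed.

Lemma mord_mul R f g m n : mord R f m -> mord R g n -> mord R (f * g) (m + n).
Proof.
move=> h h'; have [t ht] := mord_unif h.
have t0 := munif_neq0 ht.
have [r ur ->] := (mordP _ _ ht).1 h; have [r' ur' ->] := (mordP _ _ ht).1 h'.
apply/(mordP _ _ ht); exists (r * r'); first exact: munit_mul.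
by rewrite expfzDr //; ring.
Qed.

Lemma mord_inv R f m : mord R f m -> mord R f^-1 (- m).
Proof.
move=> h; have [t ht] := mord_unif h.
have [r ur ->] := (mordP _ _ ht).1 h.
by apply/(mordP _ _ ht); exists r^-1; [apply: munit_inv | rewrite invfM invr_expz].
Qed.

Lemma mord_exp R f m j : mord R f m -> mord R (f ^+ j) (m *+ j).
Proof.
move=> h; have [t ht] := mord_unif h; elim: j => [|j IH].
  apply/(mordP _ _ ht); exists 1; first exact: munit_1.
  by rewrite expr0 mulr0n expr0z mulr1.
by rewrite exprS mulrS; apply: mord_mul.
Qed.

Lemma munit_ord R t f : munif R t -> munit R f -> mord R f 0.
Proof. by move=> ht uf; apply/(mordP _ _ ht); exists f; rewrite // expr0z mulr1. Qed.

Lemma munif_ord R t : munif R t -> mord R t 1.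
Proof.
by move=> ht; apply/(mordP _ _ ht); exists 1; [apply: munit_1 | rewrite expr1z mul1r].
Qed.

Lemma mge_add R f g m : mge R f m -> mge R g m -> mge R (f + g) m.
Proof.
move=> h h'; have [t ht] := mge_unif h.
have [r ur ->] := (mgeP _ _ ht).1 h; have [r' ur' ->] := (mgeP _ _ ht).1 h'.
by apply/(mgeP _ _ ht); exists (r + r'); [apply: mreg_add | rewrite mulrDl].
Qed.

Lemma mge_mul R f g m n : mge R f m -> mge R g n -> mge R (f * g) (m + n).
Proof.
move=> h h'; have [t ht] := mge_unif h.
have [r ur ->] := (mgeP _ _ ht).1 h; have [r' ur' ->] := (mgeP _ _ ht).1 h'.
apply/(mgeP _ _ ht); exists (r * r'); first exact: mreg_mul.
by rewrite expfzDr ?(munif_neq0 ht) //; ring.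
Qed.

Lemma munif_reg R t : munif R t -> mreg R t.
Proof. by case=> /mvanP h _; apply: mreg_val h. Qed.

Lemma mge_le R f m n : (n <= m)%R -> mge R f m -> mge R f n.
Proof.
move=> nm h; have [t ht] := mge_unif h.
have [r ur ->] := (mgeP _ _ ht).1 h.
apply/(mgeP _ _ ht); exists (r * t ^ (m - n)); last first.
  by rewrite -mulrA -expfzDr ?(munif_neq0 ht) // subrK.
apply: mreg_mul => //; have -> : m - n = `|m - n|%N by lia.
elim: `|m - n|%N => [|j IH]; first exact/munit_reg/munit_1.
by rewrite -exprnP exprS; apply: mreg_mul => //; apply: munif_reg.
Qed.

Lemma mge_reg R t f : munif R t -> mreg R f -> mge R f 0.
Proof. by move=> ht rf; exists t, f; rewrite expr0z mulr1. Qed.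

Lemma mge_van R t f : munif R t -> mvan R f -> mge R f 1.
Proof. by move=> ht /(ht.2) [r rr ->]; exists t, r; rewrite expr1z. Qed.

Lemma mge0_reg R f m : 0 <= m -> mge R f m -> mreg R f.
Proof.
move=> m0 /(mge_le m0) h; have [t ht] := mge_unif h.
by have [r rr ->] := (mgeP _ _ ht).1 h; rewrite expr0z mulr1.
Qed.

Lemma mge1_van R f m : 1 <= m -> mge R f m -> mvan R f.
Proof.
move=> m0 /(mge_le m0) h; have [t ht] := mge_unif h.
have [r rr ->] := (mgeP _ _ ht).1 h; rewrite expr1z.
by apply: mvan_mul => //; case: ht.
Qed.

Lemma mge_ord_lt R f m n : mord R f m -> mge R f n -> (n <= m)%R.
Proof.
move=> h h'; rewrite leNgt; apply/negP => mn; have [t ht] := mge_unif h'.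
have [r ur e] := (mordP _ _ ht).1 h; have [r' rr' e'] := (mgeP _ _ ht).1 h'.
have t0 := munif_neq0 ht.
have er : r = r' * t ^ (n - m).
  apply: (mulIf (expfz_neq0 m t0)); rewrite -e e' -mulrA -expfzDr // subrK //.
have /munitP [_] := ur; apply; apply: (@mge1_van _ _ (n - m)); first by lia.
by exists t, r'.
Qed.

Lemma mord_uniq R f m n : mord R f m -> mord R f n -> m = n.
Proof.
move=> h h'; apply/eqP; rewrite eq_le.
by rewrite (mge_ord_lt h' (mord_mge h)) (mge_ord_lt h (mord_mge h')).
Qed.

Lemma mord_add R f g m n : mord R f m -> mge R g n -> (m < n)%R -> mord R (f + g) m.
Proof.
move=> h h' mn; have [t ht] := mge_unif h'; have t0 := munif_neq0 ht.
have [r [y y0 hy] ->] := (mordP _ _ ht).1 h.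
have [r' rr' ->] := (mgeP _ _ ht).1 h'.
apply/(mordP _ _ ht); exists (r + r' * t ^ (n - m)); last first.
  by rewrite mulrDl -mulrA -expfzDr // subrK.
exists y => //; rewrite -(addr0 y); apply: val_add => //; apply/mvanP.
by apply: (@mge1_van _ _ (n - m)); [lia | exists t, r'].
Qed.

Lemma mord_reg R f m : 0 <= m -> mord R f m -> mreg R f.
Proof. by move=> m0 /mord_mge; apply: mge0_reg. Qed.

Lemma mord0_unit R f : mord R f 0 -> munit R f.
Proof.
move=> h; have [t ht] := mord_unif h.
by have [r ur ->] := (mordP _ _ ht).1 h; rewrite expr0z mulr1.
Qed.

Lemma mge_sub R f g m : mge R f m -> mge R g m -> mge R (f - g) m.
Proof.
move=> h h'; apply: mge_add => //; rewrite -mulN1r -[m]add0r.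
apply: mge_mul => //; have [t ht] := mge_unif h.
by apply: (mge_reg ht); rewrite -(rmorph1 c) -rmorphN; apply: mreg_cst.
Qed.


(** Where the derivative of the equation with respect to y is nonzero, the
    equation itself expresses y - y(R) as a regular multiple of x - x(R). *)
Lemma munif_affine R x y : val R = Some (x, y) -> 2 * y + a1 E * x + a3 E != 0 ->
  munif R (X - c x).
Proof.
case: R => -[[x' y']|] //= xy [<- <-] n0; set R := exist _ _ _.
have [hx hy] := val_chart M R; rewrite /= in hx hy.
pose den := Y + c y' + c (a1 E) * X + c (a3 E).
pose num := X ^+ 2 + X * c x' + c x' ^+ 2 + c (a2 E) * (X + c x')
  + c (a4 E) - c (a1 E) * c y'.
have hden : mval R den (2 * y' + a1 E * x' + a3 E).
  have -> : 2 * y' + a1 E * x' + a3 E = y' + y' + a1 E * x' + a3 E by ring.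
  do !apply: val_add; rewrite //; try exact: val_cst.
  by apply: val_mul => //; apply: val_cst.
have rnum : mreg R num.
  rewrite /num; have rX := mreg_val hx; have rc := mreg_cst M R.
  by rewrite -rmorphM -!rmorphXn -rmorphN; do !(apply: mreg_add || apply: mreg_mul).
apply: (@munif_chart _ _ _ R (num / den)).
  by apply: mreg_mul => //; apply: mreg_val (val_inv hden n0).
rewrite /= -mulrA; apply: (mulIf (val_neq0 hden n0)).
rewrite -!mulrA [den^-1 * _]mulrC -!mulrA mulfV ?(val_neq0 hden n0) // mulr1.
have /= /eqP /(congr1 c) := xy; rewrite !(rmorphD, rmorphM, rmorphXn).
have := m_eq M; rewrite /den /num => e e'.
apply/subr0_eq; transitivity (
  (Y ^+ 2 + c (a1 E) * X * Y + c (a3 E) * Y) -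
  (c y' ^+ 2 + c (a1 E) * c x' * c y' + c (a3 E) * c y') -
  ((X ^+ 3 + c (a2 E) * X ^+ 2 + c (a4 E) * X + c (a6 E)) -
  (c x' ^+ 3 + c (a2 E) * c x' ^+ 2 + c (a4 E) * c x' + c (a6 E)))); first by ring.
by rewrite e e' subrr.
Qed.

Local Notation O := (zeropt E).

(** In the coordinates z = X/Y and w = 1/Y at infinity the equation reads
    w (1 + a1 z + a3 w - a2 z^2 - a4 z w - a6 w^2) = z^3. *)
Lemma mord_inf_aux : exists2 U, mval O U 1 & Y^-1 * U = (X / Y) ^+ 3.
Proof.
have [hz hw] := val_chart M O; rewrite /= in hz hw.
set z := X / Y in hz *; set w := Y^-1 in hw *.
exists (1 + (c (a1 E) * z + c (a3 E) * w - c (a2 E) * z * z - c (a4 E) * z * w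
  - c (a6 E) * w * w)).
  have hc := val_cst M O; have -> : 1 = 1 + 0 :> k by rewrite addr0.
  apply: val_add.
    by rewrite -(rmorph1 c).
  have -> : 0 = a1 E * 0 + a3 E * 0 - a2 E * 0 * 0 - a4 E * 0 * 0 - a6 E * 0 * 0 by ring.
  by do !(apply: val_sub || apply: val_add || apply: val_mul).
have := m_eq M; have := mY_neq0 M; rewrite /z /w => Y0 e.
rewrite expr_div_n; have -> : X ^+ 3 = Y ^+ 2 + c (a1 E) * X * Y + c (a3 E) * Y - c (a2 E) * X ^+ 2 - c (a4 E) * X - c (a6 E) by rewrite e; ring.
by field.
Qed.

Lemma munif_inf : munif O (X / Y).
Proof.
have [U hU e] := mord_inf_aux; have [hz hw] := val_chart M O.
have U0 := val_neq0 hU (oner_neq0 _).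
have := @munif_chart _ _ M O ((X / Y) ^+ 2 / U).
rewrite /= rmorph0 !subr0; apply.
  apply: mreg_mul; first exact: mreg_val (val_exp 2 hz).
  exact: mreg_val (val_inv hU (oner_neq0 _)).
by apply: (mulIf U0); rewrite e; field; rewrite U0 (mY_neq0 M).
Qed.

Lemma mord_inf_Y : mord O Y (- 3%:Z).
Proof.
have [U hU e] := mord_inf_aux; rewrite -[Y]invrK; apply: mord_inv.
have U0 := val_neq0 hU (oner_neq0 _).
apply/(mordP _ _ munif_inf); exists U^-1.
  by apply: munit_inv; exists 1; rewrite // oner_neq0.
by rewrite -exprnP -e mulrC mulfK.
Qed.

Lemma mord_inf_X : mord O X (- 2%:Z).
Proof.
have -> : X = (X / Y) * Y by rewrite mulfVK // mY_neq0.
by apply: (mord_mul (munif_ord munif_inf) mord_inf_Y).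
Qed.

End Orders.

(** * The affine ring *)

Definition alg_closed (k : fieldType) :=
  forall p : {poly k}, (1 < size p)%N -> exists x, root p x.

Lemma closedField_alg_closed (k : closedFieldType) : alg_closed k.
Proof. by move=> p sp; apply/closed_rootP; rewrite neq_ltn sp orbT. Qed.

Section AffineRing.
Variables (k : fieldType) (E : ellcurve k) (M : funmodel E).
Local Notation K := (mfield M).
Local Notation c := (mcst M).
Local Notation X := (mX M).
Local Notation Y := (mY M).
Local Notation O := (zeropt E).
Local Notation linp := (linp E).
Local Notation cubp := (cubp E).
Local Notation pe := (pe M).

(** The norm of a + b Y in k(X). *)
Definition normp (a b : {poly k}) : {poly k} :=
  a ^+ 2 - a * b * linp - b ^+ 2 * cubp.

Lemma pe_norm a b : ev1 c (normp a b) X = pe a b * pe (a - b * linp) (- b).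
Proof.
rewrite peM /normp -pe0; congr pe; ring.
Qed.

Lemma normp_horner a b x y y' : y + y' = - linp.[x] -> y * y' = - cubp.[x] ->
  (normp a b).[x] = (a.[x] + b.[x] * y) * (a.[x] + b.[x] * y').
Proof.
move=> e1 e2; transitivity (a.[x] ^+ 2 + a.[x] * b.[x] * (y + y') + b.[x] ^+ 2 * (y * y')).
  by rewrite e1 e2 /normp !(hornerD, hornerN, hornerM, horner_exp); ring.
by ring.
Qed.

Lemma quad_roots (kc : alg_closed k) (l d : k) : exists y y', y + y' = - l /\ y * y' = - d.
Proof.
pose p : {poly k} := 'X^2 + (l *: 'X - d%:P).
have sp : size p = 3%N.
  rewrite size_polyDl size_polyXn // ltnS; apply: szD; first by apply: szZ; rewrite size_polyX.
  by apply: szN; rewrite (leq_trans (size_polyC_leq1 _)).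
have [|y /rootP] := kc p; first by rewrite sp.
rewrite /p !(hornerD, hornerN, hornerXn, hornerZ, hornerX, hornerC) => e; exists y, (- l - y); split; first by ring.
have -> : d = y ^+ 2 + l * y by apply/esym/subr0_eq; rewrite -e; ring.
ring.
Qed.

(** A function regular at all affine points is a polynomial in X and Y. The
    denominators of f form an ideal J of k[X, Y]. Regularity at the points above
    x provides an element of J that vanishes at none of them, hence, by taking
    norms, an element of J in k[X] that does not vanish at x. A nonconstant
    element of J in k[X] of minimal degree would have a root x, which a gcd with
    that element removes. *)
Lemma reg_affine (kc : alg_closed k) (f : K) :
  (forall R, R <> O -> mreg R f) -> exists a b, f = pe a b.
Proof.
move=> freg.
pose J A B := exists a b, pe A B * f = pe a b.
have JD A B A' B' : J A B -> J A' B' -> J (A + A') (B + B').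
  move=> [a [b e]] [a' [b' e']]; exists (a + a'), (b + b').
  by rewrite !peD mulrDl e e'.
have JM A B A' B' : J A B -> J (A * A' + B * B' * cubp) (A * B' + A' * B - B * B' * linp).
  move=> [a [b e]]; rewrite /J -peM mulrAC e peM; by do 2!eexists.
have JN A B : J A B -> J (normp A B) 0.
  move=> /(JM _ _ (A - B * linp) (- B)) [a [b e]]; exists a, b; rewrite -e -peM pe0.
  by rewrite pe_norm.
have Jx p A : J A 0 -> J (p * A) 0.
  by move=> [a [b e]]; exists (p * a), (p * b); rewrite -[0](mulr0 p) -pe_ev1M -mulrA e pe_ev1M.
have Jpt x y : oncurve E (Some (x, y)) ->
    exists A B : {poly k}, J A B /\ A.[x] + B.[x] * y != 0.
  move=> xy; have [] := freg (exist (oncurve E) (Some (x, y)) xy) _ => // g [h].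
  move=> [h0 fE]; have [A [B [hE hv]]] := ev2_pe M h.
  have [A' [B' [gE _]]] := ev2_pe M g.
  exists A, B; split; last by rewrite hv.
  exists A', B'; rewrite fE hE gE mulrC mulfVK // -hE.
  by have := @chart_eval_neq0 _ _ M (exist (oncurve E) (Some (x, y)) xy) h h0.
have [a0 [b0 [d [d0 fE]]]] := pe_repr f.
have Jd : J d 0.
  by exists a0, b0; rewrite pe0 fE mulrC mulfVK // evX_eq0.
have [n] := ubnP (size d); elim: n d d0 Jd {fE} => // n IH d d0 Jd sd.
have [s1|s1] := leqP (size d) 1.
  move: d0 Jd; rewrite (size1_polyC s1) polyC_eq0 => d0 [a [b e]].
  exists (((d`_0)^-1)%:P * a), (((d`_0)^-1)%:P * b).
  by rewrite -pe_ev1M -e peC ev1C mulrA -rmorphM mulVf // rmorph1 mul1r.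
have [x /eqP dx] := kc _ s1.
have [y [y' [e1 e2]]] := quad_roots kc (linp.[x]) (cubp.[x]).
have [xy xy'] : oncurve E (Some (x, y)) /\ oncurve E (Some (x, y')).
  split=> /=; apply/eqP; rewrite -horner_cubp -addrA -mulrDl -horner_linp; apply/eqP.
    by rewrite -subr_eq0 -[cubp.[x]]opprK -e2 -[linp.[x]]opprK -e1; apply/eqP; ring.
  by rewrite -subr_eq0 -[cubp.[x]]opprK -e2 -[linp.[x]]opprK -e1; apply/eqP; ring.
(* The two points above x may coincide. One of the two local denominators, or
   their sum, is nonzero at both of them. *)
have [A [B [JAB v]]] : exists A B : {poly k}, J A B /\ (normp A B).[x] != 0.
  have [A [B [J1 v1]]] := Jpt _ _ xy; have [A' [B' [J2 v2]]] := Jpt _ _ xy'.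
  have [v12|v12] := eqVneq (A.[x] + B.[x] * y') 0; last first.
    by exists A, B; rewrite (normp_horner _ _ e1 e2) mulf_neq0.
  have [v21|v21] := eqVneq (A'.[x] + B'.[x] * y) 0; last first.
    by exists A', B'; rewrite (normp_horner _ _ e1 e2) mulf_neq0.
  exists (A + A'), (B + B'); split; first exact: JD.
  rewrite (normp_horner _ _ e1 e2) !hornerD.
  have -> : A.[x] + A'.[x] + (B.[x] + B'.[x]) * y =
     (A.[x] + B.[x] * y) + (A'.[x] + B'.[x] * y) by ring.
  have -> : A.[x] + A'.[x] + (B.[x] + B'.[x]) * y' =
     (A.[x] + B.[x] * y') + (A'.[x] + B'.[x] * y') by ring.
  by rewrite v12 v21 addr0 add0r mulf_neq0.
have [[u w]] := Bezoutp d (normp A B).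
set e := u * d + w * _ => eg.
have e0 : e != 0 by rewrite -size_poly_gt0 (eqp_size eg) size_poly_gt0 gcdp_eq0 negb_and d0.
have ed : e %| d by rewrite (eqp_dvdl _ eg) dvdp_gcdl.
have ex : e.[x] != 0.
  apply: contra v; have : e %| normp A B by rewrite (eqp_dvdl _ eg) dvdp_gcdr.
  by move=> /dvdpP [q ->] /eqP ex; rewrite hornerM ex mulr0.
apply: (IH e) => //.
  by rewrite /e -(addr0 0); apply: JD; apply: Jx => //; apply: JN.
rewrite -ltnS; apply: leq_trans sd; rewrite ltnS ltn_neqAle dvdp_leq // andbT.
apply: contra ex; rewrite (dvdp_size_eqp ed) => /eqp_root /(_ x).
by rewrite /root dx eqxx.
Qed.

(** The order of the pole of a(X) + b(X) Y at infinity. *)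
Definition degpe (a b : {poly k}) : nat :=
  maxn (2 * (size a).-1) (if b == 0 then 0 else 3 + 2 * (size b).-1).

Lemma mord_poly R (u : K) (m : nat) (p : {poly k}) : (0 < m)%N -> p != 0 ->
  mord R u (- m%:Z) -> mord R (ev1 c p u) (- (m * (size p).-1)%N%:Z).
Proof.
move=> m0 + hu; have [t ht] := mord_unif hu.
elim/poly_ind: p => [|p a IH]; first by rewrite eqxx.
rewrite ev1D ev1M ev1X ev1C => pa0.
have [p0|p0] := eqVneq p 0.
  move: pa0; rewrite p0 mul0r add0r ev1_0 mul0r add0r size_polyC polyC_eq0 => a0.
  by rewrite a0 muln0 oppr0; apply: (munit_ord ht); apply: munit_cst.
have -> : (size (p * 'X + a%:P)).-1 = (size p).-1.+1.
  by rewrite size_MXaddC (negPf p0) /= prednK // size_poly_gt0.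
have -> : - (m * (size p).-1.+1)%N%:Z = - (m * (size p).-1)%N%:Z + - m%:Z by lia.
have h := mord_mul (IH p0) hu.
apply: mord_add h (mge_reg ht (mreg_cst _ _ _)) _; lia.
Qed.

(** Stated for any pair of functions with poles of orders 2m and 3m, in order
    to apply also to the images of X and Y under an isomorphism. There is no
    cancellation because the orders of the two terms, divided by m, have
    different parities. *)
Lemma mord_pe R (u v : K) (m : nat) (a b : {poly k}) : (0 < m)%N ->
  (a != 0) || (b != 0) -> mord R u (- (2 * m)%N%:Z) -> mord R v (- (3 * m)%N%:Z) ->
  mord R (ev1 c a u + ev1 c b u * v) (- (m * degpe a b)%N%:Z).
Proof.
move=> m0 + hu hv; have [t ht] := mord_unif hu.
have m2 : (0 < 2 * m)%N by lia.
have [->|a0] /= := eqVneq a 0.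
  rewrite ev1_0 add0r => b0; have := mord_mul (mord_poly m2 b0 hu) hv.
  rewrite /degpe size_poly0 (negPf b0) muln0 max0n.
  by congr mord; lia.
have ha := mord_poly m2 a0 hu.
have [-> _|b0 _] := eqVneq b 0.
  rewrite ev1_0 mul0r addr0 /degpe eqxx maxn0.
  by move: ha; congr mord; lia.
have hb := mord_mul (mord_poly m2 b0 hu) hv.
rewrite /degpe (negPf b0).
have [ab|ab] := ltnP (2 * (size a).-1) (3 + 2 * (size b).-1).
  rewrite addrC.
  have -> : - (m * (3 + 2 * (size b).-1))%N%:Z =
     - (2 * m * (size b).-1)%N%:Z + - (3 * m)%N%:Z by lia.
  apply: mord_add hb (mord_mge ha) _; nia.
have -> : - (m * (2 * (size a).-1))%N%:Z = - (2 * m * (size a).-1)%N%:Z by lia.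
apply: mord_add ha (mord_mge hb) _.
have {ab} : (4 + 2 * (size b).-1 <= 2 * (size a).-1)%N by lia.
nia.
Qed.

Lemma mord_inf_pe a b : (a != 0) || (b != 0) -> mord O (pe a b) (- (degpe a b)%:Z).
Proof.
by move=> ab; have := mord_pe (m := 1) isT ab (mord_inf_X M) (mord_inf_Y M); rewrite mul1n.
Qed.

Lemma mge_inf_pe a b (m : nat) : mge O (pe a b) (- m%:Z) -> (degpe a b <= m)%N.
Proof.
move=> h; have [/norP [/negPn /eqP -> /negPn /eqP ->]|ab] := boolP (~~ ((a != 0) || (b != 0))).
  by rewrite /degpe size_poly0 eqxx.
by have := mge_ord_lt (mord_inf_pe (negPn ab)) h; lia.
Qed.

Lemma pe_low a b : (degpe a b <= 2)%N -> exists r s, pe a b = c r * X + c s.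
Proof.
rewrite /degpe; have [->|b0] := eqVneq b 0; last by lia.
rewrite maxn0 => sa; exists a`_1, a`_0.
have -> : a = a`_1 *: 'X + (a`_0)%:P.
  apply/polyP => [[|[|i]]]; rewrite !coefE ?mulr0 ?addr0 ?mulr1 ?add0r //.
  by rewrite nth_default ?mulr0 //; move: (size a) sa; lia.
by rewrite pe0 ev1D ev1Z ev1X ev1C !coefE mulr0 mulr1 addr0 add0r.
Qed.

End AffineRing.

(** * The norm equation in characteristic two *)
Section CharTwo.
Variables (R : pzRingType) (h : 2 = 0 :> R).
Lemma c2_even n : n.*2%:R = 0 :> R.
Proof. by rewrite -muln2 natrM h mulr0. Qed.
Lemma c2_odd n : n.*2.+1%:R = 1 :> R.
Proof. by rewrite -addn1 natrD c2_even add0r. Qed.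
Lemma c2_opp (x : R) : - x = x.
Proof. by apply/esym/eqP; rewrite -addr_eq0 -mulr2n -mulr_natl h mul0r. Qed.
Lemma c2_Neven n : - n.*2%:R = 0 :> R. Proof. by rewrite c2_even oppr0. Qed.
Lemma c2_Nodd n : - n.*2.+1%:R = 1 :> R. Proof. by rewrite c2_opp c2_odd. Qed.
Lemma c2_addrr (x : R) : x + x = 0.
Proof. by rewrite -[X in X + _]c2_opp addNr. Qed.
Lemma c2_eq (x y : R) : x + y = 0 -> x = y.
Proof. by move/eqP; rewrite addr_eq0 c2_opp => /eqP. Qed.
End CharTwo.

Lemma c2_poly (R : nzRingType) : 2 = 0 :> R -> 2 = 0 :> {poly R}.
Proof. by move=> h; rewrite -polyC_natr h. Qed.

(** Ring identities modulo 2 = 0: the coefficients that occur below, at most 6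
    in absolute value, are reduced modulo 2. *)
Tactic Notation "ring2" constr(h) := ring:
  (c2_Nodd h 0 : -1 = 1) (c2_even h 1 : 2 = 0) (c2_Neven h 1 : -2 = 0)
  (c2_odd h 1 : 3 = 1) (c2_Nodd h 1 : -3 = 1) (c2_even h 2 : 4 = 0)
  (c2_Neven h 2 : -4 = 0) (c2_odd h 2 : 5 = 1) (c2_Nodd h 2 : -5 = 1)
  (c2_even h 3 : 6 = 0) (c2_Neven h 3 : -6 = 0).
Tactic Notation "ring2" constr(h) ":" constr(e) := ring: e
  (c2_Nodd h 0 : -1 = 1) (c2_even h 1 : 2 = 0) (c2_Neven h 1 : -2 = 0)
  (c2_odd h 1 : 3 = 1) (c2_Nodd h 1 : -3 = 1) (c2_even h 2 : 4 = 0)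
  (c2_Neven h 2 : -4 = 0) (c2_odd h 2 : 5 = 1) (c2_Nodd h 2 : -5 = 1)
  (c2_even h 3 : 6 = 0) (c2_Neven h 3 : -6 = 0).

Section PolyAux.
Variables (k : fieldType) (x : k).
Local Notation v := ('X - x%:P).

Lemma root_order (p : {poly k}) : p != 0 ->
  exists m q, q.[x] != 0 /\ p = v ^+ m * q.
Proof.
move=> p0; have [m [q]] := multiplicity_XsubC p x.
by rewrite p0 /= => rq ->; exists m, q; rewrite mulrC.
Qed.

Lemma root_order_le m n (p q : {poly k}) : p.[x] != 0 ->
  v ^+ m * p = v ^+ n * q -> (n <= m)%N.
Proof.
move=> hp e; rewrite leqNgt; apply/negP => mn.
have v0 : v ^+ m != 0 by rewrite expf_neq0 // polyXsubC_eq0.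
move: e; rewrite -(subnK mn) -addSnnS addnC exprD -mulrA => /(mulfI v0) e.
by move: hp; rewrite e exprS !hornerE subrr !mul0r eqxx.
Qed.

Lemma root_order_uniq m n (p q : {poly k}) : p.[x] != 0 -> q.[x] != 0 ->
  v ^+ m * p = v ^+ n * q -> m = n.
Proof.
move=> hp hq e; apply/eqP; rewrite eqn_leq.
by rewrite (root_order_le hq (esym e)) (root_order_le hp e).
Qed.

Lemma sqr_root_order n (p q : {poly k}) : q.[x] != 0 -> p ^+ 2 = v ^+ n * q ->
  exists j r, [/\ r.[x] != 0, p = v ^+ j * r & (j * 2)%N = n].
Proof.
move=> hq sq; have p0 : p != 0.
  apply: contraNneq hq => p0; move/esym/eqP: sq; rewrite p0 expr0n mulf_eq0.
  by rewrite expf_eq0 polyXsubC_eq0 andbF => /eqP ->; rewrite horner0.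
have [j [r [hr pE]]] := root_order p0; exists j, r; split=> //.
apply: (@root_order_uniq _ _ (r ^+ 2) q) => //; first by rewrite horner_exp expf_neq0.
by rewrite -sq pE exprMn -exprM.
Qed.

Lemma taylor2 (p : {poly k}) :
  exists q, p = p.[x]%:P + p^`().[x] *: v + v ^+ 2 * q.
Proof.
have dec (r : {poly k}) : exists s, r = r.[x]%:P + v * s.
  have /factor_theorem [s e] : root (r - r.[x]%:P) x.
    by rewrite /root !hornerE subrr.
  by exists s; rewrite [v * s]mulrC -e addrC subrK.
have [s es] := dec p; have [q eq] := dec s; exists q.
have -> : p^`().[x] = s.[x].
  by rewrite {1}es derivD derivC add0r derivM derivXsubC mul1r !hornerE subrr mul0r addr0.
by rewrite {1}es {1}eq -mul_polyC; ring.
Qed.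

Lemma deriv_deriv2 (p : {poly k}) : 2 = 0 :> k -> p^`()^`() = 0.
Proof.
move=> h; rewrite -[LHS]/(p^`(2)) nderivn_def -[_ *+ _]mulr_natl.
by rewrite (c2_even (c2_poly h) 1) mul0r.
Qed.

End PolyAux.

(** In this section A, B, T, S are the polynomials in the slope of a line
    through -P that occur in the norm of a function with divisor n(P) - n(O), and
    e1 is the coefficient a1 of the curve; the size of B is even because it is
    n - 1 with n odd. *)
Section NormEquation.
Variables (k : fieldType) (two0 : 2 = 0 :> k).
Variables (e1 t0 b g c0 : k) (A B T S : {poly k}).
Hypotheses (TE : T = 'X^2 + e1 *: 'X + t0%:P) (SE : S = b *: 'X + g%:P).
Hypotheses (c00 : c0 != 0) (b0 : b != 0).
Hypothesis normE : A ^+ 2 + A * B * T + B ^+ 2 * S = c0%:P.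
Hypotheses (oddB : ~~ odd (size B)) (B0 : B != 0).

Let two0p : 2 = 0 :> {poly k} := c2_poly two0.

Lemma deriv_T : T^`() = e1%:P.
Proof.
rewrite TE !derivD derivXn derivC derivZ derivX alg_polyC addr0 expr1.
by rewrite -mulr_natl two0p mul0r add0r.
Qed.
Lemma deriv_S : S^`() = b%:P.
Proof. by rewrite SE derivD derivC derivZ derivX alg_polyC addr0. Qed.

Lemma size_deriv_odd (p : {poly k}) : ~~ odd (size p) -> p != 0 ->
  size p^`() = (size p).-1.
Proof.
move=> od p0; have p1 : (1 < size p)%N.
  by move: p0 od; rewrite -size_poly_gt0; case: (size p) => [|[|]].
apply/eqP; rewrite eqn_leq; apply/andP; split.
  by rewrite -ltnS prednK ?lt_size_deriv // ltnW.
rewrite leqNgt; apply/negP => h; have : p^`()`_(size p).-2 = 0.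
  by apply: nth_default; move: h p1; case: (size p) => [|[|?]].
have [j sj] : exists j, size p = j.*2.+2.
  have := odd_double_half (size p); rewrite (negPf od) add0n => sp.
  by exists (size p)./2.-1; move: p1; rewrite -{1 2}sp; case: (size p)./2.
rewrite coef_deriv -mulr_natl sj /= c2_odd // mul1r.
have -> : p`_j.*2.+1 = lead_coef p by rewrite /lead_coef sj.
by move/eqP; rewrite lead_coef_eq0 (negPf p0).
Qed.

(** The derivative of the norm equation, in which the derivatives of the
    squares vanish. *)
Lemma deriv_norm : A * (B^`() * T + e1%:P * B) = B * (A^`() * T + b%:P * B).
Proof.
have := congr1 (@deriv k) normE.
rewrite !expr2 derivC !derivD !derivM deriv_T deriv_S => h.
by apply: (c2_eq two0p); rewrite -h; ring2 two0p.
Qed.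

Lemma norm_coprime : coprimep A B.
Proof.
apply/Bezout_coprimepP; exists (A + B * T, B * S) => /=.
have -> : (A + B * T) * A + B * S * B = c0%:P by rewrite -normE; ring.
by rewrite -size_poly_eq1 size_polyC c00.
Qed.

(** A and B are coprime by the norm equation, so that B divides the cofactor
    of A in [deriv_norm]. *)
Lemma common_logderiv : exists G, B^`() * T + e1%:P * B = G * B /\ A^`() * T + b%:P * B = G * A.
Proof.
have : B %| B^`() * T + e1%:P * B.
  rewrite -(@Gauss_dvdpr _ _ A) 1?coprimep_sym ?norm_coprime //.
  by rewrite deriv_norm dvdp_mulr.
move/dvdpP => [G eG]; exists G; split=> //; apply: (mulfI B0).
by rewrite -deriv_norm eG; ring.
Qed.

Lemma size_monic_quad : size T = 3%N.
Proof.
rewrite TE -addrA size_polyDl size_polyXn // ltnS; apply: szD.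
  by apply: szZ; rewrite size_polyX.
exact: leq_trans (size_polyC_leq1 _) _.
Qed.

(** Since B has odd degree, the derivative of B has degree one less, and the
    common factor G has degree 1. Differentiating B' T + e1 B = G B once more,
    with B'' = 0, gives G' B = G B', hence B = v B' and then T = v (v + e1)
    where v = X - tau is G made monic. *)
Lemma ram_slope : exists tau,
  [/\ t0 = tau ^+ 2 + e1 * tau,
      B = ('X - tau%:P) * B^`(),
      B^`() * T = (('X - tau%:P) + e1%:P) * B
    & A^`() * T + b%:P * B = ('X - tau%:P) * A].
Proof.
have [G [GB GA]] := common_logderiv.
have B'0 : B^`() != 0.
  rewrite -size_poly_gt0 size_deriv_odd //.
  by move: B0 oddB; rewrite -size_poly_gt0; case: (size B) => [|[|]].
have sBp : (0 < size B)%N by rewrite size_poly_gt0.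
have T0 : T != 0 by rewrite -size_poly_gt0 size_monic_quad.
have sBT : size (B^`() * T) = (size B).+1.
  by rewrite size_mul // size_monic_quad size_deriv_odd //; lia.
have sGB : size (G * B) = (size B).+1.
  rewrite -GB size_polyDl sBT // ltnS; apply: szM => _ _.
  by have := size_polyC_leq1 e1; lia.
have G0 : G != 0 by apply: contraTneq isT => G0; move: sGB; rewrite G0 mul0r size_poly0.
have sGB2 : size (G * B) = (size G + size B).-1 by exact: size_mul.
have sG : size G = 2%N by move: sGB; rewrite sGB2; lia.
have [tau [e [ee GE]]] : exists tau e, e != 0 /\ G = e *: ('X - tau%:P).
  exists (- (G`_0 / G`_1)), G`_1.
  have g1 : G`_1 != 0 by have := lead_coef_eq0 G; rewrite /lead_coef sG (negPf G0) => ->.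
  split=> //; rewrite {1}(@size2_lin _ G) ?sG // scalerBr -[_ *: _%:P]mul_polyC -polyCM.
  by rewrite mulrN mulrCA mulfV // mulr1 polyCN opprK addrC.
have dG : G^`() = e%:P by rewrite GE derivZ derivXsubC alg_polyC.
have ep0 : e%:P != 0 :> {poly k} by rewrite polyC_eq0.
have BG : B * e%:P = B^`() * G.
  have := congr1 (@deriv k) GB; rewrite derivD !derivM deriv_T derivC dG.
  rewrite (deriv_deriv2 _ two0) !mul0r !add0r => h.
  apply: (c2_eq two0p).
  have -> : B * e%:P + B^`() * G = e%:P * B + G * B^`() by ring.
  by rewrite -h; ring2 two0p.
have TG : T * e%:P = G * (G + e1%:P).
  apply: (mulfI B'0); apply: (mulfI B0).
  have -> : B * (B^`() * (G * (G + e1%:P))) = B * (B^`() * G) * (G + e1%:P) by ring.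
  rewrite -BG.
  have -> : B * (B * e%:P) * (G + e1%:P) = B * e%:P * (G * B + e1%:P * B) by ring.
  by rewrite -GB; ring2 two0p.
exists tau.
have BE : B = ('X - tau%:P) * B^`().
  by apply: (mulIf ep0); rewrite BG GE -mul_polyC; ring.
have TE' : T = ('X - tau%:P) * (e%:P * ('X - tau%:P) + e1%:P).
  by apply: (mulIf ep0); rewrite TG GE -mul_polyC; ring.
have t0E : t0 = tau ^+ 2 + e1 * tau.
  have := congr1 (fun p => p.[tau]) TE'; rewrite TE !hornerE subrr mul0r => h.
  by apply: (c2_eq two0); rewrite -h; ring.
have e_1 : e = 1.
  have : ('X - tau%:P) ^+ 2 * (e%:P - 1) = 0 :> {poly k}.
    have -> : 0 = T - T by rewrite subrr.
    rewrite {1}TE' TE t0E -mul_polyC polyCD polyC_exp polyCM.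
    by ring2 two0p.
  move/eqP; rewrite mulf_eq0 expf_eq0 /= polyXsubC_eq0 /= subr_eq0 -polyC1.
  by move/eqP/polyC_inj.
have GE1 : G = 'X - tau%:P by rewrite GE e_1 scale1r.
split=> //.
- by rewrite -GE1 mulrDl -GB -addrA (c2_addrr two0p) addr0.
- by rewrite GA GE1.
Qed.


(** At the slope tau the equation Z^2 = T Z + S has the double root xQ. With
    A1 = A + xQ B and s0^2 = c0 the norm equation becomes
    (A1 + s0)^2 = B v (A1 (v + e1) + B (b + xQ (v + e1))),
    which relates the multiplicities of tau in A1 + s0 and in B. *)
Section AtSlope.
Variables (tau xQ s0 : k).
Local Notation v := ('X - tau%:P).
Hypotheses (t0E : t0 = tau ^+ 2 + e1 * tau) (BE : B = v * B^`()).
Hypotheses (xQE : xQ ^+ 2 = b * tau + g) (s0E : s0 ^+ 2 = c0).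
Let A1 := A + xQ%:P * B.

Lemma T_at_slope : T = v * (v + e1%:P).
Proof. by rewrite TE t0E -mul_polyC polyCD polyC_exp polyCM; ring2 two0p. Qed.

Lemma B_at_slope : B.[tau] = 0.
Proof. by rewrite BE !hornerE subrr mul0r. Qed.

Lemma A1_at_slope : A1.[tau] != 0.
Proof.
rewrite /A1 !hornerE B_at_slope mulr0 addr0.
have := congr1 (fun p => p.[tau]) normE.
rewrite !(hornerD, hornerM, horner_exp, hornerC) B_at_slope => e.
by apply: contraNneq c00 => A0; rewrite -e A0; apply/eqP; ring.
Qed.

Lemma shifted_norm : (A1 + s0%:P) ^+ 2 =
  B * (v * (A1 * (v + e1%:P) + B * (b%:P + xQ%:P * (v + e1%:P)))).
Proof.
have -> : (A1 + s0%:P) ^+ 2 = A1 ^+ 2 + c0%:P.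
  by rewrite -s0E polyC_exp; ring2 two0p.
have SE' : S + (xQ ^+ 2)%:P = b%:P * v.
  by rewrite SE xQE -mul_polyC polyCD polyCM; ring2 two0p.
rewrite -normE /A1; apply: (c2_eq two0p).
transitivity (B ^+ 2 * (S + (xQ ^+ 2)%:P + b%:P * v)
   + A * B * (T + v * (v + e1%:P))).
  by rewrite polyC_exp; ring2 two0p.
by rewrite SE' T_at_slope !(c2_addrr two0p) !mulr0 addr0.
Qed.

(** If tau had even multiplicity m in B, then B = v^m B1 and B = v B' would give
    B1 = v B1', as the derivative of v^m vanishes. *)
Lemma B_mult_odd m B1 : B1.[tau] != 0 -> B = v ^+ m * B1 -> odd m.
Proof.
move=> h e; apply/negPn/negP => om.
have vm0 : v ^+ m != 0 by rewrite expf_neq0 // polyXsubC_eq0.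
have : v ^+ m * B1 = v ^+ m * (v * B1^`()).
  rewrite -e {1}BE e derivM deriv_exp -mulr_natl derivXsubC.
  have -> : m%:R = 0 :> {poly k}.
    by rewrite -(odd_double_half m) (negPf om) add0n (c2_even two0p).
  by rewrite mul0r mul0r add0r; ring.
by move/(mulfI vm0) => eB; move: h; rewrite eB !hornerE subrr mul0r eqxx.
Qed.

(** When e1 <> 0 the last factor of the square is nonzero at tau, so that twice
    the multiplicity of tau in A1 + s0 is its multiplicity in B plus one. *)
Lemma wild_multiplicity : e1 != 0 -> exists m j B1 W, [/\ B1.[tau] != 0, W.[tau] != 0,
  B = v ^+ m * B1, A1 + s0%:P = v ^+ j * W & (odd m /\ (2 * j = m + 1)%N)].
Proof.
move=> e10; have [m [B1 [hB1 eB]]] := root_order tau B0.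
pose W0 := A1 * (v + e1%:P) + B * (b%:P + xQ%:P * (v + e1%:P)).
have W00 : W0.[tau] != 0.
  rewrite /W0 hornerD !hornerM B_at_slope mul0r addr0 mulf_neq0 ?A1_at_slope //.
  by rewrite !hornerE subrr add0r.
have sq : (A1 + s0%:P) ^+ 2 = v ^+ m.+1 * (B1 * W0).
  by rewrite shifted_norm -/W0 {1}eB exprS; ring.
have [|j [W [hW eW ej]]] := sqr_root_order _ sq; first by rewrite hornerM mulf_neq0.
exists m, j, B1, W; split=> //; split; first exact: (B_mult_odd hB1 eB).
by rewrite mulnC ej addn1.
Qed.

(** When e1 = 0 the last factor is divisible by v, which leaves the exponent
    m + 2, where m is the odd multiplicity in B. If m > 1, the remaining factor
    is a unit at tau and m + 2 is even, a contradiction. *)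
Lemma tame_multiplicity : e1 = 0 -> exists B1 W, [/\ B1.[tau] != 0,
  B = v * B1 & A1 + s0%:P = v ^+ 2 * W].
Proof.
move=> e10; have [m [B1 [hB1 eB]]] := root_order tau B0.
have om := B_mult_odd hB1 eB.
have m0 : (0 < m)%N by case: m om {eB}.
pose W0 := A1 + v ^+ m.-1 * B1 * (b%:P + xQ%:P * v).
have sq : (A1 + s0%:P) ^+ 2 = v ^+ m.+2 * (B1 * W0).
  have eB' : B = v * v ^+ m.-1 * B1 by rewrite -exprS prednK.
  have -> : v ^+ m.+2 = v ^+ 2 * (v * v ^+ m.-1) by rewrite -exprS prednK // -exprD.
  rewrite shifted_norm e10 /W0; move: A1 (v ^+ m.-1) eB' => A1' q ->.
  by rewrite polyC0; ring.
have m1 : m = 1%N.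
  have [//|m1] := eqVneq m 1%N; have m2 : (0 < m.-1)%N by lia.
  have W00 : W0.[tau] != 0.
    rewrite /W0 hornerD !hornerM horner_exp hornerXsubC subrr expr0n.
    by rewrite (gtn_eqF m2) !mul0r addr0 A1_at_slope.
  have [|j [W [_ _ jm]]] := sqr_root_order _ sq; first by rewrite hornerM mulf_neq0.
  by move: om; lia.
have [z|nz] := eqVneq (A1 + s0%:P) 0.
  by exists B1, 0; rewrite eB m1 expr1 mulr0.
have [j [W [hW eW]]] := root_order tau nz.
have : (m.+2 <= j * 2)%N.
  apply: (@root_order_le _ tau _ _ (W ^+ 2) (B1 * W0)).
    by rewrite horner_exp expf_neq0.
  by rewrite -sq eW exprMn -exprM.
rewrite m1 => j2; exists B1, (v ^+ (j - 2) * W); split=> //; first by rewrite eB m1.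
by rewrite mulrA -exprD subnKC // -ltnS; lia.
Qed.

End AtSlope.
End NormEquation.

(** * The pencil of lines through a point *)
Lemma rmorph_two0 (R : nzRingType) (K : fieldType) (f : {rmorphism R -> K}) :
  2 = 0 :> R -> 2 = 0 :> K.
Proof. by move=> h; rewrite -(rmorph_nat f) h rmorph0. Qed.

Lemma sqrt_closed (k : fieldType) (kc : alg_closed k) (a : k) : exists s, s ^+ 2 = a.
Proof.
have [|s /rootP] := kc ('X^2 - a%:P); first by rewrite size_XnsubC.
by rewrite !(hornerD, hornerN, hornerXn, hornerC) => /subr0_eq; exists s.
Qed.

Lemma discr_char2 (k : fieldType) (two0 : 2 = 0 :> k) (b1 b2 b3 b4 b6 : k) :
  discr b1 b2 b3 b4 b6 = b1 ^+ 4 * (b1 ^+ 2 * b6 + b1 * b3 * b4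
     + b2 * b3 ^+ 2 + b4 ^+ 2) + b3 ^+ 4 + b1 ^+ 3 * b3 ^+ 3.
Proof.
rewrite /discr (c2_even two0 2 : 4 = 0) (c2_even two0 4 : 8 = 0).
by rewrite (c2_odd two0 13 : 27 = 1) (c2_odd two0 4 : 9 = 1) two0; ring2 two0.
Qed.

Section Pencil.
Variables (k : fieldType) (E : ellcurve k) (M : funmodel E).
Variables (two0 : 2 = 0 :> k) (kc : alg_closed k).
Local Notation K := (mfield M).
Local Notation c := (mcst M).
Local Notation X := (mX M).
Local Notation Y := (mY M).
Local Notation O := (zeropt E).
Local Notation "p @ u" := (ev1 (mcst M) p u) (at level 10).

Let two0K : 2 = 0 :> K := rmorph_two0 c two0.

(** A common zero of the equation and its partial derivatives makes the
    discriminant vanish: solve the three conditions for a3, a4 and a6. *)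
Lemma smooth x y : oncurve E (Some (x, y)) -> a1 E * x + a3 E = 0 ->
  x ^+ 2 + a4 E + a1 E * y = 0 -> False.
Proof.
move=> /= /eqP e ey ex; have /eqP := discr_neq0 E; apply.
rewrite (discr_char2 two0).
have e3 : a3 E = a1 E * x by apply: (c2_eq two0); rewrite addrC.
have e4 : a4 E = x ^+ 2 + a1 E * y by apply: (c2_eq two0); rewrite -ex; ring.
have e6 : a6 E = y ^+ 2 + a2 E * x ^+ 2 + a1 E * x * y.
  apply: (c2_eq two0); transitivity (y ^+ 2 + a1 E * x * y + a3 E * y +
    (x ^+ 3 + a2 E * x ^+ 2 + a4 E * x + a6 E)).
    by rewrite e3 e4; ring2 two0.
  by rewrite e (c2_addrr two0).
by rewrite e3 e4 e6; ring2 two0.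
Qed.

(** P has coordinates (x0, y0 + bet), so that -P = (x0, y0), and bet <> 0 says
    that P is not of order 2. The function u is the slope of the line through
    -P and the current point. *)
Variables (P : point E) (x0 y0 : k).
Let bet := a1 E * x0 + a3 E.
Hypotheses (PE : val P = Some (x0, y0 + bet)) (bet0 : bet != 0).
Let gam := a1 E * y0 + x0 ^+ 2 + a4 E.
Let T : {poly k} := 'X^2 + a1 E *: 'X + (x0 + a2 E)%:P.
Let S : {poly k} := bet *: 'X + gam%:P.
Let Z : K := X - c x0.
Let u : K := (Y - c y0) / Z.

Lemma curve0 : y0 ^+ 2 + a1 E * x0 * y0 + a3 E * y0 =
  x0 ^+ 3 + a2 E * x0 ^+ 2 + a4 E * x0 + a6 E.
Proof.
case: P PE => -[[x y]|] //= xy [ex ey]; move: xy; rewrite /= ex ey => /eqP <-.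
by rewrite /bet; ring2 two0.
Qed.

Lemma Z_neq0 : Z != 0. Proof. exact: mX_cst_neq0. Qed.
Lemma Y_pencil : Y = u * Z + c y0.
Proof. by rewrite /u mulfVK ?Z_neq0 // subrK. Qed.
Lemma X_pencil : X = Z + c x0. Proof. by rewrite /Z subrK. Qed.

Lemma ev1_T w : T @ w = w ^+ 2 + c (a1 E) * w + c x0 + c (a2 E).
Proof. by rewrite /T !ev1D ev1Z ev1X ev1Xn ev1C rmorphD addrA. Qed.
Lemma ev1_S w : S @ w = c bet * w + c gam.
Proof. by rewrite /S !ev1D ev1Z ev1X ev1C. Qed.
Lemma horner_T w : T.[w] = w ^+ 2 + a1 E * w + x0 + a2 E.
Proof. by rewrite /T !(hornerD, hornerXn, hornerZ, hornerX, hornerC) addrA. Qed.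
Lemma horner_S w : S.[w] = bet * w + gam.
Proof. by rewrite /S !(hornerD, hornerZ, hornerX, hornerC). Qed.

(** The equation of E on the line of slope w through (x0, y0), as a cubic in
    z = x - x0 with the root z = 0. *)
Lemma line_eq (R : comPzRingType) (h2 : 2 = 0 :> R) (b1 b2 b3 b4 b6 z w p q : R) :
  q ^+ 2 + b1 * p * q + b3 * q = p ^+ 3 + b2 * p ^+ 2 + b4 * p + b6 ->
  (w * z + q) ^+ 2 + b1 * (z + p) * (w * z + q) + b3 * (w * z + q) +
   ((z + p) ^+ 3 + b2 * (z + p) ^+ 2 + b4 * (z + p) + b6) =
  z * (z ^+ 2 + ((w ^+ 2 + b1 * w + p + b2) * z +
          ((b1 * p + b3) * w + (b1 * q + p ^+ 2 + b4)))).
Proof.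
move=> e; have -> : b6 = q ^+ 2 + b1 * p * q + b3 * q + p ^+ 3 + b2 * p ^+ 2 + b4 * p.
  by apply: (c2_eq h2); rewrite addrC e; ring2 h2.
by ring2 h2.
Qed.

Lemma pencil_rel : Z ^+ 2 = T @ u * Z + S @ u.
Proof.
apply: (c2_eq two0K); apply: (mulfI Z_neq0); rewrite mulr0.
have := congr1 c curve0; rewrite !(rmorphD, rmorphM, rmorphXn) /=.
move/(line_eq two0K Z u); rewrite -Y_pencil -X_pencil (m_eq M) (c2_addrr two0K) => ->.
by rewrite ev1_T ev1_S /bet /gam !(rmorphD, rmorphM, rmorphXn).
Qed.

Lemma pt_on (u0 X0 : k) : X0 ^+ 2 = T.[u0] * X0 + S.[u0] ->
  oncurve E (Some (X0 + x0, u0 * X0 + y0)).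
Proof.
move=> e; apply/eqP; apply: (c2_eq two0); rewrite (line_eq two0 _ _ curve0).
by rewrite e horner_T horner_S /bet /gam (c2_addrr two0) mulr0.
Qed.

(** At -P itself the slope is that of the tangent: there u is rewritten as a
    quotient whose denominator takes the value bet. *)
Lemma val_pt (R : point E) u0 X0 : val R = Some (X0 + x0, u0 * X0 + y0) ->
  X0 ^+ 2 = T.[u0] * X0 + S.[u0] -> mval R u u0 /\ mval R Z X0.
Proof.
move=> RE e.
have [hX hY] : mval R X (X0 + x0) /\ mval R Y (u0 * X0 + y0).
  by case: R RE => -[[x y]|] //= xy [<- <-]; have := val_chart M (exist _ (Some (x, y)) xy).
have hZ : mval R Z X0.
  by have := val_sub hX (val_cst M R x0); rewrite addrK.
split=> //; have hY0 : mval R (Y - c y0) (u0 * X0).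
  by have := val_sub hY (val_cst M R y0); rewrite addrK.
have [z|z] := eqVneq X0 0; last first.
  by have := val_mul hY0 (val_inv hZ z); rewrite mulfK.
pose den := Y + c y0 + c (a1 E) * X + c (a3 E).
pose num := X ^+ 2 + X * c x0 + c x0 ^+ 2 + c (a2 E) * (X + c x0)
  + c (a4 E) + c (a1 E) * c y0.
have hc := val_cst M R.
have hden : mval R den bet.
  have -> : bet = u0 * X0 + y0 + y0 + a1 E * (X0 + x0) + a3 E.
    by rewrite z /bet; ring2 two0.
  by do !(apply: val_add || apply: val_mul).
have hnum : mval R num gam.
  have -> : gam = (X0 + x0) ^+ 2 + (X0 + x0) * x0 + x0 ^+ 2 + a2 E * (X0 + x0 + x0)
     + a4 E + a1 E * y0 by rewrite z /gam; ring2 two0.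
  by do !(apply: val_add || apply: val_mul || apply: val_exp).
have -> : u = num / den.
  apply: (mulIf (val_neq0 hden bet0)); rewrite mulfVK ?(val_neq0 hden bet0) //.
  apply: (mulfI Z_neq0); rewrite mulrA [Z * u]mulrC -[u * Z](addrK (c y0)) -Y_pencil.
  have := m_eq M; have := congr1 c curve0; rewrite !(rmorphD, rmorphM, rmorphXn) /= => e1 e2.
  apply: (c2_eq two0K); rewrite /den /num /Z.
  transitivity (
  (Y ^+ 2 + c (a1 E) * X * Y + c (a3 E) * Y) +
  (c y0 ^+ 2 + c (a1 E) * c x0 * c y0 + c (a3 E) * c y0) +
  ((X ^+ 3 + c (a2 E) * X ^+ 2 + c (a4 E) * X + c (a6 E)) +
  (c x0 ^+ 3 + c (a2 E) * c x0 ^+ 2 + c (a4 E) * c x0 + c (a6 E)))).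
    by ring2 two0K.
  by rewrite e1 e2 (c2_addrr two0K).
have -> : u0 = gam / bet.
  move: e; rewrite z expr0n mulr0 add0r horner_S /= => /esym e.
  by apply: (canRL (mulfK bet0)); rewrite mulrC; apply: (c2_eq two0).
by apply: val_mul => //; apply: val_inv.
Qed.

Lemma pt_exists u0 X0 : X0 ^+ 2 = T.[u0] * X0 + S.[u0] ->
  exists R : point E, [/\ val R = Some (X0 + x0, u0 * X0 + y0), R <> O, R <> P,
   mval R u u0 & mval R Z X0].
Proof.
move=> e; have xy := pt_on e.
exists (exist _ (Some (X0 + x0, u0 * X0 + y0)) xy).
have [h1 h2] := val_pt (R := exist _ (Some (X0 + x0, u0 * X0 + y0)) xy) erefl e.
split=> // RP; move: PE; rewrite -RP /= => -[h3 /eqP].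
have -> : X0 = 0 by apply: (addIr x0); rewrite h3 add0r.
by rewrite mulr0 add0r -subr_eq0 opprD addrA subrr sub0r oppr_eq0 (negPf bet0).
Qed.

(** The points other than O and P correspond to the points of the affine curve
    z^2 = T(w) z + S(w): at w = infinity this model has lost exactly the two
    poles of u. *)
Lemma pt_param (R : point E) : R <> O -> R <> P ->
  exists u0 X0, [/\ val R = Some (X0 + x0, u0 * X0 + y0),
    X0 ^+ 2 = T.[u0] * X0 + S.[u0], mval R u u0 & mval R Z X0].
Proof.
move=> RO RP.
suff [u0 [X0 [h1 h2]]] : exists u0 X0, val R = Some (X0 + x0, u0 * X0 + y0) /\
    X0 ^+ 2 = T.[u0] * X0 + S.[u0].
  by have [h3 h4] := val_pt h1 h2; exists u0, X0.
case: R RO RP => -[[x y]|] xy RO RP; last by case: RO; apply/val_inj.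
have [xx0|xx0] := eqVneq x x0.
  exists (gam / bet), 0; rewrite mulr0 !add0r horner_S expr0n mulr0 add0r; split.
    have : (y + y0) * (y + (y0 + bet)) = 0.
      have /= /eqP := xy; rewrite xx0 -curve0 => e.
      rewrite -(c2_addrr two0 (y0 ^+ 2 + a1 E * x0 * y0 + a3 E * y0)).
      by rewrite -{1}e /bet; ring2 two0.
    move/eqP; rewrite mulf_eq0 => /orP [] /eqP /(c2_eq two0) ey; first by rewrite /= xx0 ey.
    by case: RP; apply/val_inj; rewrite /= PE xx0 ey.
  by rewrite mulrCA mulfV // mulr1 (c2_addrr two0).
exists ((y - y0) / (x - x0)), (x - x0).
have xx : x - x0 != 0 by rewrite subr_eq0.
rewrite mulfVK // !subrK; split=> //.
apply: (c2_eq two0); apply: (mulfI xx); rewrite mulr0.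
have := line_eq two0 (x - x0) ((y - y0) / (x - x0)) curve0.
rewrite mulfVK // !subrK; have /= /eqP -> := xy; rewrite (c2_addrr two0) => ->.
by rewrite horner_T horner_S.
Qed.

(** k[u] + k[u] Z is the ring of functions with poles at O and P only. *)
Definition qe (A B : {poly k}) : K := A @ u + B @ u * Z.

Lemma qeZ A B : qe A B * Z = qe (B * S) (A + B * T).
Proof.
by have := pencil_rel; rewrite /qe; move: (T) (S) => T' S' r; rewrite !(ev1D, ev1M); ring: r.
Qed.
Lemma qeu A B : qe A B * u = qe (A * 'X) (B * 'X).
Proof. by rewrite /qe !ev1M ev1X; ring. Qed.
Lemma qeD A B A' B' : qe A B + qe A' B' = qe (A + A') (B + B').
Proof. by rewrite /qe !ev1D; ring. Qed.
Lemma qec a A B : c a * qe A B = qe (a *: A) (a *: B).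
Proof. by rewrite /qe !ev1Z; ring. Qed.
Lemma qe_cst a : qe a%:P 0 = c a.
Proof. by rewrite /qe ev1C ev1_0 mul0r addr0. Qed.

Lemma pe_qe a b : exists A B, pe M a b = qe A B.
Proof.
have evX p : exists A B, p @ X = qe A B.
  elim/poly_ind: p => [|p y [A [B e]]].
    by exists 0, 0; rewrite ev1_0 /qe !ev1_0 mul0r addr0.
  rewrite ev1D ev1M ev1X ev1C e -qe_cst {1}X_pencil mulrDr qeZ [_ * c _]mulrC qec !qeD.
  by do 2!eexists.
have [A [B e]] := evX a; have [A' [B' e']] := evX b.
rewrite /pe e e' Y_pencil mulrDr mulrA [_ * c _]mulrC qec qeu qeZ !qeD.
by do 2!eexists.
Qed.

Lemma val_qe R A B u0 X0 : mval R u u0 -> mval R Z X0 ->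
  mval R (qe A B) (A.[u0] + B.[u0] * X0).
Proof.
by move=> hu hZ; apply: val_add; [|apply: val_mul => //]; apply: val_ev1.
Qed.

Definition normq (A B : {poly k}) := A ^+ 2 + A * B * T + B ^+ 2 * S.

Lemma normqE A B : qe A B * qe (A + B * T) B = normq A B @ u.
Proof.
have := pencil_rel; rewrite /qe /normq; move: (T) (S) => T' S' r.
by rewrite !(ev1D, ev1M); ring2 two0K: r.
Qed.

Lemma quad_roots2 (p q : k) : exists y y', [/\ y ^+ 2 = p * y + q,
  y' ^+ 2 = p * y' + q, y + y' = p & y * y' = q].
Proof.
have [y [y' [e1 e2]]] := quad_roots kc p q.
exists y, y'; rewrite (c2_opp two0) in e1; rewrite (c2_opp two0) in e2.
by split=> //; rewrite -e1 -e2; ring2 two0.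
Qed.

(** A root u0 of the norm would yield a zero of the function at one of the two
    points of slope u0. *)
Lemma normq_const A B : (forall R, R <> O -> R <> P -> ~ mvan R (qe A B)) ->
  exists2 c0, c0 != 0 & normq A B = c0%:P.
Proof.
move=> nv; have nr u0 : (normq A B).[u0] != 0.
  apply/eqP => e.
  have [y [y' [e1 e2 e3 e4]]] := quad_roots2 T.[u0] S.[u0].
  have : (A.[u0] + B.[u0] * y) * (A.[u0] + B.[u0] * y') = 0.
    rewrite -e /normq; move: (T) (S) e3 e4 => T' S' e3 e4.
    by rewrite !(hornerD, hornerM) -e3 -e4; ring.
  move/eqP; rewrite mulf_eq0 => /orP [] /eqP z.
    have [R [_ RO RP hu hZ]] := pt_exists e1.
    by apply: (nv R RO RP); apply/mvanP; rewrite -z; apply: val_qe.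
  have [R [_ RO RP hu hZ]] := pt_exists e2.
  by apply: (nv R RO RP); apply/mvanP; rewrite -z; apply: val_qe.
have [s1|s1] := leqP (size (normq A B)) 1.
  rewrite (size1_polyC s1); exists (normq A B)`_0 => //.
  by have := nr 0; rewrite {1}(size1_polyC s1) hornerC.
by have [u0 /rootP e] := kc s1; have := nr u0; rewrite e eqxx.
Qed.

Lemma mord_inf_Z : mord O Z (- 2%:Z).
Proof.
apply: (mord_add (n := 0)) (mord_inf_X M) _ _ => //.
by rewrite -rmorphN; apply: mge_reg (munif_inf M) (mreg_cst _ _ _).
Qed.
Lemma mord_inf_u : mord O u (- 1).
Proof.
have h : mord O (Y - c y0) (- 3%:Z).
  apply: (mord_add (n := 0)) (mord_inf_Y M) _ _ => //.
  by rewrite -rmorphN; apply: mge_reg (munif_inf M) (mreg_cst _ _ _).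
exact: mord_mul h (mord_inv mord_inf_Z).
Qed.

Lemma mord_inf_qe (A B : {poly k}) : B != 0 -> ((size A).+1 = size B)%N ->
  mord O (qe A B) (- (size B).+1%:Z).
Proof.
move=> B0 sAB; have t := munif_inf M.
have hB : mord O (B @ u * Z) (- (size B).+1%:Z).
  have -> : - (size B).+1%:Z = - (1 * (size B).-1)%N%:Z + - 2%:Z.
    have : (0 < size B)%N by rewrite size_poly_gt0.
    by lia.
  by apply: mord_mul mord_inf_Z; apply: mord_poly => //; apply: mord_inf_u.
rewrite /qe; have [->|A0] := eqVneq A 0; first by rewrite ev1_0 add0r.
rewrite addrC; apply: mord_add hB (mord_mge (mord_poly _ A0 mord_inf_u)) _ => //.
by rewrite mul1n; lia.
Qed.

(** The norm equation, and the parity of the size of B. By the norm equation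
    A and A + B T, of product c0 + B^2 S, have degrees with sum 2 deg B + 1,
    and one of them has degree deg B - 1. If it is A, then B Z has the dominant
    pole at O, and comparing with f gives n = size B + 1. If it is A + B T,
    the conjugate of f has a pole at O, as f does, although their product is
    constant. *)
Lemma pencil_form (f : K) (n : nat) : odd n -> mord O f (- n%:Z) ->
  (forall R, R <> O -> mreg R f) -> (forall R, R <> O -> R <> P -> ~ mvan R f) ->
  exists (A B : {poly k}) c0, [/\ f = qe A B, normq A B = c0%:P, c0 != 0, B != 0
    & ~~ odd (size B)].
Proof.
move=> on hf rf nv; have [a [b e]] := reg_affine kc rf.
have [A [B e']] := pe_qe a b; have {a b e e'} fE : f = qe A B by rewrite e e'.
rewrite fE in nv hf {rf}; have [c0 c00 nE] := normq_const nv.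
exists A, B, c0.
have t := munif_inf M; have n0 : (0 < n)%N by case: n on hf.
have sc0 : size c0%:P = 1%N by rewrite size_polyC c00.
have B0 : B != 0.
  apply/eqP => B0; move: nE; rewrite /normq B0 mulr0 mul0r expr0n mul0r !addr0 => nA.
  have sA : size A = 1%N.
    have A0 : A != 0 by apply: contraTneq isT => A0; move: sc0; rewrite -nA A0 expr0n size_poly0.
    have : size (A ^+ 2) = (size A + size A).-1 by rewrite expr2; exact: size_mul.
    rewrite nA sc0; have : (0 < size A)%N by rewrite size_poly_gt0.
    by lia.
  have /eqP/size_poly1P [y y0' Ay] := sA.
  move: hf; rewrite Ay B0 qe_cst => h; have := munit_ord t (munit_cst M O y0').
  by move/(mord_uniq h); lia.
have sS : size S = 2%N.
  rewrite /S size_polyDl size_scale ?size_polyX // ltnS.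
  exact: leq_trans (size_polyC_leq1 _) _.
have S0 : S != 0 by rewrite -size_poly_gt0 sS.
have sT : size T = 3%N by rewrite (@size_monic_quad _ (a1 E) (x0 + a2 E) T).
have T0 : T != 0 by rewrite -size_poly_gt0 sT.
have sB : (0 < size B)%N by rewrite size_poly_gt0.
have sM (p q : {poly k}) : p != 0 -> q != 0 ->
    size (p * q) = (size p + size q).-1 by exact: size_mul.
have sBT : size (B * T) = (size B).+2 by rewrite sM // sT; lia.
have sBS : size (B ^+ 2 * S) = (2 * size B)%N.
  by rewrite expr2 sM ?mulf_neq0 // sS sM //; lia.
have AA : A * (A + B * T) = B ^+ 2 * S + c0%:P.
  by rewrite -nE /normq; ring2 (c2_poly two0).
have sAA : size (A * (A + B * T)) = (2 * size B)%N.
  by rewrite AA size_polyDl sBS // sc0; lia.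
have AA0 : A * (A + B * T) != 0 by rewrite -size_poly_gt0 sAA; lia.
have [A0 A20] : A != 0 /\ A + B * T != 0.
  by move: AA0; rewrite mulf_eq0 negb_or => /andP.
have sAA2 : (size A + size (A + B * T)%R).-1 = (2 * size B)%N.
  by rewrite -sAA; apply/esym; exact: size_mul.
have [h1|h1] := boolP ((size A).+1 == size B).
  have h := mord_inf_qe B0 (eqP h1); have := mord_uniq h hf => en.
  by split=> //; move: on; have -> : n = (size B).+1 by lia; rewrite /= => ->.
have h2 : (size (A + B * T)%R).+1 = size B.
  have [s1|s1] := ltnP (size (B * T)) (size A).
    by move: sAA2; rewrite (size_polyDl s1); move: s1; rewrite sBT; clear; lia.
  have [s2|s2] := eqVneq (size A) (size (B * T)).
    by move: sAA2; rewrite s2 sBT; clear; lia.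
  have s3 : (size A < size (B * T)%R)%N by rewrite ltn_neqAle s2 s1.
  move: sAA2; rewrite addrC (size_polyDl s3) sBT.
  by move: h1; clear; lia.
have hq := mord_inf_qe B0 h2.
have := mord_mul hf hq; rewrite normqE nE ev1C => h.
have := mord_uniq h (munit_ord t (munit_cst M O c00)).
by move: n0; clear; lia.
Qed.

(** * Ramification of a function with divisor n(P) - n(O) *)
Section Ramification.
Variables (A B : {poly k}) (c0 s0 : k).
Hypotheses (nE : normq A B = c0%:P) (c00 : c0 != 0) (B0 : B != 0).
Hypotheses (oB : ~~ odd (size B)) (s0E : s0 ^+ 2 = c0).

(** tau is the slope of [ram_slope] and X1 the double root of Z^2 = T Z + S there;
    d1 is the derivative of the equation of E with respect to y at Q. *)
Variables (tau X1 : k).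
Hypothesis t0E : x0 + a2 E = tau ^+ 2 + a1 E * tau.
Hypothesis BE : B = ('X - tau%:P) * B^`().
Hypothesis X1E : X1 ^+ 2 = bet * tau + gam.

Lemma T_tau w : T.[w] = (w + tau) * (w + tau + a1 E).
Proof. by rewrite horner_T -[_ + x0 + _]addrA t0E; ring2 two0. Qed.

Lemma X1_eq : X1 ^+ 2 = T.[tau] * X1 + S.[tau].
Proof. by rewrite T_tau (c2_addrr two0) !mul0r add0r horner_S X1E. Qed.

Let d1 := a1 E * (X1 + x0) + a3 E.

(** Otherwise Q would be a singular point of E. *)
Lemma d1_neq0 : d1 != 0.
Proof.
apply/eqP => dz; have xy := pt_on X1_eq.
apply: (smooth xy dz).
have e : a1 E * X1 = bet by apply: (c2_eq two0); rewrite -dz /d1 /bet; ring.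
have -> : (X1 + x0) ^+ 2 + a4 E + a1 E * (tau * X1 + y0) =
  X1 ^+ 2 + (a1 E * X1) * tau + (x0 ^+ 2 + a1 E * y0 + a4 E) by ring2 two0.
by rewrite X1E e /gam; ring2 two0.
Qed.

Variable Q : point E.
Hypotheses (QE : val Q = Some (X1 + x0, tau * X1 + y0)).
Let hu : mval Q u tau := (val_pt QE X1_eq).1.
Let hZ : mval Q Z X1 := (val_pt QE X1_eq).2.

Lemma munif_Q : munif Q (Z - c X1).
Proof.
have -> : Z - c X1 = X - c (X1 + x0) by rewrite /Z rmorphD; ring.
apply: (munif_affine M QE); rewrite -/d1.
by rewrite -[2 * _]/(2%:R * _) two0 mul0r add0r -/d1 d1_neq0.
Qed.

Lemma mord_Q_Z : mord Q (Z - c X1) 1.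
Proof. exact: munif_ord munif_Q. Qed.

(** u is ramified at Q: the relation Z^2 = T(u) Z + S(u) makes u - tau the square
    of Z - X1 divided by a function w that takes the value d1 <> 0 at Q. *)
Lemma mord_Q_v : mord Q (u - c tau) 2.
Proof.
pose w := c d1 + c X1 * (u - c tau) + (u - c tau + c (a1 E)) * (Z - c X1).
have hw : mval Q w d1.
  have -> : d1 = d1 + X1 * (tau - tau) + (tau - tau + a1 E) * (X1 - X1) by ring.
  have hc := val_cst M Q.
  by do !(apply: val_sub || apply: val_add || apply: val_mul).
have w0 := val_neq0 hw d1_neq0.
have -> : u - c tau = w^-1 * (Z - c X1) ^+ 2.
  apply: (mulfI w0); rewrite mulVKf //; apply: (c2_eq two0K).
  have e2 := congr1 c t0E; have e3 := pencil_rel.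
  rewrite ev1_T ev1_S in e3.
  have e4 : c (a2 E) = c tau ^+ 2 + c (a1 E) * c tau + c x0.
    apply: (c2_eq two0K); move: e2; rewrite !(rmorphD, rmorphM, rmorphXn) /= => e2.
    transitivity ((c x0 + c (a2 E)) + (c tau ^+ 2 + c (a1 E) * c tau)); first by ring.
    by rewrite e2 (c2_addrr two0K).
  have e5 : c gam = c X1 ^+ 2 + c bet * c tau.
    have aux b g : X1 ^+ 2 = b * tau + g -> c X1 ^+ 2 = c b * c tau + c g.
      by move/(congr1 c); rewrite rmorphD rmorphM rmorphXn.
    by rewrite (aux _ _ X1E); ring2 two0K.
  have e6 : c bet = c (a1 E) * c x0 + c (a3 E) by rewrite /bet rmorphD rmorphM.
  rewrite /w /d1 !(rmorphD, rmorphM); rewrite e5 e4 e6 in e3.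
  move: (Z) (u) e3 => z w' e3.
  transitivity (z ^+ 2 + ((w' ^+ 2 + c (a1 E) * w' + c x0 + (c tau ^+ 2 + c (a1 E) * c tau + c x0)) * z + ((c (a1 E) * c x0 + c (a3 E)) * w' + (c X1 ^+ 2 + (c (a1 E) * c x0 + c (a3 E)) * c tau)))).
    by ring2 two0K.
  by rewrite e3 (c2_addrr two0K).
have := mord_mul (munit_ord munif_Q (munit_inv (ex_intro2 _ _ d1 d1_neq0 hw))) (mord_exp 2 mord_Q_Z).
by rewrite add0r.
Qed.

Lemma qe_decomp : qe A B - c s0 =
  (A + X1%:P * B + s0%:P) @ u + B @ u * (Z - c X1).
Proof. by rewrite /qe !(ev1D, ev1M, ev1C); ring2 two0K. Qed.

Lemma ev_v m (p : {poly k}) :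
  (('X - tau%:P) ^+ m * p) @ u = (u - c tau) ^+ m * p @ u.
Proof. by rewrite ev1M ev1_exp ev1D ev1N ev1X ev1C. Qed.

Lemma mord_Q_pow m (W : {poly k}) : W.[tau] != 0 ->
  mord Q ((('X - tau%:P) ^+ m * W) @ u) (2 * m)%N%:Z.
Proof.
move=> W0; rewrite ev_v.
have h := mord_exp m mord_Q_v.
have hW : munit Q (W @ u) by exists W.[tau] => //; apply: val_ev1.
have := mord_mul h (munit_ord munif_Q hW); rewrite addr0.
by congr mord; lia.
Qed.

(** In the decomposition [qe_decomp] the first term has order 2j = m + 1, and
    the second one the larger order 2m + 1. *)
Lemma wild_index : a1 E != 0 -> exists2 e, ~~ odd e && (0 < e)%N &
  mord Q (qe A B - c s0) e%:Z.
Proof.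
move=> a10; have [m [j [B1 [W [hB1 hW eB eA [om ej]]]]]] :=
  @wild_multiplicity k two0 (a1 E) (x0 + a2 E) bet gam c0 A B T S erefl erefl c00 nE B0
   tau X1 s0 t0E BE X1E s0E a10.
exists (2 * j)%N; first by move: om ej; clear; lia.
rewrite qe_decomp eA eB.
have h1 := mord_Q_pow j hW.
have h2 := mord_mul (mord_Q_pow m hB1) mord_Q_Z.
by apply: mord_add h1 (mord_mge h2) _; move: om ej; clear; lia.
Qed.

(** In the decomposition [qe_decomp] the first term has order at least 4, and
    the second one order 2 + 1. *)
Lemma tame_index : a1 E = 0 -> mord Q (qe A B - c s0) 3%:Z.
Proof.
move=> a10; have [B1 [W [hB1 eB eA]]] :=
  @tame_multiplicity k two0 (a1 E) (x0 + a2 E) bet gam c0 A B T S erefl erefl c00 bet0 nE oB B0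
   tau X1 s0 t0E BE X1E s0E a10.
rewrite qe_decomp eA eB -{2}['X - _]expr1.
have h2 := mord_mul (mord_Q_pow 1 hB1) mord_Q_Z.
rewrite addrC; apply: mord_add h2 (_ : mge Q _ 4) _ => //.
rewrite ev_v -[4]addr0; apply: mge_mul; first exact: mord_mge (mord_exp 2 mord_Q_v).
by apply: (mge_reg munif_Q); apply: mreg_val (val_ev1 W hu).
Qed.

(** Expand f - f(R) to first order in v = u - u0 and t = Z - X0. The relation
    of Z and u gives T(u0) t = bet v + (order 2), and the two identities for A'
    and B' then turn T(u0) (f - f(R)) into (u0 + tau) f(R) v + (order 2). If
    this has order 2, so has v, hence also t, which is a uniformizer. *)
Lemma unramified R c' : a1 E = 0 ->
  B^`() * T = ('X - tau%:P + (a1 E)%:P) * B ->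
  A^`() * T + bet%:P * B = ('X - tau%:P) * A ->
  R <> O -> R <> P -> R <> Q -> ~ mge R (qe A B - c c') 2.
Proof.
move=> a10 dB dA RO RP RQ h2.
have [u0 [X0 [RE e hu0 hZ0]]] := pt_param RO RP.
have T0E : T.[u0] = (u0 + tau) ^+ 2 by rewrite T_tau a10 addr0 expr2.
have ut0 : u0 + tau != 0.
  apply: contra_notN RQ => /eqP ut.
  have uE : u0 = tau by apply: (c2_eq two0).
  have : (X0 + X1) ^+ 2 = 0.
    transitivity (X0 ^+ 2 + X1 ^+ 2); first by ring2 two0.
    by rewrite e X1_eq T0E T_tau (c2_addrr two0) ut expr0n !mul0r !add0r uE (c2_addrr two0).
  move/eqP; rewrite expf_eq0 /= => /eqP /(c2_eq two0) XX.
  by apply/val_inj; rewrite RE QE uE XX.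
pose t := Z - c X0; pose v := u - c u0.
have ht : munif R t.
  have -> : t = X - c (X0 + x0) by rewrite /t /Z rmorphD; ring.
  apply: (munif_affine M RE).
  by rewrite -[2 * _]/(2%:R * _) two0 mul0r add0r; move: bet0; rewrite /bet a10 !mul0r.
have t1 : mge R t 1 by apply: mord_mge; apply: munif_ord.
have v1 : mge R v 1.
  by apply: (mge_van ht); apply/mval_sub_cst.
have g0 (f : K) (rf : mreg R f) : mge R f 0 := mge_reg ht rf.
have m2 (f g h : K) : mge R f 1 -> mge R g 1 -> mreg R h -> mge R (f * g * h) 2.
  by move=> hf hg hh; have := mge_mul (mge_mul hf hg) (g0 _ hh).
have rZ := mreg_val hZ0.
have rv : mreg R v by apply: mge0_reg v1.
have rt : mreg R t by apply: munif_reg.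
have revu p : mreg R (p @ u) by exact: mreg_val (val_ev1 p hu0).
pose f0 := A.[u0] + B.[u0] * X0.
have f00 : f0 != 0.
  have := congr1 (fun p => p.[u0]) nE; rewrite hornerC /normq.
  apply: contra_eqN => /eqP z; rewrite eq_sym.
  have -> : (A ^+ 2 + A * B * T + B ^+ 2 * S).[u0] = f0 * (A.[u0] + B.[u0] * (T.[u0] + X0)).
    rewrite /f0; move: (T) (S) e => T' S' e.
    rewrite !(hornerD, hornerM); apply: (c2_eq two0).
    have -> : S'.[u0] = X0 ^+ 2 + T'.[u0] * X0 by rewrite e; ring2 two0.
    by ring2 two0.
  by rewrite z mul0r.
have cE : c' = f0.
  have := mge1_van (isT : 1 <= 2%:Z) h2 => /mval_sub_cst h.
  exact: val_uniq h (val_qe A B hu0 hZ0).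
rewrite {c'}cE in h2.
have tE : c T.[u0] * t = c bet * v + v * v * c X0 + t * t * 1 + t * v * v.
  have e1 : T @ u = c T.[u0] + v ^+ 2.
    by rewrite ev1_T horner_T a10 rmorph0 !(rmorphD, rmorphM, rmorphXn) /= /v; ring2 two0K.
  have e2 : S @ u = c S.[u0] + c bet * v.
    by rewrite ev1_S horner_S; move: (bet) (gam) => b g; rewrite rmorphD rmorphM /v; ring2 two0K.
  have e3 : c S.[u0] = c X0 ^+ 2 + c T.[u0] * c X0.
    move: (T.[u0]) (S.[u0]) e => T' S' /(congr1 c).
    by rewrite rmorphXn rmorphD rmorphM /= => ->; ring2 two0K.
  have := pencil_rel; rewrite e1 e2 e3 -/v /t; move: (Z) (c T.[u0]) (v) => z T' w r.
  apply: (c2_eq two0K).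
  transitivity (z ^+ 2 + ((T' + w ^+ 2) * z + (c X0 ^+ 2 + T' * c X0 + c bet * w))).
    by ring2 two0K.
  by rewrite r (c2_addrr two0K).
have [A2 eA] := taylor2 u0 A; have [B2 eB] := taylor2 u0 B.
have evtaylor (p q : {poly k}) : p = p.[u0]%:P + p^`().[u0] *: ('X - u0%:P) + ('X - u0%:P) ^+ 2 * q ->
    p @ u = c p.[u0] + c p^`().[u0] * v + v ^+ 2 * q @ u.
  move=> ep; rewrite {1}ep !ev1D ev1C ev1Z ev1M ev1_exp !ev1D ev1N ev1X ev1C //.
pose T0 := T.[u0].
have coefE : T0 * A^`().[u0] + T0 * B^`().[u0] * X0 + bet * B.[u0] = (u0 + tau) * f0.
  have := congr1 (fun p => p.[u0]) dA; have := congr1 (fun p => p.[u0]) dB.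
  rewrite /f0 /T0 a10; move: (T) => T'.
  rewrite !(hornerD, hornerM, hornerN, hornerC, hornerX) addr0 => eB' eA'.
  transitivity ((A^`().[u0] * T'.[u0] + bet * B.[u0]) + B^`().[u0] * T'.[u0] * X0); first by ring.
  by rewrite eB' eA'; ring2 two0.
have key : c T0 * (qe A B - c f0) = c ((u0 + tau) * f0) * v
   + v * v * (c T0 * (A2 @ u + B2 @ u * Z) + c B.[u0] * c X0)
   + v * t * (c T0 * c B^`().[u0]) + t * t * c B.[u0] + v * v * (t * c B.[u0]).
  move: (bet) coefE tE => b coefE tE.
  rewrite -coefE /qe (evtaylor _ _ eA) (evtaylor _ _ eB) /f0 -/T0.
  have zE : Z = t + c X0 by rewrite /t subrK.
  rewrite zE !(rmorphD, rmorphM); rewrite -/T0 in tE.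
  transitivity (c B.[u0] * (c T0 * t) +
    (c T0 * (c A^`().[u0] * v + v ^+ 2 * A2 @ u + (c B^`().[u0] * v + v ^+ 2 * B2 @ u) * (t + c X0)))).
    by ring2 two0K.
  by rewrite tE; ring2 two0K.
have cv : mge R (c ((u0 + tau) * f0) * v) 2.
  have hl : mge R (c T0 * (qe A B - c f0)) 2.
    by have := mge_mul (g0 _ (mreg_cst M R T0)) h2.
  have hr : mge R (v * v * (c T0 * (A2 @ u + B2 @ u * Z) + c B.[u0] * c X0)
   + v * t * (c T0 * c B^`().[u0]) + t * t * c B.[u0] + v * v * (t * c B.[u0])) 2.
    have hc := mreg_cst M R.
    do !apply: mge_add; apply: m2 => //; do !(apply: mreg_add || apply: mreg_mul) => //.
  by have := mge_sub hl hr; rewrite key; congr mge; ring.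
have v2 : mge R v 2.
  have hc := mge_mul (g0 _ (mreg_cst M R ((u0 + tau) * f0)^-1)) cv.
  by move: hc; rewrite mulrA -rmorphM mulVf ?mulf_neq0 // rmorph1 mul1r.
have : mge R (c T.[u0] * t) 2.
  rewrite tE; have hc := mreg_cst M R.
  apply: mge_add; last by apply: m2.
  apply: mge_add; last by apply: m2 => //; rewrite -(rmorph1 c).
  apply: mge_add; last by apply: m2.
  by have := mge_mul (g0 _ (hc bet)) v2.
have hT0 : mord R (c T.[u0] * t) 1.
  have T00 : T.[u0] != 0 by rewrite T0E expf_neq0.
  by have := mord_mul (munit_ord ht (munit_cst M R T00)) (munif_ord ht).
by move/(mge_ord_lt hT0).
Qed.

End Ramification.
End Pencil.

(** * Principal divisors on curves with a1 = 0 *)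
Section Chords.
Variables (k : fieldType) (E : ellcurve k) (M : funmodel E).
Variables (two0 : 2 = 0 :> k) (kc : alg_closed k) (a10 : a1 E = 0).
Local Notation K := (mfield M).
Local Notation c := (mcst M).
Local Notation X := (mX M).
Local Notation Y := (mY M).
Local Notation O := (zeropt E).

Let two0K : 2 = 0 :> K := rmorph_two0 c two0.
Implicit Types (P Q R S A B : point E) (f g : K) (D : point E -> int).

Lemma a3_neq0 : a3 E != 0.
Proof.
have := discr_neq0 E; rewrite (discr_char2 two0) a10.
by apply: contra => /eqP ->; apply/eqP; ring.
Qed.

Lemma munif_pt R x y : val R = Some (x, y) -> munif R (X - c x).
Proof.
move=> RE; apply: (munif_affine M RE).
by rewrite -[2 * _]/(2%:R * _) two0 a10 !mul0r !add0r a3_neq0.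
Qed.

Lemma munif_ex R : exists t : K, munif R t.
Proof.
case: R => -[[x y]|] xy.
  by exists (X - c x); apply: (@munif_pt (exist _ (Some (x, y)) xy) x y).
exists (X / Y); have -> : exist _ None xy = O by apply/val_inj.
exact: munif_inf.
Qed.

Lemma unit_ord R (f : K) : munit R f -> mord R f 0.
Proof. by have [t ht] := munif_ex R; apply: munit_ord ht. Qed.

Lemma oncurveE x y : oncurve E (Some (x, y)) =
  (y ^+ 2 + a3 E * y == x ^+ 3 + a2 E * x ^+ 2 + a4 E * x + a6 E).
Proof. by rewrite /= a10 !mul0r addr0. Qed.

Lemma neg_on x y : oncurve E (Some (x, y)) -> oncurve E (Some (x, y + a3 E)).
Proof. by rewrite !oncurveE => /eqP <-; apply/eqP; ring2 two0. Qed.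

Definition negpt (R : point E) : point E :=
  if R is exist (Some (x, y)) xy then exist (oncurve E) (Some (x, y + a3 E)) (neg_on xy)
  else O.

Lemma val_negpt R x y : val R = Some (x, y) -> val (negpt R) = Some (x, y + a3 E).
Proof. by case: R => -[[x' y']|] //= xy [-> ->]. Qed.

Lemma val_pt_ss R x y : val R = Some (x, y) -> mval R X x /\ mval R Y y.
Proof.
case: R => -[[x' y']|] //= xy [<- <-].
exact: (val_chart M (exist _ (Some (x', y')) xy)).
Qed.

Lemma pt_on_ss R x y : val R = Some (x, y) -> oncurve E (Some (x, y)).
Proof. by move=> <-; apply: valP. Qed.

(** The divisor of the point P. *)
Definition dl (P R : point E) : int := (R == P)%:R.
Definition mdiv (f : K) (D : point E -> int) := forall R, mord R f (D R).

Lemma mdivM f g D D' : mdiv f D -> mdiv g D' -> mdiv (f * g) (fun R => D R + D' R).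
Proof. by move=> h h' R; apply: mord_mul. Qed.
Lemma mdivV f D : mdiv f D -> mdiv f^-1 (fun R => - D R).
Proof. by move=> h R; apply: mord_inv. Qed.
Lemma mdiv_ext f D D' : mdiv f D -> (forall R, D R = D' R) -> mdiv f D'.
Proof. by move=> h e R; rewrite -e. Qed.

Lemma dl_aff P R x y x' y' : val P = Some (x, y) -> val R = Some (x', y') ->
  (R == P) = (x' == x) && (y' == y).
Proof. by move=> eP eR; rewrite -val_eqE eP eR. Qed.

Lemma dl_O R x y : val R = Some (x, y) -> (R == O) = false.
Proof. by move=> eR; rewrite -val_eqE eR. Qed.

Lemma ptO (R : point E) : R <> O -> exists x y, val R = Some (x, y).
Proof.
case: R => -[[x y]|] xy h; first by exists x, y.
by case: h; apply/val_inj.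
Qed.

Lemma O_or (R : point E) : R = O \/ exists x y, val R = Some (x, y).
Proof. by have [->|/eqP/ptO h] := eqVneq R O; [left | right]. Qed.

Lemma same_x R P x y y' : val R = Some (x, y) -> val P = Some (x, y') ->
  y = y' \/ y = y' + a3 E.
Proof.
move=> eR eP; have := pt_on_ss eR; have := pt_on_ss eP; rewrite !oncurveE.
move=> /eqP e /eqP; rewrite -e => e'.
have : (y + y') * (y + (y' + a3 E)) = 0.
  rewrite -(c2_addrr two0 (y' ^+ 2 + a3 E * y')) -{1}e'; ring2 two0.
by move/eqP; rewrite mulf_eq0 => /orP [] /eqP /(c2_eq two0) ->; [left | right].
Qed.

Lemma mord_X R x y x1 : val R = Some (x, y) -> mord R (X - c x1) (x == x1)%:R.
Proof.
move=> eR; have [hX _] := val_pt_ss eR; have [<-|ne] := eqVneq x x1.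
  exact: munif_ord (munif_pt eR).
apply: unit_ord; exists (x - x1); first by rewrite subr_eq0.
by apply: val_sub hX (val_cst _ _ _).
Qed.

Lemma mord_inf_Xc x1 : mord O (X - c x1) (- 2%:Z).
Proof.
apply: (mord_add (n := 0)) (mord_inf_X M) _ _ => //.
by rewrite -rmorphN; apply: mge_reg (munif_inf M) (mreg_cst _ _ _).
Qed.

Lemma neq_add_a3 y : (y == y + a3 E) = false.
Proof. by rewrite -subr_eq0 opprD addrA subrr sub0r oppr_eq0 (negPf a3_neq0). Qed.

Lemma div_vert P x y : val P = Some (x, y) ->
  mdiv (X - c x) (fun R => dl P R + dl (negpt P) R - 2%:Z * dl O R).
Proof.
move=> eP R; have eN := val_negpt eP; rewrite /dl.
have [->|[x' [y' eR]]] := O_or R.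
  rewrite eqxx -!val_eqE eP eN /= !add0r mulr1; exact: mord_inf_Xc.
rewrite (dl_O eR) mulr0 subr0 (dl_aff eP eR) (dl_aff eN eR).
have := mord_X x eR; have [xx|//] := eqVneq x' x; rewrite xx in eR.
have [->|->] := same_x eR eP; first by rewrite eqxx /= neq_add_a3.
by rewrite eqxx eq_sym neq_add_a3.
Qed.

(** A line of slope l through P1 and P2, or tangent at P1 = P2: the hypothesis
    star is the comparison of coefficients that makes the cubic on the line
    split as (x + x1) (x + x2) (x + x3), and covers both cases. *)
Section Line.
Variables (P1 P2 : point E) (x1 y1 x2 y2 l : k).
Hypotheses (E1 : val P1 = Some (x1, y1)) (E2 : val P2 = Some (x2, y2)).
Let x3 := l ^+ 2 + a2 E + x1 + x2.
Let m x := l * (x + x1) + y1.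
Hypothesis m2 : m x2 = y2.
Hypothesis star : a4 E + a3 E * l = x1 * x2 + (x1 + x2) * x3.

Lemma line_norm (R : comPzRingType) (h2 : 2 = 0 :> R) (A2 A3 A4 A6 X1 Y1 X2 L X3 x y : R) :
  Y1 ^+ 2 + A3 * Y1 = X1 ^+ 3 + A2 * X1 ^+ 2 + A4 * X1 + A6 ->
  y ^+ 2 + A3 * y = x ^+ 3 + A2 * x ^+ 2 + A4 * x + A6 ->
  X3 = L ^+ 2 + A2 + X1 + X2 -> A4 + A3 * L = X1 * X2 + (X1 + X2) * X3 ->
  (y + (L * (x + X1) + Y1)) * (y + (L * (x + X1) + Y1) + A3)
  = (x + X1) * (x + X2) * (x + X3).
Proof.
move=> e1 e e3 es.
transitivity ((y ^+ 2 + A3 * y) + (Y1 ^+ 2 + A3 * Y1) + L ^+ 2 * (x + X1) ^+ 2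
   + A3 * L * (x + X1)); first by ring2 h2.
rewrite e e1; have -> : A3 * L = A4 + (X1 * X2 + (X1 + X2) * X3).
  by rewrite -es addrA (c2_addrr h2) add0r.
rewrite e3; ring2 h2.
Qed.

Lemma third_on : oncurve E (Some (x3, m x3)).
Proof.
rewrite oncurveE; apply/eqP; apply: (c2_eq two0).
have := pt_on_ss E1; rewrite oncurveE => /eqP e1.
transitivity ((m x3) ^+ 2 + a3 E * m x3 + (x3 ^+ 3 + a2 E * x3 ^+ 2 + a4 E * x3 + a6 E)) => //.
have -> : a6 E = y1 ^+ 2 + a3 E * y1 + x1 ^+ 3 + a2 E * x1 ^+ 2 + a4 E * x1.
  by apply: (c2_eq two0); rewrite e1; ring2 two0.
transitivity ((x3 + x1) * (l ^+ 2 * (x3 + x1) + a3 E * l + a4 E + a2 E * (x3 + x1) + x3 ^+ 2 + x3 * x1 + x1 ^+ 2)).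
  by rewrite /m; ring2 two0.
have -> : a3 E * l = a4 E + (x1 * x2 + (x1 + x2) * x3).
  by rewrite -star addrA (c2_addrr two0) add0r.
have e2 : l ^+ 2 = x3 + a2 E + x1 + x2 by rewrite /x3; ring2 two0.
by ring2 two0: e2.
Qed.

Definition thirdpt : point E := exist (oncurve E) (Some (x3, m x3)) third_on.

Let L : K := Y - (c l * (X + c x1) + c y1).

Lemma L_norm : L * (L + c (a3 E)) = (X - c x1) * (X - c x2) * (X - c x3).
Proof.
rewrite /L !(c2_opp two0K).
apply: (@line_norm _ two0K (c (a2 E)) (c (a3 E)) (c (a4 E)) (c (a6 E))).
- have := pt_on_ss E1; rewrite oncurveE => /eqP /(congr1 c).
  by rewrite !(rmorphD, rmorphM, rmorphXn).
- by have := m_eq M; rewrite a10 rmorph0 !mul0r addr0.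
- by rewrite /x3 !(rmorphD, rmorphXn).
by have := congr1 c star; move: (x3) => z; rewrite !(rmorphD, rmorphM).
Qed.

Let m_x1 : m x1 = y1.
Proof. by rewrite /m (c2_addrr two0) mulr0 add0r. Qed.

(** At an affine point, the conjugate function L + a3 takes the value a3 <> 0
    wherever L vanishes, so that the order of L is that of the norm. *)
Lemma div_line : mdiv L (fun R => dl P1 R + dl P2 R + dl thirdpt R - 3%:Z * dl O R).
Proof.
move=> R; rewrite /dl; have E3 : val thirdpt = Some (x3, m x3) by [].
have [->|[x [y eR]]] := O_or R.
  rewrite eqxx -!val_eqE E1 E2 /= !add0r mulr1 /L.
  apply: (mord_add (n := -2)) (mord_inf_Y M) _ _ => //.
  have hc z : mge O (c z) (- 2).
    by apply: (@mge_le _ _ _ _ _ 0) => //; apply: mge_reg (munif_inf M) (mreg_cst _ _ _).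
  have -> : - (c l * (X + c x1) + c y1) = c l * X + (c l * c x1 + c y1).
    by ring2 two0K.
  apply: mge_add; last by rewrite -rmorphM -rmorphD; apply: hc.
  rewrite -[-2]add0r; apply: mge_mul (mord_mge (mord_inf_X M)).
  exact: mge_reg (munif_inf M) (mreg_cst _ _ _).
rewrite (dl_O eR) mulr0 subr0 (dl_aff E1 eR) (dl_aff E2 eR) (dl_aff E3 eR).
have [hX hY] := val_pt_ss eR.
have hL : mval R L (y - m x).
  have hc := val_cst M R; rewrite /m.
  by apply: val_sub => //; apply: val_add => //; apply: val_mul => //; apply: val_add.
have [yE|ne] := eqVneq y (m x); last first.
  have aux x' y' : m x' = y' -> (x == x') && (y == y') = false.
    by move=> <-; apply/negbTE; apply: contra ne => /andP [/eqP -> ->].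
  rewrite !aux ?m_x1 //; apply: unit_ord; exists (y - m x) => //; by rewrite subr_eq0.
have hLb : mval R (L + c (a3 E)) (a3 E).
  by have := val_add hL (val_cst M R (a3 E)); rewrite yE subrr add0r.
have L0 := val_neq0 hLb a3_neq0.
have -> : L = (X - c x1) * (X - c x2) * (X - c x3) * (L + c (a3 E))^-1.
  by rewrite -L_norm mulfK.
have aux x' y' : m x' = y' -> (x == x') && (y == y') = (x == x').
  by move=> <-; rewrite yE; case: eqVneq => // ->; rewrite eqxx.
rewrite !aux ?m_x1 // -[X in mord _ _ X]addr0; apply: mord_mul.
  by do !apply: mord_mul; apply: mord_X eR.
by apply: unit_ord; apply: munit_inv; exists (a3 E) => //; apply: a3_neq0.
Qed.

End Line.

Lemma addpt_cases P1 P2 x1 y1 x2 y2 : val P1 = Some (x1, y1) -> val P2 = Some (x2, y2) ->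
  (P2 = negpt P1 /\ addpt E (val P1) (val P2) = None) \/
  exists l, let x3 := l ^+ 2 + a2 E + x1 + x2 in let m x := l * (x + x1) + y1 in
   [/\ m x2 = y2, a4 E + a3 E * l = x1 * x2 + (x1 + x2) * x3
    & addpt E (val P1) (val P2) = Some (x3, m x3 + a3 E)].
Proof.
move=> e1 e2; have := pt_on_ss e1; have := pt_on_ss e2; rewrite !oncurveE.
move=> /eqP c2 /eqP c1; rewrite e1 e2 /addpt.
have [xx|xx] := eqVneq x1 x2 => /=.
  rewrite -xx in e2 c2 *; have [y0|y0] := eqVneq.
    left; split=> //; apply/val_inj; rewrite e2 (val_negpt e1).
    congr (Some (_, _)); apply: (c2_eq two0); rewrite -y0 a10; ring.
  have yy : y2 = y1.
    have [//|yy] := same_x e2 e1; case/eqP: y0; rewrite yy a10; ring2 two0.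
  rewrite yy; right.
  have -> : 2 * y1 + a1 E * x1 + a3 E = a3 E.
    by rewrite a10 -[2 * _]/(2%:R * _) two0 !mul0r !add0r.
  set l := (_ / _); exists l => /=.
  have lE : a3 E * l = x1 ^+ 2 + a4 E.
    rewrite /l mulrC mulfVK ?a3_neq0 // a10; ring2 two0.
  split.
  - by rewrite (c2_addrr two0) mulr0 add0r.
  - by rewrite lE (c2_addrr two0 x1); ring2 two0.
  by congr (Some (_, _)); rewrite a10; ring2 two0.
right; set l := (_ / _); exists l => /=.
have x12 : x1 + x2 != 0 by apply: contra xx => /eqP /(c2_eq two0) ->.
have lE : l * (x1 + x2) = y1 + y2.
  have -> : x1 + x2 = x2 - x1 by ring2 two0.
  by rewrite /l mulfVK 1?subr_eq0 1?eq_sym //; ring2 two0.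
split.
- by rewrite [x2 + x1]addrC lE; ring2 two0.
- apply: (mulIf x12).
  transitivity (a4 E * (x1 + x2) + a3 E * (l * (x1 + x2))); first by ring.
  rewrite lE.
  have -> : a3 E * (y1 + y2) = (y1 + y2) ^+ 2 + (y1 ^+ 2 + a3 E * y1) + (y2 ^+ 2 + a3 E * y2).
    by ring2 two0.
  rewrite c1 c2 -lE; ring2 two0.
by congr (Some (_, _)); rewrite a10; ring2 two0.
Qed.

Lemma addpt_on (P1 P2 : point E) : oncurve E (addpt E (val P1) (val P2)).
Proof.
have [->|[x1 [y1 e1]]] := O_or P1; first exact: valP.
have [->|[x2 [y2 e2]]] := O_or P2.
  have -> : addpt E (val P1) (val O) = val P1 by rewrite e1.
  exact: (valP P1).
have [[_ ->]//|[l [h1 h2 ->]]] := addpt_cases e1 e2.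
by apply: neg_on; apply: (third_on e1 h2).
Qed.

Definition addP (P1 P2 : point E) : point E := exist (oncurve E) _ (addpt_on P1 P2).

(** The quotient of a line by a vertical line realizes (P1) + (P2) ~ (P1 + P2) +
    (O). *)
Lemma miller P1 P2 : exists h : K,
  mdiv h (fun R => dl P1 R + dl P2 R - dl (addP P1 P2) R - dl O R).
Proof.
have one D : (forall R, D R = 0) -> exists h : K, mdiv h D.
  by move=> D0; exists 1 => R; rewrite D0; apply: unit_ord; apply: munit_1.
have [e|[x1 [y1 e1]]] := O_or P1.
  apply: one => R; have -> : addP P1 P2 = P2 by apply/val_inj; rewrite /= e.
  by rewrite e; ring.
have [e|[x2 [y2 e2]]] := O_or P2.
  apply: one => R; have -> : addP P1 P2 = P1 by apply/val_inj; rewrite /= e e1.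
  by rewrite e; ring.
have [[eN eO]|[l [h1 h2 e3]]] := addpt_cases e1 e2.
  exists (X - c x1); apply: mdiv_ext (div_vert e1) _ => R.
  have -> : addP P1 P2 = O by apply/val_inj; rewrite /= eO.
  by rewrite eN; ring.
pose Q := thirdpt e1 h2; have eQ : val Q = Some (_, _) := erefl.
have -> : addP P1 P2 = negpt Q by apply/val_inj; rewrite (val_negpt eQ) /= e3.
have := mdivM (div_line e1 e2 h1 h2) (mdivV (div_vert eQ)).
rewrite -/Q => h; eexists; apply: mdiv_ext h _ => R; ring.
Qed.

Lemma low_pole f : (forall R, R <> O -> mreg R f) -> mge O f (- 2%:Z) ->
  exists r s, f = c r * X + c s.
Proof.
move=> rf h; have [a [b fE]] := reg_affine kc rf; rewrite fE in h.
by rewrite fE; apply: pe_low; exact: (mge_inf_pe (m := 2) h).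
Qed.

Lemma ord_lin r s : r != 0 -> mord O (c r * X + c s) (- 2%:Z).
Proof.
move=> r0; have := mord_mul (munit_ord (munif_inf M) (munit_cst M O r0)) (mord_inf_X M).
by rewrite add0r => h; apply: mord_add h (mge_reg (munif_inf M) (mreg_cst _ _ _)) _.
Qed.

Lemma lin_pole r s m : c r * X + c s != 0 -> mord O (c r * X + c s) m -> m != 0 ->
  r != 0.
Proof.
move=> + h m0; apply: contraNneq => r0; move: h; rewrite r0 rmorph0 mul0r add0r => h.
have [->|s0] := eqVneq s 0; first by rewrite rmorph0.
by move: m0; rewrite (mord_uniq h (unit_ord (munit_cst M O s0))) eqxx.
Qed.

Lemma lin_root r s R x y : val R = Some (x, y) -> mge R (c r * X + c s) 1 ->
  c r * X + c s = c r * (X - c x).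
Proof.
move=> eR h; have [hX _] := val_pt_ss eR.
have /mvanP h0 := mge1_van (lexx _) h.
have hv := val_add (val_mul (val_cst M R r) hX) (val_cst M R s).
have -> : s = - (r * x) by apply: (addrI (r * x)); rewrite subrr (val_uniq hv h0).
by rewrite rmorphN rmorphM; ring.
Qed.

Lemma dl_refl A : dl A A = 1. Proof. by rewrite /dl eqxx. Qed.
Lemma dl_neq A R : R <> A -> dl A R = 0. Proof. by move/eqP; rewrite /dl => /negbTE ->. Qed.
Lemma dl_ge0 A R : 0 <= dl A R. Proof. by rewrite /dl; case: eqP. Qed.

(** There is no point of order 2: a function with a double pole at O is r X + s
    with r <> 0, and its zeros are two distinct opposite points. *)
Lemma no_double_zero f T : T <> O -> mdiv f (fun R => 2%:Z * dl T R - 2%:Z * dl O R) -> False.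
Proof.
move=> TO h; have [x [y eT]] := ptO TO.
have hO := h O; rewrite dl_refl dl_neq in hO; last by move/esym.
have [r [s fE]] : exists r s, f = c r * X + c s.
  apply: low_pole; last by apply: mord_mge; move: hO; congr mord.
  move=> R RO; apply: (mord_reg _ (h R)); rewrite (dl_neq RO) mulr0 subr0.
  by have := dl_ge0 T R; lia.
have hT := h T; rewrite dl_refl (dl_neq TO) in hT.
have r0 : r != 0 by move: (mord_neq0 hT) hO; rewrite fE => h0 /(lin_pole h0); apply.
have lr : c r * X + c s = c r * (X - c x).
  by apply: (lin_root eT); rewrite -fE; apply: (mge_le _ (mord_mge hT)).
rewrite fE lr in hT.
have := mord_uniq hT (mord_mul (unit_ord (munit_cst M T r0)) (munif_ord (munif_pt eT))).
by [].
Qed.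

(** Distinct points are not linearly equivalent. Multiplying by the vertical
    line through B turns f into a function r X + s with zeros A and -B; such
    zeros are opposite, hence A = B. *)
Lemma degree1_divisor_inj f A B : mdiv f (fun R => dl A R - dl B R) -> A = B.
Proof.
have [-> //|/eqP AB h] := eqVneq A B.
have key g A' : A' <> O -> mdiv g (fun R => dl A' R - dl O R) -> False.
  move=> AO hg.
  have hO := hg O; rewrite dl_refl dl_neq in hO; last by move/esym.
  have [r [s fE]] : exists r s, g = c r * X + c s.
    apply: low_pole; last by apply: (mge_le _ (mord_mge hO)).
    move=> R RO; apply: (mord_reg _ (hg R)); rewrite (dl_neq RO) subr0; exact: dl_ge0.
  have r0 : r != 0 by move: (mord_neq0 hO) (hO); rewrite fE => h0 /(lin_pole h0); apply.
  by have := mord_uniq (ord_lin s r0); rewrite -fE => /(_ _ hO).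
have [BO|/eqP BO] := eqVneq B O.
  by case: (key f A _ _); rewrite -BO.
have [AO|/eqP AO] := eqVneq A O.
  case: (key f^-1 B BO _); rewrite -AO.
  by apply: mdiv_ext (mdivV h) _ => R; rewrite opprB.
have [xB [yB eB]] := ptO BO; have [xA [yA eA]] := ptO AO.
have hg := mdivM h (div_vert eB).
have {}hg : mdiv (f * (X - c xB)) (fun R => dl A R + dl (negpt B) R - 2%:Z * dl O R).
  by apply: mdiv_ext hg _ => R; ring.
have nBO : negpt B <> O by move/(congr1 val); rewrite (val_negpt eB).
have hO := hg O; rewrite dl_refl !dl_neq in hO; try by move/esym.
have [r [s fE]] : exists r s, f * (X - c xB) = c r * X + c s.
  apply: low_pole; last by apply: mord_mge; move: hO; congr mord.
  move=> R RO; apply: (mord_reg _ (hg R)); rewrite (dl_neq RO) mulr0 subr0.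
  by have := dl_ge0 A R; have := dl_ge0 (negpt B) R; lia.
have hA := hg A; rewrite dl_refl (dl_neq AO) in hA.
have r0 : r != 0 by move: (mord_neq0 hA) hO; rewrite fE => h0 /(lin_pole h0); apply.
have eg : f * (X - c xB) = c r * (X - c xA).
  rewrite fE; apply: (lin_root eA); rewrite -fE; apply: (mge_le _ (mord_mge hA)).
  by have := dl_ge0 (negpt B) A; lia.
have h1 := hg (negpt B); rewrite eg dl_refl (dl_neq nBO) in h1.
have h2 := mord_mul (unit_ord (munit_cst M (negpt B) r0)) (div_vert eA (negpt B)).
have := mord_uniq h1 h2; rewrite (dl_neq nBO) add0r mulr0 !subr0 => /addrI e.
have nn : negpt B = negpt A by move: e; rewrite /dl; case: eqP.
apply/val_inj; move: (congr1 val nn); rewrite (val_negpt eA) (val_negpt eB) eA eB.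
by case=> -> /addIr ->.
Qed.

(** The cancellation law, obtained from [miller] without associativity. *)
Lemma addP_inj P R R' : addP P R = addP P R' -> R = R'.
Proof.
move=> e; have [h hh] := miller P R; have [h' hh'] := miller P R'.
apply: (@degree1_divisor_inj (h * h'^-1)); apply: mdiv_ext (mdivM hh (mdivV hh')) _ => S.
by rewrite e; ring.
Qed.

Definition mulP n P := iter n (addP P) O.
Lemma val_mulP n P : val (mulP n P) = mulpt n P.
Proof. by elim: n => //= n ->. Qed.

Lemma miller_multiple n P : exists f : K,
  mdiv f (fun R => n%:Z * dl P R - dl (mulP n P) R - (n%:Z - 1) * dl O R).
Proof.
elim: n => [|n [f hf]].
  by exists 1 => R /=; rewrite (_ : _ - _ = 0); [apply: unit_ord; apply: munit_1 | ring].
have [h hh] := miller P (mulP n P); exists (f * h).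
apply: mdiv_ext (mdivM hf hh) _ => R; rewrite -[mulP n.+1 P]/(addP P (mulP n P)).
by rewrite intS; ring.
Qed.

Lemma torsion_fun n P : mulpt n P = None ->
  exists f : K, mdiv f (fun R => n%:Z * dl P R - n%:Z * dl O R).
Proof.
move=> e; have [f hf] := miller_multiple n P; exists f; apply: mdiv_ext hf _ => R.
have -> : mulP n P = O by apply/val_inj; rewrite val_mulP.
ring.
Qed.

(** If n = 2m, the function with divisor n(P) - n(O) divided by the square of
    one with divisor m(P) - (mP) - (m - 1)(O) has a double zero at mP and a
    double pole at O. *)
Lemma order_odd n P : exact_order P n -> odd n.
Proof.
move=> [n0 nP minn]; apply/negPn/negP => en.
have nE : n = (n./2 + n./2)%N by rewrite addnn -[LHS]odd_double_half (negPf en).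
have m0 : (0 < n./2 < n)%N by lia.
have mO : mulP n./2 P <> O.
  by move/(congr1 val); rewrite val_mulP; apply: minn.
have [f hf] := torsion_fun nP; have [g hg] := miller_multiple n./2 P.
apply: (no_double_zero (f := f * (g * g)^-1) mO).
apply: mdiv_ext (mdivM hf (mdivV (mdivM hg hg))) _ => R.
by rewrite {1 2}nE PoszD; ring.
Qed.

End Chords.

(** * Torsion over an algebraic extension of F_2 *)
Lemma pigeonhole (T : eqType) (s : seq T) (g : nat -> T) :
  (forall i, g i \in s) -> exists i j, (i < j)%N /\ g i = g j.
Proof.
move=> gs; have : ~~ uniq (mkseq g (size s).+1).
  apply/negP => us; have : {subset mkseq g (size s).+1 <= s}.
    by move=> _ /mapP [i _ ->].
  by move/(uniq_leq_size us); rewrite size_mkseq ltnn.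
move/(uniqPn (g 0)) => [i [j [ij]]]; rewrite size_mkseq => js.
by rewrite !nth_mkseq ?(ltn_trans ij) // => e; exists i, j.
Qed.

Section FrobeniusFixed.
Variables (k : fieldType) (two0 : 2 = 0 :> k).

Lemma pow2D m (x y : k) : (x + y) ^+ (2 ^ m) = x ^+ (2 ^ m) + y ^+ (2 ^ m).
Proof.
elim: m => [|m IH]; first by rewrite !expr1.
by rewrite expnSr !exprM IH; ring2 two0.
Qed.

Lemma pow2_inj m (x y : k) : x ^+ (2 ^ m) = y ^+ (2 ^ m) -> x = y.
Proof.
move=> e; apply: (c2_eq two0); apply/eqP.
have : (x + y) ^+ (2 ^ m) == 0 by rewrite pow2D e (c2_addrr two0).
by rewrite expf_eq0 => /andP [].
Qed.

(** The powers a^(2^i) lie in the finite ring F_2[a], hence repeat, and the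
    Frobenius map is injective. *)
Lemma pow2_period (f : {rmorphism 'F_2 -> k}) (a : k) : integralOver f a ->
  exists2 m, (0 < m)%N & a ^+ (2 ^ m) = a.
Proof.
move=> [p pm /rootP pa].
pose s := [seq (map_poly f (val q)).[a] | q <- enum {poly_(size p) 'F_2}].
have as_s i : a ^+ (2 ^ i) \in s.
  pose r : {poly 'F_2} := 'X^(2 ^ i) %% p.
  have sr : (size r <= size p)%N by apply: ltnW; rewrite ltn_modp monic_neq0.
  apply/mapP; exists (npolyp (size p) r); first by rewrite mem_enum.
  rewrite /= npolypK // -[LHS]hornerXn -(map_polyXn f).
  rewrite (divp_eq 'X^(2 ^ i) p) -/r rmorphD rmorphM /= hornerD hornerM pa.
  by rewrite mulr0 add0r.
have [i [j [ij]]] := pigeonhole as_s.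
rewrite -(subnKC (ltnW ij)) expnD mulnC exprM => /pow2_inj e.
by exists (j - i)%N; rewrite // subn_gt0.
Qed.

Lemma pow2_periods (f : {rmorphism 'F_2 -> k}) (s : seq k) : integralRange f ->
  exists2 m, (0 < m)%N & forall a, a \in s -> a ^+ (2 ^ m) = a.
Proof.
move=> alg; elim: s => [|a s [m m0 IH]]; first by exists 1%N.
have [n n0 ea] := pow2_period (alg a).
have rep b j l : b ^+ (2 ^ j) = b -> b ^+ (2 ^ (j * l)) = b.
  by move=> e; elim: l => [|l IHl]; rewrite ?muln0 ?expr1 // mulnS expnD exprM e.
exists (m * n)%N; first by rewrite muln_gt0 m0.
move=> b; rewrite inE => /orP [/eqP ->|/IH]; last exact: rep.
by rewrite mulnC; apply: rep.
Qed.

Variable E : ellcurve k.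
Variable q : nat.
Let fixed (a : k) := a ^+ (2 ^ q) = a.

Lemma fixedD a b : fixed a -> fixed b -> fixed (a + b).
Proof. by rewrite /fixed pow2D => -> ->. Qed.
Lemma fixedN a : fixed a -> fixed (- a).
Proof. by rewrite (c2_opp two0). Qed.
Lemma fixedM a b : fixed a -> fixed b -> fixed (a * b).
Proof. by rewrite /fixed exprMn => -> ->. Qed.
Lemma fixedV a : fixed a -> fixed a^-1.
Proof. by rewrite /fixed exprVn => ->. Qed.
Lemma fixed_nat n : fixed n%:R.
Proof.
by rewrite /fixed -natrX -(odd_double_half n); case: (odd n);
  rewrite ?add1n ?add0n ?(c2_odd two0) ?(c2_even two0) natrX
   ?(c2_odd two0) ?(c2_even two0) ?expr1n // expr0n expn_eq0.
Qed.

Definition fixed_pt (p : option (k * k)) :=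
  if p is Some (x, y) then fixed x /\ fixed y else True.

Lemma fixed_addpt p p' : fixed (a1 E) -> fixed (a2 E) -> fixed (a3 E) -> fixed (a4 E) ->
  fixed_pt p -> fixed_pt p' -> fixed_pt (addpt E p p').
Proof.
move=> f1 f2 f3 f4; case: p => [[x y]|] //; case: p' => [[x' y']|] //= [fx fy] [fx' fy'].
case: ifP => // _; set l := (if _ then _ else _).
have fl : fixed l.
  rewrite /l; case: ifP => _; rewrite ?expr2; do !(assumption || apply: fixed_nat || apply: fixedM
    || apply: fixedV || apply: fixedN || apply: fixedD).
by split; rewrite ?expr2; do !(assumption || apply: fixedM || apply: fixedN || apply: fixedD).
Qed.

End FrobeniusFixed.

(** The multiples of P stay in the finite set of points over the finite field
    that contains the coefficients and coordinates; two of them coincide, and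
    cancellation gives a multiple equal to O. *)
Lemma torsion_exists (k : closedFieldType) (f : {rmorphism 'F_2 -> k})
    (alg : integralRange f) (E : ellcurve k) (P : point E) : a1 E = 0 ->
  exists2 n, (0 < n)%N & mulpt n P = None.
Proof.
move=> a10; have kc := @closedField_alg_closed k.
have two0 : 2 = 0 :> k by rewrite -(rmorph_nat f) -(rmorph0 f); congr (f _); apply/val_inj.
have [xy fP] : exists xy : k * k, forall q, fixed_pt q (Some xy) -> fixed_pt q (val P).
  by case: (val P) => [xy|]; [exists xy | exists (0, 0)].
have [m m0 fx] := pow2_periods two0 [:: a1 E; a2 E; a3 E; a4 E; xy.1; xy.2] alg.
have [rs rsE] : exists rs : seq k, forall a : k, a ^+ (2 ^ m) = a -> a \in rs.
  have [rs e] := closed_field_poly_normal ('X^(2 ^ m) - 'X : {poly k}).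
  exists rs => a ea; rewrite -root_prod_XsubC.
  have : root ('X^(2 ^ m) - 'X) a by rewrite /root !hornerE ea subrr.
  rewrite {1}e rootZ // lead_coef_eq0 -size_poly_eq0.
  rewrite size_polyDl size_polyXn // size_polyN size_polyX ltnS.
  by case: (m) m0 => // j _; rewrite expnS leq_pmulr ?expn_gt0.
pose s : seq (option (k * k)) := None :: [seq Some p | p <- [seq (a, b) | a <- rs, b <- rs]].
have memf i : fixed_pt m (mulpt i P).
  elim: i => //= i IH; apply: fixed_addpt => //; try by (apply: fx; rewrite !inE eqxx ?orbT).
  by apply: fP; case: (xy) fx => a b fx; split; apply: fx; rewrite !inE eqxx ?orbT.
have mems i : mulpt i P \in s.
  have := memf i; case: (mulpt i P) => [[a b] [fa fb]|_]; last by rewrite inE.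
  by rewrite inE /=; apply/mapP; exists (a, b) => //; apply/allpairsP; exists (a, b); split=> //; apply: rsE.
have [i [j [ij e]]] := pigeonhole mems.
have M := Mfun E.
have inj R R' : addP two0 a10 P R = addP two0 a10 P R' -> R = R'.
  exact: (addP_inj M kc).
exists (j - i)%N; rewrite ?subn_gt0 //.
have mulE l : val (mulP two0 a10 l P) = mulpt l P by exact: val_mulP.
rewrite -mulE.
suff -> : mulP two0 a10 (j - i) P = zeropt E by [].
have {}e : mulP two0 a10 i P = mulP two0 a10 j P by apply/val_inj; rewrite !mulE.
elim: i j ij e => [|i IH] j ij e; first by rewrite subn0 -e.
case: j ij e => // j ij e; rewrite subSS; apply: IH => //; exact: inj e.
Qed.

(** * Lame points *)
Section Lame.
Variables (k : fieldType) (E : ellcurve k) (M : funmodel E).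
Variables (two0 : 2 = 0 :> k) (kc : alg_closed k).
Local Notation K := (mfield M).
Local Notation c := (mcst M).
Local Notation O := (zeropt E).
Implicit Types (P Q R : point E) (f : K).

(** As for the local notions, these are the notions of the theorem over a
    model. *)
Definition mram f R (e : nat) : Prop :=
  (0 < e)%N /\ (mord R f^-1 e%:Z \/ exists y, mord R (f - c y) e%:Z).
Definition mramified f R : Prop := exists2 e, (1 < e)%N & mram f R e.
Definition mtame f : Prop := forall R e, mram f R e -> prime_to_char k e.
Definition mlame P (n : nat) : Prop :=
  [/\ (1 < n)%N, prime_to_char k n, exact_order P n
    & exists f : K, exists Q : point E,
      [/\ mdiv f (fun R => n%:Z *+ (R == P) - n%:Z *+ (R == O)),
          mtame f,
          Q != O /\ Q != P,
          forall R, mramified f R <-> (R = O \/ R = P \/ R = Q)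
        & [/\ mram f O n, mram f P n & mram f Q 3%N]]].

Lemma pchar2 : 2 \in [pchar k].
Proof. by rewrite inE /= two0 eqxx. Qed.

Lemma prime_to_char2 n : prime_to_char k n <-> odd n.
Proof.
split=> [/(_ 2 pchar2)|on p pk]; first by rewrite dvdn2 negbK.
by rewrite (pcharf_eq pchar2) in pk; rewrite (eqP (pk : p == 2)) dvdn2 negbK.
Qed.

Lemma order_neqO P n : (1 < n)%N -> exact_order P n -> P <> O.
Proof. by move=> n1 [_ _ h] PO; apply: (h 1%N); rewrite ?n1 // PO. Qed.

(** If a1 <> 0, the index of [wild_index] is even, against tameness. The order n
    is odd, as it is prime to 2, so that P is not of order 2. *)
Lemma lame_a1_eq0 P n : mlame P n -> a1 E = 0.
Proof.
move=> [n1 /prime_to_char2 on ord [f [_ [fdiv ftame _ _ _]]]].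
have PO := order_neqO n1 ord.
have [x [y eP]] := ptO PO.
pose bet := a1 E * x + a3 E.
have bet0 : bet != 0.
  have n3 : (0 < 2 < n)%N by move: n1 on; clear; case: n => [|[|[|]]].
  apply/eqP => b; case: ord => _ _ /(_ 2 n3).
  rewrite /mulpt /= eP /= eqxx /=.
  by have -> : y + y + a1 E * x + a3 E = 0; rewrite ?eqxx // -addrA -/bet b addr0 (c2_addrr two0).
have PE : val P = Some (x, (y + bet) + (a1 E * x + a3 E)).
  by rewrite eP -/bet -addrA (c2_addrr two0) addr0.
have OP : (O == P) = false by apply/negbTE/eqP => e; apply: PO.
have fO : mord O f (- n%:Z) by have := fdiv O; rewrite eqxx OP sub0r.
have freg R : R <> O -> mreg R f.
  move/eqP=> RO; apply: (mord_reg _ (fdiv R)).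
  by rewrite (negPf RO) subr0; case: (R == P).
have fnv R : R <> O -> R <> P -> ~ mvan R f.
  move=> /eqP RO /eqP RP; have := fdiv R; rewrite (negPf RO) (negPf RP) => h.
  by case/munitP: (mord0_unit h).
have [A [B [c0 [fE nE c00 B0 oB]]]] := pencil_form two0 kc PE bet0 on fO freg fnv.
have [tau [t0E BE _ _]] := ram_slope two0 erefl erefl c00 bet0 nE oB B0.
have [X1 X1E] := sqrt_closed kc ((a1 E * x + a3 E) * tau + (a1 E * (y + bet) + x ^+ 2 + a4 E)).
have [s0 s0E] := sqrt_closed kc c0.
have [Q [QE QO QP _ _]] := pt_exists M two0 PE bet0 (X1_eq two0 t0E X1E).
have [//|a10] := eqVneq (a1 E) 0.
have [e /andP [oe e0] ho] := wild_index M two0 PE bet0 nE c00 B0 oB s0E t0E BE X1E QE a10.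
have /prime_to_char2 : prime_to_char k e.
  by apply: (ftame Q); split=> //; right; exists s0; rewrite fE.
by rewrite (negPf oe).
Qed.

(** With n the order of P, the function with divisor n(P) - n(O) has index n at
    O and P, index 3 at the point Q of [tame_index], and index 1 elsewhere by
    [unramified]. *)
Lemma supersingular_lame P : a1 E = 0 -> P <> O ->
  (exists2 n, (0 < n)%N & mulpt n P = None) -> exists n, mlame P n.
Proof.
move=> a10 PO [n00 n000 e00].
have ex : exists n, (0 < n)%N && (mulpt n P == None).
  by exists n00; rewrite n000 e00 eqxx.
have [n /andP [n0 /eqP nP] nmin] := ex_minnP ex.
have ord : exact_order P n.
  split=> // m /andP [m0 mn] mP; have := nmin m; rewrite m0 mP eqxx => /(_ isT).
  by rewrite leqNgt mn.
have on := order_odd M two0 kc a10 ord.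
have [x [y eP]] := ptO PO.
have n1 : (1 < n)%N.
  case: n n0 nP {nmin ord on} => [|[|n]] // _; by rewrite /mulpt /= eP.
pose bet := a1 E * x + a3 E.
have bet0 : bet != 0 by rewrite /bet a10 mul0r add0r (a3_neq0 two0 a10).
have PE : val P = Some (x, (y + bet) + (a1 E * x + a3 E)).
  by rewrite eP -/bet -addrA (c2_addrr two0) addr0.
have OP : (O == P) = false by apply/negbTE/eqP => e; apply: PO.
have [f fdiv'] := torsion_fun M two0 a10 nP.
have fdiv : mdiv f (fun R => n%:Z *+ (R == P) - n%:Z *+ (R == O)).
  apply: mdiv_ext fdiv' _ => R; rewrite /dl; case: (R == P); case: (R == O) => //=;
  rewrite ?mulr0 ?mulr1 //.
have fO : mord O f (- n%:Z) by have := fdiv O; rewrite eqxx OP sub0r.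
have fP : mord P f n by have := fdiv P; rewrite eqxx eq_sym OP subr0.
have freg R : R <> O -> mreg R f.
  move/eqP=> RO; apply: (mord_reg _ (fdiv R)).
  by rewrite (negPf RO) subr0; case: (R == P).
have fu R : R <> O -> R <> P -> munit R f.
  move=> /eqP RO /eqP RP; have := fdiv R; rewrite (negPf RO) (negPf RP).
  exact: mord0_unit.
have fnv R : R <> O -> R <> P -> ~ mvan R f.
  by move=> RO RP; case/munitP: (fu R RO RP).
have [A [B [c0 [fE nE c00 B0 oB]]]] := pencil_form two0 kc PE bet0 on fO freg fnv.
have [tau [t0E BE dB dA]] := ram_slope two0 erefl erefl c00 bet0 nE oB B0.
have [X1 X1E] := sqrt_closed kc ((a1 E * x + a3 E) * tau + (a1 E * (y + bet) + x ^+ 2 + a4 E)).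
have [s0 s0E] := sqrt_closed kc c0.
have [Q [QE QO QP _ _]] := pt_exists M two0 PE bet0 (X1_eq two0 t0E X1E).
have fQ : mord Q (f - c s0) 3%:Z.
  by rewrite fE; apply: (tame_index M two0 PE bet0 nE c00 B0 oB s0E t0E BE X1E QE a10).
have fnr R c' : R <> O -> R <> P -> R <> Q -> ~ mge R (f - c c') 2.
  by rewrite fE; apply: (unramified two0 PE bet0 nE c00 t0E X1E QE a10 dB dA).
have unif := munif_ex M two0 a10.
have ramO : mram f O n.
  by split=> //; left; have := mord_inv fO; rewrite opprK.
have ramP : mram f P n by split=> //; right; exists 0; rewrite rmorph0 subr0.
have ramQ : mram f Q 3 by split=> //; right; exists s0.
have uO e : mram f O e -> e = n.
  move=> [e0 [h|[y' h]]].
    by have := mord_uniq h (mord_inv fO); rewrite opprK => -[].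
  have [t ht] := unif O.
  have h' : mord O (f - c y') (- n%:Z).
    apply: (mord_add (n := 0)) fO _ _; last by lia.
    by rewrite -rmorphN; apply: mge_reg ht (mreg_cst _ _ _).
  by have := mord_uniq h h'; lia.
have uP e : mram f P e -> e = n.
  move=> [e0 [h|[y' h]]]; first by have := mord_uniq h (mord_inv fP); lia.
  have [yz|yn] := eqVneq y' 0.
    by move: h; rewrite yz rmorph0 subr0 => h; have := mord_uniq h fP; case.
  have [t ht] := unif P.
  have h' : mord P (f - c y') 0.
    rewrite addrC; apply: (mord_add (n := n)) _ (mord_mge fP) _ => //.
    by rewrite -rmorphN; apply: munit_ord ht (munit_cst _ _ _); rewrite oppr_eq0.
  by have := mord_uniq h h'; lia.
have uother R e : R <> O -> R <> P -> mram f R e ->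
    exists y', mord R (f - c y') e%:Z.
  move=> RO RP [e0 [h|//]]; have [t ht] := unif R.
  by have := mord_uniq h (munit_ord ht (munit_inv (fu R RO RP))); lia.
have uQ e : mram f Q e -> e = 3%N.
  move=> h; have [e0 _] := h; have [y' h'] := uother Q e QO QP h.
  have yE : y' = s0.
    have /mval_sub_cst v1 : mvan Q (f - c y') by apply: (mge1_van _ (mord_mge h')); lia.
    have /mval_sub_cst v2 : mvan Q (f - c s0) by apply: (mge1_van _ (mord_mge fQ)).
    exact: val_uniq v1 v2.
  by rewrite yE in h'; have := mord_uniq h' fQ; case.
have uR R e : R <> O -> R <> P -> R <> Q -> mram f R e -> e = 1%N.
  move=> RO RP RQ h; have [e0 _] := h; have [y' h'] := uother R e RO RP h.
  have [//|e1] := eqVneq e 1%N; case: (fnr R y' RO RP RQ).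
  by apply: (mge_le _ (mord_mge h')); lia.
have ramE R e : mram f R e -> [\/ (R = O /\ e = n), (R = P /\ e = n),
    (R = Q /\ e = 3%N) | e = 1%N].
  move=> h; have [RO|/eqP RO] := eqVneq R O; first by constructor 1; rewrite RO in h; split=> //; exact: uO.
  have [RP|/eqP RP] := eqVneq R P; first by constructor 2; rewrite RP in h; split=> //; exact: uP.
  have [RQ|/eqP RQ] := eqVneq R Q; first by constructor 3; rewrite RQ in h; split=> //; exact: uQ.
  by constructor 4; apply: (uR R).
exists n; split=> //; first exact/prime_to_char2.
exists f, Q; split=> //.
- move=> R e /ramE [] [] *; apply/prime_to_char2; subst=> //.
- by split; apply/eqP.
move=> R; split; last first.
  by case=> [->|[->|->]]; [exists n | exists n | exists 3%N].
case=> e e1 /ramE [[-> _]|[-> _]|[-> _]|e2]; [by left|by right; left|by right; right|].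
by rewrite e2 in e1.
Qed.

End Lame.


(** * Substitutions *)

(** A solution (u, v) of the equation of E in a field K, with u transcendental
    over k, defines an embedding of the function field into K. *)
Section Lift.
Variables (k : fieldType) (E : ellcurve k) (M : funmodel E).
Variables (K : fieldType) (d : {rmorphism k -> K}) (u v : K).
Hypothesis uv : v ^+ 2 + d (a1 E) * u * v + d (a3 E) * v =
  u ^+ 3 + d (a2 E) * u ^+ 2 + d (a4 E) * u + d (a6 E).
Hypothesis u_free : forall p, ev1 d p u = 0 -> p = 0.
Local Notation c := (mcst M).
Local Notation X := (mX M).
Local Notation Y := (mY M).

Let liftv (a b e : {poly k}) : K := (ev1 d a u + ev1 d b u * v) / ev1 d e u.

Lemma u_neq0 p : p != 0 -> ev1 d p u != 0.
Proof. by apply: contraNneq => /u_free ->. Qed.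

Let is_repr (f : M) (abe : {poly k} * {poly k} * {poly k}) :=
  (abe.2 != 0) && (f == pe M abe.1.1 abe.1.2 / ev1 c abe.2 X).

Lemma is_repr_ex f : exists abe, is_repr f abe.
Proof.
by have [a [b [e [e0 ->]]]] := pe_repr f; exists (a, b, e); rewrite /is_repr /= e0 eqxx.
Qed.

Definition lift (f : M) : K := let abe := xchoose (is_repr_ex f) in liftv abe.1.1 abe.1.2 abe.2.

Lemma liftE f a b e : e != 0 -> f = pe M a b / ev1 c e X -> lift f = liftv a b e.
Proof.
rewrite /lift; have /andP [] := xchooseP (is_repr_ex f).
case: (xchoose _) => [[a' b'] e'] /= e0' /eqP -> e0 /eqP.
rewrite eqr_div ?evX_eq0 // => /eqP; rewrite mulrC pe_ev1M mulrC [RHS]mulrC pe_ev1M.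
move=> h; have [ha hb] : e * a' = e' * a /\ e * b' = e' * b.
  by apply: (@pe_inj _ _ M); rewrite -!pe_ev1M mulrC -pe_ev1M in h *; rewrite -h; ring.
rewrite /liftv; apply/eqP; rewrite eqr_div ?u_neq0 //; apply/eqP.
transitivity (ev1 d (e * a') u + ev1 d (e * b') u * v); first by rewrite !ev1M; ring.
by rewrite ha hb !ev1M; ring.
Qed.

Lemma lift_zmod : zmod_morphism lift.
Proof.
move=> f g; have [a [b [e [e0 fE]]]] := pe_repr f.
have [a' [b' [e' [e0' gE]]]] := pe_repr g.
rewrite (liftE e0 fE) (liftE e0' gE).
have n1 := u_neq0 e0; have n2 := u_neq0 e0'.
have n3 : ev1 c e X != 0 by rewrite evX_eq0.
have n4 : ev1 c e' X != 0 by rewrite evX_eq0.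
rewrite (@liftE _ (e' * a - e * a') (e' * b - e * b') (e * e')) ?mulf_neq0 //.
  by rewrite /liftv !(ev1D, ev1N, ev1M); field; rewrite n1 n2.
by rewrite fE gE peB -!pe_ev1M ev1M; field; rewrite n3 n4.
Qed.

Lemma lift_monoid : monoid_morphism lift.
Proof.
split=> [|f g].
  rewrite (@liftE 1 1 0 1) ?oner_neq0 //.
    by rewrite /liftv !ev1_1 ev1_0 mul0r addr0 divr1.
  by rewrite pe0 !ev1_1 divr1.
have [a [b [e [e0 fE]]]] := pe_repr f.
have [a' [b' [e' [e0' gE]]]] := pe_repr g.
rewrite (liftE e0 fE) (liftE e0' gE).
have n1 := u_neq0 e0; have n2 := u_neq0 e0'.
rewrite (@liftE _ (a * a' + b * b' * cubp E) (a * b' + a' * b - b * b' * linp E) (e * e')) ?mulf_neq0 //.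
  rewrite /liftv !(ev1D, ev1N, ev1M) ev1lin ev1cub [RHS]mulf_div; congr (_ / _).
  have e2 : v ^+ 2 = u ^+ 3 + d (a2 E) * u ^+ 2 + d (a4 E) * u + d (a6 E)
    - (d (a1 E) * u * v + d (a3 E) * v) by rewrite -uv; ring.
  by ring: e2.
by rewrite fE gE -peM ev1M mulf_div.
Qed.

HB.instance Definition _ := GRing.isZmodMorphism.Build M K lift lift_zmod.
HB.instance Definition _ := GRing.isMonoidMorphism.Build M K lift lift_monoid.

Lemma lift_ex : exists phi : {rmorphism M -> K},
  [/\ forall a, phi (c a) = d a, phi X = u & phi Y = v].
Proof.
exists lift; split=> [a||] /=.
- rewrite (@liftE _ a%:P 0 1) ?oner_neq0 //.
    by rewrite /liftv ev1C ev1_0 ev1_1 mul0r addr0 divr1.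
  by rewrite peC ev1_1 divr1.
- rewrite (@liftE _ 'X 0 1) ?oner_neq0 //.
    by rewrite /liftv ev1X ev1_0 ev1_1 mul0r addr0 divr1.
  by rewrite pe0 ev1X ev1_1 divr1.
rewrite (@liftE _ 0 1 1) ?oner_neq0 //.
  by rewrite /liftv ev1_0 ev1_1 mul1r add0r divr1.
by rewrite pe_01 ev1_1 divr1.
Qed.

End Lift.

Lemma rmorph_ev1 (k K K' : fieldType) (d : {rmorphism k -> K}) (d' : {rmorphism k -> K'})
  (phi : {rmorphism K -> K'}) : (forall a, phi (d a) = d' a) ->
  forall p u, phi (ev1 d p u) = ev1 d' p (phi u).
Proof.
move=> h p u; elim/poly_ind: p => [|p a IH]; first by rewrite !ev1_0 rmorph0.
by rewrite !(ev1D, ev1M, ev1X, ev1C) rmorphD rmorphM /= IH h.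
Qed.

Lemma rmorph_ev2 (k K K' : fieldType) (d : {rmorphism k -> K}) (d' : {rmorphism k -> K'})
  (phi : {rmorphism K -> K'}) : (forall a, phi (d a) = d' a) ->
  forall G u v, phi (ev2 d G u v) = ev2 d' G (phi u) (phi v).
Proof.
move=> h G u v; elim/poly_ind: G => [|G q IH]; first by rewrite !ev2_0 rmorph0.
by rewrite !(ev2D, ev2M, ev2X, ev2C) rmorphD rmorphM /= IH (rmorph_ev1 h).
Qed.

Lemma hom_ext (k : fieldType) (E : ellcurve k) (M : funmodel E) (K : fieldType)
  (phi psi : {rmorphism M -> K}) :
  (forall a, phi (mcst M a) = psi (mcst M a)) -> phi (mX M) = psi (mX M) ->
  phi (mY M) = psi (mY M) -> phi =1 psi.
Proof.
move=> hc hX hY f; have [a [b [e [e0 ->]]]] := pe_repr f.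
pose d : {rmorphism k -> K} := psi \o mcst M.
have hd b' : psi (mcst M b') = d b' by [].
have hd' b' : phi (mcst M b') = d b' by rewrite hc.
rewrite /pe !fmorph_div !rmorphD !rmorphM /=.
by rewrite !(rmorph_ev1 hd) !(rmorph_ev1 hd') hX hY.
Qed.

Section Substitution.
Variables (k : fieldType) (two0 : 2 = 0 :> k).
Implicit Types (E : ellcurve k).

(** The condition under which (x, y) -> (w^2 x + r, w^3 y + w^2 s x + t) maps E1
    to E2, for curves with a1 = 0 in characteristic 2: by [subst_eq] the
    equation of E2 in the new coordinates is then w^6 times that of E1. *)
Definition subst_rel E1 E2 (w r s t : k) : Prop :=
  [/\ w != 0, a3 E2 = w ^+ 3 * a3 E1, a2 E2 = w ^+ 2 * a2 E1 + s ^+ 2 + r,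
      a4 E2 = w ^+ 4 * a4 E1 + w ^+ 3 * a3 E1 * s + r ^+ 2
    & a6 E2 = w ^+ 6 * a6 E1 + t ^+ 2 + a3 E2 * t + r ^+ 3 + a2 E2 * r ^+ 2 + a4 E2 * r].

Lemma subst_rel_sym E1 E2 w r s t : subst_rel E1 E2 w r s t ->
  subst_rel E2 E1 w^-1 (r / w ^+ 2) (s / w) ((t + s * r) / w ^+ 3).
Proof.
move=> [w0 e3 e2 e4 e6]; have w2 : w * w^-1 = 1 by rewrite mulfV.
rewrite /subst_rel invr_eq0 w0 e6 e4 e2 e3 -!exprVn.
by move: w^-1 w2 => wi e; split=> //; ring2 two0: e.
Qed.

Lemma subst_eq (R : comPzRingType) (h : 2 = 0 :> R) (w r s t x y a b d g : R) :
  let a2' := w ^+ 2 * a + s ^+ 2 + r in let a3' := w ^+ 3 * b in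
  let a4' := w ^+ 4 * d + w ^+ 3 * b * s + r ^+ 2 in
  let a6' := w ^+ 6 * g + t ^+ 2 + a3' * t + r ^+ 3 + a2' * r ^+ 2 + a4' * r in
  let x' := w ^+ 2 * x + r in let y' := w ^+ 3 * y + w ^+ 2 * s * x + t in
  y' ^+ 2 + a3' * y' + (x' ^+ 3 + a2' * x' ^+ 2 + a4' * x' + a6') =
  w ^+ 6 * (y ^+ 2 + b * y + (x ^+ 3 + a * x ^+ 2 + d * x + g)).
Proof. by move=> /=; ring2 h. Qed.

Section HalfIso.
Variables (E1 E2 : ellcurve k) (M1 : funmodel E1) (M2 : funmodel E2).
Variables (w r s t : k).
Hypothesis (rel : subst_rel E1 E2 w r s t) (a10 : a1 E1 = 0) (a10' : a1 E2 = 0).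
Local Notation c1 := (mcst M1).
Local Notation c2 := (mcst M2).

Definition sx x := w ^+ 2 * x + r.
Definition sy x y := w ^+ 3 * y + w ^+ 2 * s * x + t.

Lemma subst_on x y : oncurve E1 (Some (x, y)) -> oncurve E2 (Some (sx x, sy x y)).
Proof.
rewrite !oncurveE // => /eqP e; apply/eqP; apply: (c2_eq two0).
case: rel => _ e3 e2 e4 e6; rewrite e6 e4 e2 e3 /sx /sy (subst_eq two0) e.
by rewrite (c2_addrr two0) mulr0.
Qed.

Definition spt (R : point E1) : point E2 :=
  if R is exist (Some (x, y)) xy then exist (oncurve E2) (Some (sx x, sy x y)) (subst_on xy)
  else zeropt E2.

Lemma val_spt R x y : val R = Some (x, y) -> val (spt R) = Some (sx x, sy x y).
Proof. by case: R => -[[x' y']|] //= xy [-> ->]. Qed.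

Let u : M1 := c1 (w ^+ 2) * mX M1 + c1 r.
Let v : M1 := c1 (w ^+ 3) * mY M1 + c1 (w ^+ 2 * s) * mX M1 + c1 t.

Let w0 : w != 0. Proof. by case: rel. Qed.
Let two0K : 2 = 0 :> M1 := rmorph_two0 c1 two0.

Lemma subst_hom : exists phi : {rmorphism M2 -> M1},
  [/\ forall a, phi (c2 a) = c1 a, phi (mX M2) = u & phi (mY M2) = v].
Proof.
apply: lift_ex.
  have := m_eq M1; rewrite a10 a10' !rmorph0 !mul0r !addr0 => e.
  apply: (c2_eq two0K); case: rel => _ e3 e2 e4 e6; rewrite e6 e4 e2 e3 /u /v.
  rewrite !(rmorphD, rmorphM, rmorphXn) /= (subst_eq two0K) e.
  by rewrite (c2_addrr two0K) mulr0.
move=> p e; have wp : w ^+ 2 != 0 by rewrite expf_neq0.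
have sq : size ((w ^+ 2) *: 'X + r%:P) = 2%N.
  by rewrite size_polyDl size_scale // size_polyX // ltnS size_polyC_leq1.
apply/eqP; rewrite -size_poly_eq0 -(size_comp_poly2 p sq) size_poly_eq0.
rewrite -(evX_eq0 M1) -e; apply/eqP; rewrite {e}.
elim/poly_ind: p => [|p a IH]; first by rewrite comp_poly0 !ev1_0.
rewrite comp_polyD comp_polyM comp_polyX comp_polyC !(ev1D, ev1M) IH ev1Z ev1X !ev1C.
by rewrite ev1X.
Qed.

Variable phi : {rmorphism M2 -> M1}.
Hypotheses (hc : forall a, phi (c2 a) = c1 a) (hX : phi (mX M2) = u) (hY : phi (mY M2) = v).

(** At infinity the new chart is a quotient of the old one by the function den,
    which takes the value w^3 there. *)
Lemma subst_chart R : mval R (phi (mchart M2 (spt R)).1) (coords (spt R)).1 /\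
  mval R (phi (mchart M2 (spt R)).2) (coords (spt R)).2.
Proof.
have hcst := val_cst M1 R.
case: R hcst => -[[x y]|] xy hcst; have [h1 h2] := val_chart M1 (exist (oncurve E1) _ xy).
  by rewrite /mchart /coords /= hX hY; split; rewrite /u /v /sx /sy;
    do !(apply: val_add || apply: val_mul).
rewrite /mchart /coords /= fmorph_div fmorphV hX hY /u /v.
rewrite /mchart /coords /= in h1 h2.
have Y0 := mY_neq0 M1.
pose den := c1 (w ^+ 3) + c1 (w ^+ 2 * s) * (mX M1 / mY M1) + c1 t * (mY M1)^-1.
have hden : mval (exist (oncurve E1) None xy) den (w ^+ 3).
  have -> : w ^+ 3 = w ^+ 3 + (w ^+ 2 * s) * 0 + t * 0 by ring.
  by do !(apply: val_add || apply: val_mul).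
have w3 : w ^+ 3 != 0 by rewrite expf_neq0.
have d0 := val_neq0 hden w3.
have vE : c1 (w ^+ 3) * mY M1 + c1 (w ^+ 2 * s) * mX M1 + c1 t = den * mY M1.
  by rewrite /den; field.
rewrite vE; split.
  have -> : (c1 (w ^+ 2) * mX M1 + c1 r) / (den * mY M1) =
    (c1 (w ^+ 2) * (mX M1 / mY M1) + c1 r * (mY M1)^-1) * den^-1.
    by field; rewrite Y0 d0.
  have -> : 0 = (w ^+ 2 * 0 + r * 0) * (w ^+ 3)^-1 by ring.
  by apply: val_mul; [do !(apply: val_add || apply: val_mul) | apply: val_inv].
rewrite invfM; have -> : 0 = (w ^+ 3)^-1 * 0 by ring.
by apply: val_mul => //; apply: val_inv.
Qed.

Lemma subst_reg R f : mreg (spt R) f -> mreg R (phi f).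
Proof.
move=> [g [h /mquotP [h0 ->]]]; have [h1 h2] := subst_chart R.
rewrite fmorph_div !(rmorph_ev2 hc).
apply: mreg_mul; first exact: mreg_val (val_ev2 g h1 h2).
exact: mreg_val (val_inv (val_ev2 h h1 h2) h0).
Qed.

End HalfIso.

(** Isomorphisms of curves, over models of the function fields. *)
Record miso (E1 E2 : ellcurve k) (M1 : funmodel E1) (M2 : funmodel E2)
    (p : point E1 -> point E2) (phi : {rmorphism M2 -> M1}) : Prop := MIso {
  miso_bij : bijective p;
  miso_pbij : bijective phi;
  miso_cst : forall a, phi (mcst M2 a) = mcst M1 a;
  miso_reg : forall R f, mreg R (phi f) <-> mreg (p R) f;
  miso_zero : p (zeropt E1) = zeropt E2
}.

Lemma subst_iso E1 E2 (M1 : funmodel E1) (M2 : funmodel E2) w r s t :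
  a1 E1 = 0 -> a1 E2 = 0 -> subst_rel E1 E2 w r s t ->
  exists p (phi : {rmorphism M2 -> M1}), [/\ miso p phi,
    forall R x y, val R = Some (x, y) ->
      val (p R) = Some (w ^+ 2 * x + r, w ^+ 3 * y + w ^+ 2 * s * x + t),
    phi (mX M2) = mcst M1 (w ^+ 2) * mX M1 + mcst M1 r
    & phi (mY M2) = mcst M1 (w ^+ 3) * mY M1 + mcst M1 (w ^+ 2 * s) * mX M1 + mcst M1 t].
Proof.
move=> a10 a10' rel; have rel' := subst_rel_sym rel.
have [phi [hc hX hY]] := subst_hom M1 M2 rel a10 a10'.
have [psi [hc' hX' hY']] := subst_hom M2 M1 rel' a10' a10.
have [w0 _ _ _ _] := rel.
have w2 : w * w^-1 = 1 by rewrite mulfV.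
have two0K1 : 2 = 0 :> M1 := rmorph_two0 (mcst M1) two0.
have two0K2 : 2 = 0 :> M2 := rmorph_two0 (mcst M2) two0.
have e1 : cancel phi psi.
  have := @hom_ext _ _ M2 M2 (psi \o phi) idfun; apply=> [a||] /=.
  - by rewrite hc hc'.
  - rewrite hX rmorphD rmorphM /= hX' !hc' -!exprVn !(rmorphM, rmorphXn) /=.
    have := congr1 (mcst M2) w2; rewrite rmorphM rmorph1.
    by move: (mcst M2 w) (mcst M2 w^-1) => W Wi e; ring2 two0K2: e.
  rewrite hY !(rmorphD, rmorphM) /= hX' hY' !hc' -!exprVn !(rmorphM, rmorphXn, rmorphD) /=.
  have := congr1 (mcst M2) w2; rewrite rmorphM rmorph1.
  by move: (mcst M2 w) (mcst M2 w^-1) => W Wi e; ring2 two0K2: e.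
have e2 : cancel psi phi.
  have := @hom_ext _ _ M1 M1 (phi \o psi) idfun; apply=> [a||] /=.
  - by rewrite hc' hc.
  - rewrite hX' rmorphD rmorphM /= hX !hc -!exprVn !(rmorphM, rmorphXn) /=.
    have := congr1 (mcst M1) w2; rewrite rmorphM rmorph1.
    by move: (mcst M1 w) (mcst M1 w^-1) => W Wi e; ring2 two0K1: e.
  rewrite hY' !(rmorphD, rmorphM) /= hX hY !hc -!exprVn !(rmorphM, rmorphXn, rmorphD) /=.
  have := congr1 (mcst M1) w2; rewrite rmorphM rmorph1.
  by move: (mcst M1 w) (mcst M1 w^-1) => W Wi e; ring2 two0K1: e.
pose p := spt rel a10 a10'; pose q := spt rel' a10' a10.
have p1 : cancel p q.
  case=> -[[x y]|] xy; apply/val_inj => //=.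
  rewrite /sx /sy -!exprVn; move: w^-1 w2 => wi e; congr (Some (_, _)); ring2 two0: e.
have p2 : cancel q p.
  case=> -[[x y]|] xy; apply/val_inj => //=.
  rewrite /sx /sy -!exprVn; move: w^-1 w2 => wi e; congr (Some (_, _)); ring2 two0: e.
exists p, phi; split=> //; last by move=> R x y; apply: val_spt.
split=> //; first by exists q.
- by exists psi.
move=> R f; split; last exact: subst_reg.
move=> h; rewrite -[f]e1; apply: (subst_reg (rel := rel') (a10 := a10') (a10' := a10)) => //.
by rewrite -/q p1.
Qed.

End Substitution.

(** * Classification of isomorphisms *)
Section Classification.
Variables (k : fieldType) (two0 : 2 = 0 :> k) (kc : alg_closed k).
Variables (E1 E2 : ellcurve k) (M1 : funmodel E1) (M2 : funmodel E2).
Hypotheses (a10 : a1 E1 = 0) (a10' : a1 E2 = 0).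
Variables (p : point E1 -> point E2) (phi : {rmorphism M2 -> M1}).
Hypothesis iso : miso p phi.
Local Notation c1 := (mcst M1).
Local Notation c2 := (mcst M2).
Local Notation O1 := (zeropt E1).
Local Notation O2 := (zeropt E2).

(** An isomorphism preserves regularity, hence also values: if phi f had the
    value z <> y, the inverse of phi (f - y) would be regular at R, although
    f - y vanishes at p R. *)
Lemma miso_val R f y : mval (p R) f y -> mval R (phi f) y.
Proof.
move=> h; have /mregP [z hz] : mreg R (phi f) by apply/(miso_reg iso); exact: mreg_val h.
have [<-//|zy] := eqVneq z y.
have hg : mval (p R) (f - c2 y) 0 by rewrite -(subrr y); apply: val_sub h (val_cst _ _ _).
have hpg : mval R (phi (f - c2 y)) (z - y).
  by rewrite rmorphB /= (miso_cst iso); apply: val_sub hz (val_cst _ _ _).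
have zy0 : z - y != 0 by rewrite subr_eq0.
have g0 : f - c2 y != 0.
  by apply: contraNneq (val_neq0 hpg zy0) => ->; rewrite rmorph0.
have /(miso_reg iso) /mregP [q hq] : mreg R (phi (f - c2 y)^-1).
  by rewrite fmorphV; apply: mreg_val (val_inv hpg zy0).
have := val_mul hg hq; rewrite mulfV // -(rmorph1 c2) => /val_uniq /(_ (val_cst _ _ _)).
by rewrite mul0r => /esym/eqP; rewrite oner_eq0.
Qed.

Lemma miso_neqO R : R <> O1 -> p R <> O2.
Proof.
move=> RO pR; apply: RO; apply: (bij_inj (miso_bij iso)).
by rewrite pR (miso_zero iso).
Qed.

Lemma reg_pullback f : (forall R, R <> O2 -> mreg R f) <-> (forall R, R <> O1 -> mreg R (phi f)).
Proof.
split=> h R RO; first by apply/(miso_reg iso)/h/miso_neqO.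
have [q pq qp] := miso_bij iso; rewrite -[R]qp; apply/(miso_reg iso)/h.
by move=> qR; apply: RO; rewrite -[R]qp qR (miso_zero iso).
Qed.

Lemma reg_X (E : ellcurve k) (M : funmodel E) R : R <> zeropt E ->
  mreg R (mX M) /\ mreg R (mY M).
Proof.
move=> /ptO [x [y e]]; have [h1 h2] := val_chart M R.
by move: h1 h2; rewrite /mchart e => h1 h2; split; [exact: mreg_val h1 | exact: mreg_val h2].
Qed.

Let u := phi (mX M2).
Let v := phi (mY M2).

Lemma uv_eq : v ^+ 2 + c1 (a3 E2) * v =
  u ^+ 3 + c1 (a2 E2) * u ^+ 2 + c1 (a4 E2) * u + c1 (a6 E2).
Proof.
have := congr1 phi (m_eq M2); rewrite a10' rmorph0 !mul0r addr0.
by rewrite !(rmorphD, rmorphM, rmorphXn) /= !(miso_cst iso).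
Qed.

Lemma pe_coef4 (e0 e1 e2 e3 d : k) :
  c1 e3 * mX M1 ^+ 3 + c1 e2 * mX M1 ^+ 2 + c1 e1 * mX M1 + c1 e0 + c1 d * mY M1 = 0 ->
  [/\ e0 = 0, e1 = 0, e2 = 0, e3 = 0 & d = 0].
Proof.
have -> : c1 e3 * mX M1 ^+ 3 + c1 e2 * mX M1 ^+ 2 + c1 e1 * mX M1 + c1 e0 + c1 d * mY M1
  = pe M1 (e3 *: 'X^3 + e2 *: 'X^2 + e1 *: 'X + e0%:P) d%:P.
  by rewrite /pe !ev1D !ev1Z !ev1Xn ev1X !ev1C.
move=> /pe_free [h1 /eqP]; rewrite polyC_eq0 => /eqP d0.
have hi i : (e3 *: 'X^3 + e2 *: 'X^2 + e1 *: 'X + e0%:P : {poly k})`_i = 0 by rewrite h1 coef0.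
have := (hi 0%N, hi 1%N, hi 2, hi 3); rewrite !coefE /= !mulr0 !mulr1 ?addr0 ?add0r.
by case=> -[[]].
Qed.

Lemma pe_low3 a b : (degpe a b <= 3)%N -> exists g r q, pe M1 a b = c1 g * mY M1 + (c1 r * mX M1 + c1 q).
Proof.
rewrite /degpe geq_max => /andP [sa sb].
have [g bE] : exists g, b = g%:P.
  exists b`_0; apply: size1_polyC; move: sb; have [->|b0] := eqVneq b 0; first by rewrite size_poly0.
  by case: (size b) => [|[|j]] //; lia.
have [r [q e]] : exists r q, pe M1 a 0 = c1 r * mX M1 + c1 q.
  apply: pe_low; rewrite /degpe eqxx maxn0; move: sa; case: (size a) => [|[|[|j]]] //; lia.
exists g, r, q; rewrite -e pe0 /pe bE ev1C; ring.
Qed.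

(** The images u and v of X and Y are regular off O, hence polynomials in X and
    Y. The equation of E2 forces their poles at O to have orders 2m and 3m.
    Every function regular off O is a polynomial in u and v and has a pole of
    order divisible by m; as X and Y have poles of orders 2 and 3, m = 1. *)
Lemma miso_affine : exists al r g s t : k, [/\ al != 0, g != 0,
  u = c1 al * mX M1 + c1 r & v = c1 g * mY M1 + (c1 s * mX M1 + c1 t)].
Proof.
have [a [b uE]] := reg_affine kc ((reg_pullback _).1 (fun R RO => (reg_X M2 RO).1)).
have [a' [b' vE]] := reg_affine kc ((reg_pullback _).1 (fun R RO => (reg_X M2 RO).2)).
rewrite -/u in uE; rewrite -/v in vE.
have u0 : u != 0 by rewrite fmorph_eq0 mX_neq0.
have v0 : v != 0 by rewrite fmorph_eq0 mY_neq0.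
have peN (q q' : {poly k}) : pe M1 q q' != 0 -> (q != 0) || (q' != 0).
  apply: contraR; rewrite negb_or !negbK => /andP [/eqP -> /eqP ->].
  by rewrite pe0 ev1_0.
have hu : mord O1 u (- (degpe a b)%:Z) by rewrite uE; apply: mord_inf_pe; apply: peN; rewrite -uE.
have hv : mord O1 v (- (degpe a' b')%:Z) by rewrite vE; apply: mord_inf_pe; apply: peN; rewrite -vE.
set d := degpe a b in hu; set d' := degpe a' b' in hv.
have t := munif_inf M1.
have hcst z : mge O1 (c1 z) 0 := mge_reg t (mreg_cst _ _ z).
have d0 : (0 < d)%N.
  rewrite lt0n; apply/eqP => d0.
  have [r [q e]] : exists r q, pe M1 a b = c1 r * mX M1 + c1 q.
    by apply: pe_low; rewrite -/d d0.
  have r0 : r = 0.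
    apply/eqP/negPn/negP => r0; have := ord_lin M1 q r0; rewrite -e -uE => h.
    by have := mord_uniq h hu; rewrite d0.
  have : phi (mX M2 - c2 q) = 0.
    by rewrite rmorphB /= (miso_cst iso) -/u uE e r0 rmorph0 mul0r add0r subrr.
  by move/eqP; rewrite fmorph_eq0 (negPf (mX_cst_neq0 _ _)).
have hR : mord O1 (u ^+ 3 + c1 (a2 E2) * u ^+ 2 + c1 (a4 E2) * u + c1 (a6 E2)) (- (3 * d)%N%:Z).
  have h3 := mord_exp 3 hu; have h2 := mord_exp 2 hu.
  have -> : - (3 * d)%N%:Z = (- d%:Z) *+ 3 by lia.
  have m2 z : mge O1 (c1 z * u ^+ 2) ((- d%:Z) *+ 2).
    by have := mge_mul (hcst z) (mord_mge h2); rewrite add0r.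
  have m1 z : mge O1 (c1 z * u) (- d%:Z).
    by have := mge_mul (hcst z) (mord_mge hu); rewrite add0r.
  apply: mord_add (hcst _) _; last by lia.
  apply: mord_add (m1 _) _; last by lia.
  apply: mord_add h3 (m2 _) _; lia.
have d'0 : (0 < d')%N.
  rewrite lt0n; apply/eqP => d'0; rewrite d'0 oppr0 in hv.
  have hL : mge O1 (v ^+ 2 + c1 (a3 E2) * v) 0.
    have hv' := mord_mge hv.
    apply: mge_add; first by rewrite expr2; have := mge_mul hv' hv'; rewrite addr0.
    by have := mge_mul (hcst (a3 E2)) hv'; rewrite addr0.
  by rewrite uv_eq in hL; have := mge_ord_lt hR hL; lia.
have hL : mord O1 (v ^+ 2 + c1 (a3 E2) * v) (- (2 * d')%N%:Z).
  have h2 := mord_exp 2 hv; have -> : - (2 * d')%N%:Z = (- d'%:Z) *+ 2 by lia.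
  have h1 : mge O1 (c1 (a3 E2) * v) (- d'%:Z).
    by have := mge_mul (hcst (a3 E2)) (mord_mge hv); rewrite add0r.
  by apply: mord_add h2 h1 _; lia.
rewrite uv_eq in hL; have dd : (3 * d = 2 * d')%N by have := mord_uniq hR hL; lia.
have [m [m0 dm d'm]] : exists m, [/\ (0 < m)%N, d = 2 * m & d' = 3 * m]%N.
  have od : odd d = false by have := congr1 odd dd; rewrite !oddM /=.
  have := odd_double_half d; rewrite od add0n -muln2 => dE.
  by exists d./2; split; move: dd d0 dE; clear; lia.
rewrite dm in hu; rewrite d'm in hv.
have surj (f : M1) (n : nat) : (0 < n)%N -> (forall R, R <> O1 -> mreg R f) ->
    mord O1 f (- n%:Z) -> (m %| n)%N.
  move=> n0 rf hf; have [psi e1 e2] := miso_pbij iso.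
  have [A [B fE]] : exists A B, psi f = pe M2 A B.
    by apply: (reg_affine kc); apply/reg_pullback => R RO; rewrite e2; apply: rf.
  have fE' : f = ev1 c1 A u + ev1 c1 B u * v.
    rewrite -[f]e2 fE /pe rmorphD rmorphM /=.
    by rewrite !(rmorph_ev1 (d' := c1) (miso_cst iso)).
  have AB : (A != 0) || (B != 0).
    apply: contraR (mord_neq0 hf); rewrite negb_or !negbK => /andP [/eqP A0 /eqP B0].
    by rewrite fE' A0 B0 !ev1_0 mul0r addr0.
  have := mord_pe m0 AB hu hv; rewrite -fE' => h.
  have -> : n = (m * degpe A B)%N by have := mord_uniq hf h; lia.
  exact: dvdn_mulr.
have m2 : (m %| 2)%N := surj (mX M1) 2%N isT (fun R RO => (reg_X M1 RO).1) (mord_inf_X M1).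
have m3 : (m %| 3)%N := surj (mY M1) 3%N isT (fun R RO => (reg_X M1 RO).2) (mord_inf_Y M1).
have m1 : m = 1%N.
  have : (m %| gcdn 2 3)%N by rewrite dvdn_gcd m2.
  by rewrite -[gcdn 2 3]/1%N dvdn1 => /eqP.
rewrite m1 in hu hv dm d'm.
have [al [r ue]] : exists r q, pe M1 a b = c1 r * mX M1 + c1 q by apply: pe_low; rewrite -/d dm.
have [g [s [q ve]]] := @pe_low3 a' b' (eq_leq d'm).
rewrite -uE in ue; rewrite -vE in ve.
exists al, r, g, s, q; split=> //.
  apply/eqP => al0; have : mge O1 u 0.
    rewrite ue al0 rmorph0 mul0r add0r; exact: hcst.
  by move/(mge_ord_lt hu).
apply/eqP => g0; have : mge O1 v (- 2%:Z).
  rewrite ve g0 rmorph0 mul0r add0r; apply: mge_add.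
    by have := mge_mul (hcst s) (mord_mge (mord_inf_X M1)); rewrite add0r.
  by apply: mge_le (hcst q).
by move/(mge_ord_lt hv).
Qed.

(** Comparing coefficients in the equation of E2 at the images of X and Y; the
    scalings al of x and g of y satisfy g^2 = al^3, so that w = g / al has
    w^2 = al and w^3 = g. *)
Lemma miso_subst : exists w r s t, [/\ subst_rel E1 E2 w r s t,
  u = c1 (w ^+ 2) * mX M1 + c1 r &
  forall R x y, val R = Some (x, y) ->
    val (p R) = Some (w ^+ 2 * x + r, w ^+ 3 * y + w ^+ 2 * s * x + t)].
Proof.
have two0K : 2 = 0 :> M1 := rmorph_two0 c1 two0.
have [al [r [g [s1 [t [al0 g0 uE vE]]]]]] := miso_affine.
have := uv_eq; rewrite uE vE => e.
have [f0 f1 f2 f3 f4] : [/\ g ^+ 2 * a6 E1 + t ^+ 2 + a3 E2 * t + r ^+ 3 + a2 E2 * r ^+ 2 + a4 E2 * r + a6 E2 = 0,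
   g ^+ 2 * a4 E1 + a3 E2 * s1 + al * r ^+ 2 + a4 E2 * al = 0,
   g ^+ 2 * a2 E1 + s1 ^+ 2 + al ^+ 2 * r + a2 E2 * al ^+ 2 = 0,
   g ^+ 2 + al ^+ 3 = 0 & g ^+ 2 * a3 E1 + a3 E2 * g = 0].
  apply: pe_coef4; rewrite !(rmorphD, rmorphM, rmorphXn) /=.
  have e1 := m_eq M1; rewrite a10 rmorph0 !mul0r addr0 in e1.
  move: e e1; move: (mX M1) (mY M1) => x y e e1.
  move: e; set L := (X in X = _ -> _); set R := (X in _ = X -> _) => e.
  transitivity (L + R + c1 g ^+ 2 * ((y ^+ 2 + c1 (a3 E1) * y) + (x ^+ 3 + c1 (a2 E1) * x ^+ 2 + c1 (a4 E1) * x + c1 (a6 E1)))).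
    by rewrite /L /R; ring2 two0K.
  by rewrite e e1 !(c2_addrr two0K) mulr0 addr0.
pose w := g / al.
have g2 : g ^+ 2 = al ^+ 3 by apply: (c2_eq two0).
have w2 : w ^+ 2 = al by rewrite /w expr_div_n g2 exprS mulfK // expf_neq0.
have w3 : w ^+ 3 = g by rewrite exprS w2 /w mulfVK.
have w0 : w != 0 by rewrite mulf_neq0 // invr_eq0.
pose s := s1 / al; have s1E : s1 = al * s by rewrite mulrC mulfVK.
have e3 : a3 E2 = w ^+ 3 * a3 E1.
  by apply: (mulIf g0); apply: (c2_eq two0); rewrite w3 -f4; ring.
have w4 : w ^+ 4 = al ^+ 2 by rewrite -w2 -exprM.
have w6 : w ^+ 6 = al ^+ 3 by rewrite -w2 -exprM.
exists w, r, s, t; rewrite w2 w3; split=> // [|R x y eR].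
  split=> //.
  - apply: (mulfI (expf_neq0 2 al0)); apply: (c2_eq two0).
    by rewrite -f2 w2 g2 s1E; ring.
  - apply: (mulfI al0); apply: (c2_eq two0); rewrite -f1 e3 g2 w4 s1E; ring.
  - by apply: (c2_eq two0); rewrite -f0 g2 w6; ring.
have RO : R <> O1 by move=> RO; move: eR; rewrite RO.
have [x' [y' e']] := ptO (miso_neqO RO).
have [hx hy] := val_pt_ss M1 eR; have [hx' hy'] := val_pt_ss M2 e'.
have hc := val_cst M1 R; rewrite e'; congr (Some (_, _)).
  apply: (val_uniq (miso_val hx')); rewrite -/u uE.
  by do !(apply: val_add || apply: val_mul).
apply: (val_uniq (miso_val hy')); rewrite -/v vE -addrA -s1E.
by do !(apply: val_add || apply: val_mul).
Qed.

End Classification.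

(** * The invariant of a pair *)
Lemma miso_comp (k : fieldType) (E1 E2 E3 : ellcurve k) (M1 : funmodel E1)
  (M2 : funmodel E2) (M3 : funmodel E3) p q (phi : {rmorphism M2 -> M1})
  (psi : {rmorphism M3 -> M2}) : miso p phi -> miso q psi ->
  miso (q \o p) (phi \o psi : {rmorphism M3 -> M1}).
Proof.
move=> h h'; split.
- exact: bij_comp (miso_bij h') (miso_bij h).
- exact: bij_comp (miso_pbij h) (miso_pbij h').
- by move=> a /=; rewrite (miso_cst h') (miso_cst h).
- by move=> R f /=; rewrite -(miso_reg h') -(miso_reg h).
by rewrite /= (miso_zero h) (miso_zero h').
Qed.

Section EcIso.
Variables (k : fieldType) (E1 E2 : ellcurve k).

Definition mpullback (phi : ec_iso E1 E2) : {rmorphism Mfun E2 -> Mfun E1} :=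
  pullback phi.

Lemma ec_iso_miso (phi : ec_iso E1 E2) : miso (ptmap phi) (mpullback phi).
Proof.
exact (MIso (ptmap_bij phi) (pullback_bij phi : bijective (mpullback phi))
  (pullback_cst phi) (pullback_reg phi) (ptmap_zero phi)).
Qed.

Definition miso_ec_iso p (phi : {rmorphism Mfun E2 -> Mfun E1}) (h : miso p phi) :
    ec_iso E1 E2 :=
  @EcIso k E1 E2 p phi (miso_bij h) (miso_pbij h) (miso_cst h) (miso_reg h)
    (miso_zero h).
End EcIso.

Lemma isomorphicP (k : fieldType) (L1 L2 : ecpair k) : isomorphic L1 L2 <->
  exists p (phi : {rmorphism Mfun (ecurve L2) -> Mfun (ecurve L1)}),
    miso p phi /\ p (ecpoint L1) = ecpoint L2.
Proof.
split=> [[phi e]|[p [phi [h e]]]].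
  exact (ex_intro _ (ptmap phi) (ex_intro _ (mpullback phi) (conj (ec_iso_miso phi) e))).
exact (ex_intro _ (miso_ec_iso h) e).
Qed.

Lemma isomorphic_trans (k : fieldType) (L1 L2 L3 : ecpair k) :
  isomorphic L1 L2 -> isomorphic L2 L3 -> isomorphic L1 L3.
Proof.
move=> /isomorphicP [p [phi [h e]]] /isomorphicP [q [psi [h' e']]].
apply/isomorphicP; exists (q \o p); eexists; split; first exact: miso_comp h h'.
by rewrite /= e e'.
Qed.

Section Invariant.
Variables (k : fieldType) (two0 : 2 = 0 :> k) (kc : alg_closed k).
Implicit Types (E : ellcurve k) (L : ecpair k).

(** This is (x(P) + x(2P))^3 / a3^2 when a1 = 0: the duplication formula gives
    a3^2 (x(P) + x(2P)) = x^4 + a3^2 (x + a2) + a4^2 with x = x(P), which is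
    written here in terms of x + a2. *)
Definition lame_inv L : k :=
  let E := ecurve L in let x := (coords (ecpoint L)).1 + a2 E in
  (x ^+ 4 + a3 E ^+ 2 * x + (a4 E + a2 E ^+ 2) ^+ 2) ^+ 3 / a3 E ^+ 8.

Lemma lame_inv_subst E1 E2 w r s t (P1 : point E1) (P2 : point E2) x y y' :
  subst_rel E1 E2 w r s t -> a3 E1 != 0 -> val P1 = Some (x, y) ->
  val P2 = Some (w ^+ 2 * x + r, y') ->
  lame_inv (EcPair P1) = lame_inv (EcPair P2).
Proof.
move=> [w0 e3 e2 e4 _] a30 p1 p2; rewrite /lame_inv /coords /= p1 p2 /= e3 e4 e2.
have -> : w ^+ 2 * x + r + (w ^+ 2 * a2 E1 + s ^+ 2 + r) =
  w ^+ 2 * (x + a2 E1) + s ^+ 2 by ring2 two0.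
have -> : w ^+ 4 * a4 E1 + w ^+ 3 * a3 E1 * s + r ^+ 2 + (w ^+ 2 * a2 E1 + s ^+ 2 + r) ^+ 2
  = w ^+ 4 * (a4 E1 + a2 E1 ^+ 2) + w ^+ 3 * a3 E1 * s + s ^+ 4 by ring2 two0.
move: (x + a2 E1) (a4 E1 + _) => X D.
have -> : (w ^+ 2 * X + s ^+ 2) ^+ 4 + (w ^+ 3 * a3 E1) ^+ 2 * (w ^+ 2 * X + s ^+ 2) +
   (w ^+ 4 * D + w ^+ 3 * a3 E1 * s + s ^+ 4) ^+ 2
  = w ^+ 8 * (X ^+ 4 + a3 E1 ^+ 2 * X + D ^+ 2) by ring2 two0.
by field; rewrite w0 a30.
Qed.

Lemma subst_isomorphic E1 E2 w r s t (P1 : point E1) (P2 : point E2) x y :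
  a1 E1 = 0 -> a1 E2 = 0 -> subst_rel E1 E2 w r s t -> val P1 = Some (x, y) ->
  val P2 = Some (w ^+ 2 * x + r, w ^+ 3 * y + w ^+ 2 * s * x + t) ->
  isomorphic (EcPair P1) (EcPair P2).
Proof.
move=> a10 a10' rel e1 e2; apply/isomorphicP => /=.
have [p [phi [h hp _ _]]] := subst_iso two0 (Mfun E1) (Mfun E2) a10 a10' rel.
by exists p, phi; split=> //; apply/val_inj; rewrite e2; exact: hp e1.
Qed.

Lemma lame_inv_isomorphic L1 L2 : a1 (ecurve L1) = 0 -> a1 (ecurve L2) = 0 ->
  ecpoint L1 <> zeropt _ -> isomorphic L1 L2 -> lame_inv L1 = lame_inv L2.
Proof.
case: L1 L2 => [E1 P1] [E2 P2] /= a10 a10' P1O /isomorphicP [p [phi [h e]]].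
have [w [r [s [t [rel _ hp]]]]] := miso_subst two0 kc a10 a10' h.
have [x [y e1]] := ptO P1O; have := hp _ _ _ e1; rewrite /= in e; rewrite e => e2.
exact: lame_inv_subst rel (a3_neq0 two0 a10) e1 e2.
Qed.

Variable iota : {rmorphism 'F_2 -> k}.
Local Notation E := (E0 iota).

Lemma lame_inv_E0 (P : point E) : P <> zeropt E -> lame_inv (EcPair P) = rho_at P.
Proof.
move=> /ptO [x [y e]]; rewrite /lame_inv /rho_at /coords /= e /= /rho_poly.
rewrite !(horner_exp, hornerD, hornerXn, hornerX).
rewrite !expr1n divr1.
by congr (_ ^+ 3); ring.
Qed.

Lemma exists_root3 (a : k) : exists w, w ^+ 3 = a.
Proof.
have [|s /rootP] := kc (p := 'X^3 - a%:P); first by rewrite size_XnsubC.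
by rewrite !(hornerD, hornerN, hornerXn, hornerC) => /subr0_eq; exists s.
Qed.

Lemma exists_artin (n : nat) (a : k) : (1 < n)%N -> exists w, w ^+ n + w = a.
Proof.
move=> n1; have sp : size ('X^n + ('X - a%:P) : {poly k}) = n.+1.
  by rewrite size_polyDl size_polyXn // size_XsubC.
have [|s /rootP] := kc (p := 'X^n + ('X - a%:P)); first by rewrite sp ltnW.
rewrite !(hornerD, hornerN, hornerXn, hornerX, hornerC) addrA => /subr0_eq; by exists s.
Qed.

(** w is chosen to normalize a3 to 1, then r to remove a2; the removal of a4
    and of a6 amounts to equations s^4 + s = ... and t^2 + t = .... *)
Lemma rel_to_E0 (E1 : ellcurve k) : a1 E1 = 0 -> exists w r s t, subst_rel E1 E w r s t.
Proof.
move=> a10; have a30 := a3_neq0 two0 a10.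
have [w w3] := exists_root3 (a3 E1)^-1.
have w0 : w != 0.
  by apply: contraNneq a30 => w0; move/eqP: w3; rewrite w0 expr0n eq_sym invr_eq0.
have [s es] := @exists_artin 4 ((w ^+ 2 * a2 E1) ^+ 2 + w ^+ 4 * a4 E1) isT.
pose r := w ^+ 2 * a2 E1 + s ^+ 2.
have [t et] := @exists_artin 2 (w ^+ 6 * a6 E1 + r ^+ 3) isT.
exists w, r, s, t; split=> //=.
- by rewrite w3 mulVf.
- by rewrite /r; ring2 two0.
- rewrite w3 mulVf // mul1r; apply: (c2_eq two0); rewrite add0r.
  transitivity (s ^+ 4 + s + ((w ^+ 2 * a2 E1) ^+ 2 + w ^+ 4 * a4 E1)).
    by rewrite /r; ring2 two0.
  by rewrite es (c2_addrr two0).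
apply: (c2_eq two0); rewrite add0r !mul0r mul1r !addr0.
transitivity ((t ^+ 2 + t) + (w ^+ 6 * a6 E1 + r ^+ 3)); first by ring.
by rewrite et (c2_addrr two0).
Qed.

Lemma iso_to_E0 L : a1 (ecurve L) = 0 -> ecpoint L <> zeropt _ ->
  exists2 P : point E, P != zeropt E & isomorphic L (EcPair P).
Proof.
case: L => E1 P1 /= a10 P1O; have [w [r [s [t rel]]]] := rel_to_E0 a10.
have [x [y e1]] := ptO P1O.
have on := subst_on two0 rel a10 (erefl : a1 E = 0) (pt_on_ss e1).
by exists (exist (oncurve E) _ on) => //; apply: subst_isomorphic rel e1 _.
Qed.

Lemma iso_from_E0 L (P : point E) : a1 (ecurve L) = 0 -> P <> zeropt _ ->
  isomorphic L (EcPair P) -> isomorphic (EcPair P) L.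
Proof.
case: L => E1 P1 /= a10 PO /isomorphicP [p [phi [h e]]]; rewrite /= in h e.
have [w [r [s [t [rel _ hp]]]]] := miso_subst two0 kc a10 (erefl : a1 E = 0) h.
have P1O : P1 <> zeropt _ by move=> P1O; apply: PO; rewrite -e P1O (miso_zero h).
have [x [y e1]] := ptO P1O; have [x' [y' e']] := ptO PO.
have := hp _ _ _ e1; rewrite e e' => -[xE yE].
apply: (subst_isomorphic (erefl : a1 E = 0) a10 (subst_rel_sym two0 rel) e').
rewrite e1 xE yE -!exprVn; have [w0 _ _ _ _] := rel.
have w2 : w * w^-1 = 1 by rewrite mulfV.
by move: w^-1 w2 => wi ew; congr (Some (_, _)); ring2 two0: ew.
Qed.

(** Equal invariants give x2^4 + x2 = w^2 (x1^4 + x1) with w^3 = 1. As w^8 = w^2,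
    r = x2 + w^2 x1 satisfies r^4 = r, and s = r^2, t are then determined. *)
Lemma E0_fiber (P1 P2 : point E) : P1 <> zeropt E -> P2 <> zeropt E ->
  rho_at P1 = rho_at P2 -> isomorphic (EcPair P1) (EcPair P2).
Proof.
move=> /ptO [x1 [y1 e1]] /ptO [x2 [y2 e2]].
rewrite /rho_at e1 e2 /rho_poly !(horner_exp, hornerD, hornerXn, hornerX) => e.
have [w [w3 ew]] : exists w, w ^+ 3 = 1 /\ x2 ^+ 4 + x2 = w ^+ 2 * (x1 ^+ 4 + x1).
  have [z|z] := eqVneq (x1 ^+ 4 + x1) 0.
    exists 1; rewrite expr1n z mulr0; split=> //; apply/eqP.
    have : (x2 ^+ 4 + x2) ^+ 3 == 0 by rewrite -e z expr0n.
    by rewrite expf_eq0.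
  pose q := (x2 ^+ 4 + x2) / (x1 ^+ 4 + x1).
  have q3 : q ^+ 3 = 1 by rewrite expr_div_n -e divff // expf_neq0.
  exists (q ^+ 2); split; first by rewrite -exprM mulnC exprM q3 expr1n.
  by rewrite -exprM (exprD q 3 1) q3 mul1r mulfVK.
pose r := x2 + w ^+ 2 * x1; pose s := r ^+ 2.
have w8 : w ^+ 8 = w ^+ 2 by rewrite (exprD w 6 2) (exprM w 3 2) w3 expr1n mul1r.
have r4 : r ^+ 4 = r.
  apply: (c2_eq two0).
  transitivity ((x2 ^+ 4 + x2) + (w ^+ 8 * x1 ^+ 4 + w ^+ 2 * x1)).
    by rewrite /r; ring2 two0.
  by rewrite w8 ew -mulrDr (c2_addrr two0).
have s2 : s ^+ 2 = r by rewrite /s -exprM.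
pose t := y2 + y1 + w ^+ 2 * s * x1.
apply: (subst_isomorphic (w := w) (r := r) (s := s) (t := t) _ _ _ e1) => //; last first.
  rewrite e2 w3 /r /t; congr (Some (_, _)); ring2 two0.
have w0 : w != 0.
  by apply: contraTneq isT => w0; move/eqP: w3; rewrite w0 expr0n eq_sym oner_eq0.
split=> //=.
- by rewrite w3 mulr1.
- by rewrite s2; ring2 two0.
- by rewrite w3 /s; ring2 two0.
have on1 := pt_on_ss e1; have on2 := pt_on_ss e2.
rewrite !oncurveE //= !mul1r !mul0r !addr0 in on1 on2.
apply: (c2_eq two0); rewrite !mulr0 !mul0r !add0r !mul1r !addr0.
have x2E : x2 = w ^+ 2 * x1 + r by rewrite /r; ring2 two0.
transitivity ((y2 ^+ 2 + y2) + (y1 ^+ 2 + y1) + w ^+ 4 * s ^+ 2 * x1 ^+ 2 + w ^+ 2 * s * x1 + r ^+ 3).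
  by rewrite /t; ring2 two0.
rewrite (eqP on1) (eqP on2) x2E s2 /s.
have w6 : w ^+ 6 = 1 by rewrite (exprM w 3 2) w3 expr1n.
transitivity (w ^+ 6 * x1 ^+ 3 + x1 ^+ 3); first by ring2 two0.
by rewrite w6 mul1r (c2_addrr two0).
Qed.

End Invariant.

(** * Invariants of the automorphism group *)
Section InvariantPoly.
Variables (k : fieldType) (two0 : 2 = 0 :> k) (om : k).
Hypothesis om2 : om ^+ 2 = om + 1.
Let z : {poly k} := 'X^4 + 'X.
Let two0p : 2 = 0 :> {poly k} := c2_poly two0.

Lemma om3 : om ^+ 3 = 1.
Proof. by rewrite exprS om2 mulrDr -expr2 om2; ring2 two0. Qed.
Lemma om_neq0 : om != 0.
Proof. by apply: contra_eq_neq om3 => ->; rewrite expr0n eq_sym oner_neq0. Qed.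
Lemma om_neq1 : om != 1.
Proof.
apply/eqP => o1; move/eqP: om2; rewrite o1 expr1n -subr_eq0 opprD addrA subrr.
by rewrite sub0r oppr_eq0 oner_eq0.
Qed.
Lemma om2_neq1 : om ^+ 2 != 1.
Proof. by rewrite om2 -subr_eq0 addrK om_neq0. Qed.

Lemma size_z : size z = 5%N.
Proof. by rewrite /z size_polyDl size_polyXn // size_polyX. Qed.
Lemma z_neq0 : z != 0. Proof. by rewrite -size_poly_gt0 size_z. Qed.

(** z = X^4 + X is additive with kernel F_4 = {0, 1, om, om^2}. *)
Lemma z_tr r : r ^+ 4 = r -> z \Po ('X + r%:P) = z.
Proof.
move=> r4; rewrite /z comp_polyD comp_Xn_poly comp_polyX.
transitivity ('X ^+ 4 + 'X + ((r ^+ 4)%:P + r%:P)).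
  by rewrite polyC_exp; ring2 two0p.
by rewrite r4 (c2_addrr two0p) addr0.
Qed.
Lemma z_om : z \Po (om *: 'X) = om *: z.
Proof.
rewrite /z comp_polyD comp_Xn_poly comp_polyX exprZn scalerDr.
by rewrite (exprS om 3) om3 mulr1.
Qed.

Let transl_inv (p : {poly k}) := forall r, r ^+ 4 = r -> p \Po ('X + r%:P) = p.

Lemma tr_div p : transl_inv p -> p.[0] = 0 -> exists2 p', p = z * p' & transl_inv p'.
Proof.
move=> tp p0; pose rs := [:: 0; 1; om; om ^+ 2].
have rs4 r : r \in rs -> r ^+ 4 = r.
  rewrite !inE => /or4P [] /eqP ->; rewrite ?expr0n ?expr1n //.
    by rewrite exprS om3 mulr1.
  by rewrite -exprM (exprM om 4 2) (exprS om 3) om3 mulr1.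
have : \prod_(r <- rs) ('X - r%:P) %| p.
  apply: uniq_roots_dvdp.
    apply/allP => r /rs4 r4; apply/rootP; rewrite -p0 -[in RHS](tp r r4).
    by rewrite horner_comp !hornerE.
  rewrite uniq_rootsE /= !inE !negb_or eq_sym oner_neq0 [0 == om]eq_sym om_neq0 eq_sym.
  rewrite expf_eq0 om_neq0 /= eq_sym om_neq1 eq_sym om2_neq1 /= andbT.
  apply/eqP => e; have := om2; rewrite -e => /eqP.
  by rewrite -subr_eq0 opprD addrA subrr sub0r oppr_eq0 oner_eq0.
have -> : \prod_(r <- rs) ('X - r%:P) = z.
  rewrite /rs !big_cons big_nil mulr1 om2 polyCD.
  have e : om%:P ^+ 2 = om%:P + 1 :> {poly k} by rewrite -polyC_exp om2 polyCD.
  by rewrite /z; ring2 two0p: e.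
move=> /dvdpP [p' pE]; exists p'; first by rewrite mulrC.
move=> r r4; apply: (mulIf z_neq0); rewrite -pE -{1}(z_tr r4) -comp_polyM -pE.
exact: tp.
Qed.

Lemma tr_const y : transl_inv y%:P. Proof. by move=> r _; rewrite comp_polyC. Qed.
Lemma trB p q : transl_inv p -> transl_inv q -> transl_inv (p - q).
Proof. by move=> hp hq r r4; rewrite comp_polyB hp ?hq. Qed.

(** A polynomial invariant under the translations by F_4 that is multiplied by
    om^j under X -> om X is z^j times a polynomial in z^3 = rho: subtract its
    constant term, which is 0 unless j = 0, and divide by z, which lowers j by 1
    modulo 3. *)
Lemma inv_poly n j (p : {poly k}) : (size p <= n)%N -> (j < 3)%N -> transl_inv p ->
  p \Po (om *: 'X) = om ^+ j *: p ->
  exists q, p = z ^+ j * (q \Po rho_poly k).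
Proof.
have hom0 q : (q \Po (om *: 'X)).[0] = q.[0] by rewrite horner_comp hornerZ hornerX mulr0.
have szp p' : p' != 0 -> size (z * p') = (size p' + 4)%N.
  move=> p0; have -> : size (z * p') = (size z + size p').-1 by rewrite size_mul // z_neq0.
  by rewrite size_z addSn addnC.
elim: n j p => [|n IH] j p; first by rewrite size_poly_leq0 => /eqP ->; exists 0; rewrite comp_poly0 mulr0.
move=> sp j3 tp op.
have [->|pn0] := eqVneq p 0; first by exists 0; rewrite comp_poly0 mulr0.
case: j j3 op => [|j] j3 op.
  rewrite expr0 scale1r in op.
  have [p' pE tp'] : exists2 p', p - p.[0]%:P = z * p' & transl_inv p'.
    apply: tr_div; first by apply: trB => //; apply: tr_const.
    by rewrite hornerD hornerN hornerC subrr.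
  have op' : p' \Po (om *: 'X) = om ^+ 2 *: p'.
    have e : om *: (z * (p' \Po (om *: 'X))) = z * p'.
      by rewrite scalerAl -z_om -comp_polyM -pE comp_polyB comp_polyC op.
    apply: (mulfI z_neq0); rewrite -scalerAr -e scalerA -exprSr om3 scale1r //.
  have [p'0|p'0] := eqVneq p' 0.
    exists p.[0]%:P; rewrite expr0 mul1r comp_polyC.
    by apply/subr0_eq; rewrite pE p'0 mulr0.
  have sp' : (size p' <= n)%N.
    have h : (size (z * p')%R <= n.+1)%N.
      rewrite -pE; apply: szD => //; apply: szN; apply: leq_trans (size_polyC_leq1 _) _ => //.
    by rewrite szp // in h; lia.
  have [q qE] := IH 2 p' sp' isT tp' op'.
  exists ('X * q + p.[0]%:P); rewrite expr0 mul1r comp_polyD comp_polyM comp_polyX comp_polyC.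
  by apply: (canRL (subrK _)); rewrite pE qE /rho_poly -/z mulrA -exprS.
have p00 : p.[0] = 0.
  have := congr1 (fun q => q.[0]) op; rewrite hom0 hornerZ => /eqP.
  rewrite -subr_eq0 -{1}[p.[0]]mul1r -mulrBl mulf_eq0 => /orP [|/eqP //].
  rewrite subr_eq0 eq_sym; case: j j3 {op} => [|[|]] //.
    by rewrite (negPf om_neq1).
  by rewrite (negPf om2_neq1).
have [p' pE tp'] := tr_div tp p00.
have p'0 : p' != 0 by apply: contraNneq pn0 => p'0; rewrite pE p'0 mulr0.
have op' : p' \Po (om *: 'X) = om ^+ j *: p'.
  apply: (mulfI z_neq0); apply: (scalerI om_neq0).
  by rewrite scalerAl -z_om -comp_polyM -pE op exprS -scalerA pE -scalerAr.
have sp' : (size p' <= n)%N by move: sp; rewrite pE szp //; lia.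
have [q qE] := IH j p' sp' (ltnW j3) tp' op'.
by exists q; rewrite pE qE exprS mulrA.
Qed.

End InvariantPoly.

Section Quotient.
Variables (k : fieldType) (kc : alg_closed k) (iota : {rmorphism 'F_2 -> k}).
Local Notation E := (E0 iota).
Variable M : funmodel E.
Local Notation c := (mcst M).
Local Notation X := (mX M).
Local Notation Y := (mY M).

Lemma two0_F2 : 2 = 0 :> k.
Proof.
by rewrite -(rmorph_nat iota) -(rmorph0 iota); congr (iota _); apply/val_inj.
Qed.
Local Notation two0 := two0_F2.
Let rho : M := ev1 c (rho_poly k) X.

Lemma ev1_comp (p q : {poly k}) (w : M) : ev1 c (p \Po q) w = ev1 c p (ev1 c q w).
Proof.
elim/poly_ind: p => [|p a IH]; first by rewrite comp_poly0 !ev1_0.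
by rewrite comp_polyD comp_polyM comp_polyX comp_polyC !(ev1D, ev1M) IH ev1X !ev1C.
Qed.

Lemma E0_aut w r t : w ^+ 3 = 1 -> r ^+ 4 = r -> t ^+ 2 + t = r ^+ 3 ->
  subst_rel E E w r (r ^+ 2) t.
Proof.
move=> w3 r4 tr.
have w0 : w != 0.
  by apply: contra_eq_neq w3 => ->; rewrite expr0n eq_sym oner_neq0.
split=> //=.
- by rewrite w3 mulr1.
- by rewrite -exprM r4; ring2 two0.
- by rewrite w3; ring2 two0.
apply/esym/eqP; rewrite !mul0r mulr0 add0r mul1r !addr0 tr.
by rewrite (c2_addrr two0).
Qed.

Lemma aut_ex w r t : w ^+ 3 = 1 -> r ^+ 4 = r -> t ^+ 2 + t = r ^+ 3 ->
  exists p (psi : {rmorphism M -> M}), [/\ miso p psi,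
    psi X = ev1 c (w ^+ 2 *: 'X + r%:P) X
  & psi Y = c (w ^+ 3) * Y + c (w ^+ 2 * r ^+ 2) * X + c t].
Proof.
move=> w3 r4 tr; have rel := E0_aut w3 r4 tr.
have [p [psi [h _ hX hY]]] := subst_iso two0 M M (erefl : a1 E = 0) (erefl : a1 E = 0) rel.
by exists p, psi; split=> //; rewrite hX ev1D ev1Z ev1X ev1C.
Qed.

Lemma rho_invariant p (psi : {rmorphism M -> M}) : miso p psi -> psi rho = rho.
Proof.
move=> h; have [w [r [s [t [[w0 w3 e2 e4 _] hX _]]]]] :=
  miso_subst two0 kc (erefl : a1 E = 0) (erefl : a1 E = 0) h.
rewrite /= in w3 e2 e4.
have {}w3 : w ^+ 3 = 1 by rewrite [RHS]w3 mulr1.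
have rE : r = s ^+ 2 by apply: (c2_eq two0); rewrite [RHS]e2; ring.
have r4 : r ^+ 4 = r.
  have sE : s = r ^+ 2 by apply: (c2_eq two0); rewrite [RHS]e4 w3; ring.
  by rewrite {2}rE sE -exprM.
have w8 : w ^+ 8 = w ^+ 2 by rewrite (exprD w 6 2) (exprM w 3 2) w3 expr1n mul1r.
have w6 : w ^+ 6 = 1 by rewrite (exprM w 3 2) w3 expr1n.
rewrite /rho (rmorph_ev1 (miso_cst h)) hX.
have -> : c (w ^+ 2) * X + c r = ev1 c (w ^+ 2 *: 'X + r%:P) X.
  by rewrite ev1D ev1Z ev1X ev1C.
rewrite -ev1_comp; congr (ev1 _ _ _); rewrite /rho_poly.
rewrite rmorphXn /= comp_polyD comp_Xn_poly comp_polyX.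
have -> : (w ^+ 2 *: 'X + r%:P) ^+ 4 + (w ^+ 2 *: 'X + r%:P) = w ^+ 2 *: ('X^4 + 'X) :> {poly k}.
  have two0p := c2_poly two0.
  transitivity ((w ^+ 8)%:P * 'X^4 + (w ^+ 2)%:P * 'X + ((r ^+ 4)%:P + r%:P)).
    by rewrite -!mul_polyC !polyC_exp; ring2 two0p.
  by rewrite w8 r4 (c2_addrr two0p) addr0 -mulrDr mul_polyC.
by rewrite exprZn -exprM w6 scale1r.
Qed.

(** Write f = (a + b Y) / d. The automorphism y -> y + 1 gives b = 0. Taking a / d
    in lowest terms, an automorphism x -> w^2 x + r multiplies a and d by the
    same constant, the power of w^2 of exponent deg d. Multiplying both by
    z^(2 deg d) turns that constant into 1, as z is multiplied by w^2 and
    w^3 = 1, and [inv_poly] applies with j = 0. *)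
Lemma quotient_M (f : M) :
  (forall p (psi : {rmorphism M -> M}), miso p psi -> psi f = f) <->
  exists g h : {poly k}, ev1 c h rho != 0 /\ f = ev1 c g rho / ev1 c h rho.
Proof.
split; last first.
  move=> [g [h [h0 ->]]] p psi iso.
  have e := rho_invariant iso; move: (rho) e h0 => R e h0.
  by rewrite fmorph_div !(rmorph_ev1 (miso_cst iso)) e.
move=> inv; have [f0|f0] := eqVneq f 0.
  by exists 0, 1; rewrite ev1_0 ev1_1 oner_neq0 mul0r.
have [a [d [d0 cop fE]]] : exists a d : {poly k},
    [/\ d != 0, coprimep a d & f = ev1 c a X / ev1 c d X].
  have [a [b [e [e0 fE]]]] := pe_repr f.
  have eX0 : ev1 c e X != 0 by rewrite evX_eq0.
  have b0 : b = 0.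
    have e1 : 1 ^+ 2 + 1 = 0 ^+ 3 :> k by rewrite expr1n expr0n (c2_addrr two0).
    have [p [psi [h hX hY]]] := aut_ex (expr1n _ 3) (expr0n _ 4) e1.
    have := inv p psi h; rewrite {1}fE.
    have hX' : psi X = X by rewrite hX expr1n scale1r addr0 ev1X.
    have hY' : psi Y = Y + 1 by rewrite hY !expr1n expr0n mulr0 !rmorph0 mul0r addr0 !rmorph1 mul1r.
    rewrite /pe fmorph_div rmorphD rmorphM /= !(rmorph_ev1 (miso_cst h)) hX' hY' fE.
    move/(mulIf (invr_neq0 eX0)); rewrite /pe => ee.
    have : ev1 c b X = 0.
      move: ee; move: (ev1 c a X) (ev1 c b X) => u v ee.
      by apply: (addrI (u + v * Y)); rewrite addr0 -{2}ee mulrDr mulr1 addrA.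
    by move/eqP; rewrite evX_eq0 => /eqP.
  have a0 : a != 0.
    by apply: contraNneq f0 => a0; rewrite fE a0 b0 pe0 ev1_0 mul0r.
  have g0 : gcdp a e != 0 by rewrite gcdp_eq0 negb_and a0.
  have ge : e = e %/ gcdp a e * gcdp a e by rewrite divpK // dvdp_gcdr.
  have ga : a = a %/ gcdp a e * gcdp a e by rewrite divpK // dvdp_gcdl.
  exists (a %/ gcdp a e), (e %/ gcdp a e); split.
  - by apply: contraNneq e0 => z; rewrite ge z mul0r.
  - by rewrite coprimep_div_gcd // a0.
  have gX0 : ev1 c (gcdp a e) X != 0 by rewrite evX_eq0.
  rewrite fE b0 pe0 [in LHS]ga [ev1 c e X](congr1 (fun q => ev1 c q X) ge) !ev1M.
  by rewrite -mulf_div divff // mulr1.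
have a0 : a != 0 by apply: contraNneq f0 => a0; rewrite fE a0 ev1_0 mul0r.
have key w r : w ^+ 3 = 1 -> r ^+ 4 = r -> let l := w ^+ 2 *: 'X + r%:P in
    let y := (w ^+ 2) ^+ (size d).-1 in d \Po l = y *: d /\ a \Po l = y *: a.
  move=> w3 r4 l y; have [t et] := @exists_artin _ kc 2 (r ^+ 3) isT.
  have [p [psi [h hX _]]] := aut_ex w3 r4 et.
  have w20 : w ^+ 2 != 0.
    by rewrite expf_neq0 //; apply: contra_eq_neq w3 => ->; rewrite expr0n eq_sym oner_neq0.
  have sl : size l = 2%N.
    by rewrite /l size_polyDl size_scale // size_polyX // ltnS size_polyC_leq1.
  have dl0 : d \Po l != 0 by rewrite -size_poly_eq0 size_comp_poly2 // size_poly_eq0.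
  have e : (a \Po l) * d = a * (d \Po l).
    have := inv p psi h; rewrite fE fmorph_div !(rmorph_ev1 (miso_cst h)) hX -!ev1_comp.
    move/eqP; rewrite eqr_div ?evX_eq0 // -!ev1M => /eqP /evX_inj -> //.
  have dv : d %| d \Po l.
    by have := Gauss_dvdpr (d \Po l) (etrans (coprimep_sym d a) cop); rewrite -e dvdp_mull.
  have dl : d \Po l = y *: d.
    have : d %= d \Po l by rewrite -dvdp_size_eqp // size_comp_poly2.
    move/eqp_eq; rewrite lead_coef_comp ?sl // => ee.
    have ld : lead_coef d != 0 by rewrite lead_coef_eq0.
    apply: (scalerI ld); rewrite scalerA; move: ee; rewrite /l.
    rewrite lead_coefDl ?size_scale ?size_polyX ?ltnS ?size_polyC_leq1 //.
    by rewrite lead_coefZ lead_coefX mulr1 => <-.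
  split=> //; apply: (mulIf d0); rewrite e dl -scalerAl -scalerAr //.
have [om om2] : exists om : k, om ^+ 2 = om + 1.
  have [om e] := @exists_artin _ kc 2 1 isT; exists om.
  by apply: (c2_eq two0); rewrite addrA e (c2_addrr two0).
have o3 := om3 two0 om2.
pose e := (2 * (size d).-1)%N; pose z : {poly k} := 'X^4 + 'X.
have invp (q : {poly k}) : (forall w r, w ^+ 3 = 1 -> r ^+ 4 = r ->
     q \Po (w ^+ 2 *: 'X + r%:P) = (w ^+ 2) ^+ (size d).-1 *: q) ->
    exists q', q * z ^+ e = q' \Po rho_poly k.
  move=> hq; have [q'] : exists q', q * z ^+ e = z ^+ 0 * (q' \Po rho_poly k).
    apply: (inv_poly two0 om2 (leqnn _)) => //.
      move=> r r4; have := hq 1 r (expr1n _ _) r4; rewrite !expr1n !scale1r => h.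
      by rewrite comp_polyM h rmorphXn /= (z_tr two0).
    have w3 : (om ^+ 2) ^+ 3 = 1 by rewrite -exprM (exprM om 3 2) o3 expr1n.
    have := hq _ 0 w3 (expr0n _ _).
    have -> : (om ^+ 2) ^+ 2 = om by rewrite -exprM (exprS om 3) o3 mulr1.
    rewrite addr0 => h; rewrite comp_polyM h rmorphXn /= (z_om two0 om2).
    rewrite exprZn -scalerAl -scalerAr scalerA -exprD expr0 /e.
    by rewrite -{1}[(size d).-1]mul1n -mulnDl exprM o3 expr1n.
  by rewrite expr0 mul1r; exists q'.
have [qd ed] := invp d (fun w r w3 r4 => (key w r w3 r4).1).
have [qa ea] := invp a (fun w r w3 r4 => (key w r w3 r4).2).
have z0 : ev1 c (z ^+ e) X != 0 by rewrite evX_eq0 expf_neq0 // z_neq0.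
have dz : d * z ^+ e != 0 by rewrite mulf_neq0 // expf_neq0 // z_neq0.
exists qa, qd; rewrite /rho -!ev1_comp -ed -ea evX_eq0; split=> //.
by rewrite fE !ev1M -mulf_div divff // mulr1.
Qed.

Lemma size_rho : size (rho_poly k) = 13%N.
Proof.
by have := size_exp ('X^4 + 'X : {poly k}) 3; rewrite size_z /rho_poly; case: (size _) => //= m ->.
Qed.

Lemma finite_k_rho (p : {poly k}) : exists b : 'I_12 -> {poly k},
  p = \sum_i (b i \Po rho_poly k) * 'X^i.
Proof.
have r0 : rho_poly k != 0 by rewrite -size_poly_gt0 size_rho.
have [n] := ubnP (size p); elim: n p => // n IH p sp.
have [small|big] := ltnP (size p) 13.
  exists (fun i => (p`_i)%:P); rewrite -{1}(coefK p) (_ : \poly_(i < size p) p`_i = \poly_(i < 12) p`_i).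
    by rewrite poly_def; apply: eq_bigr => i _; rewrite comp_polyC mul_polyC.
  apply/polyP => i; rewrite !coef_poly; case: ltnP => h1; case: ltnP => h2 //.
    by move: (size p) h1 h2 small; clear; lia.
  by rewrite nth_default.
have sq : (size (p %/ rho_poly k)%R < n)%N.
  rewrite size_divp // size_rho; move: (size p) sp big; clear; lia.
have sr : (size (p %% rho_poly k)%R < n)%N.
  have := ltn_modp p (rho_poly k); rewrite r0 size_rho.
  move: (size (_ %% _)%R) (size p) sp big; clear; lia.
have [b bE] := IH _ sq; have [b' bE'] := IH _ sr.
exists (fun i => b i * 'X + b' i).
rewrite {1}(divp_eq p (rho_poly k)) {1}bE {1}bE' mulr_suml -big_split /=.
apply: eq_bigr => i _; rewrite comp_polyD comp_polyM comp_polyX; ring.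
Qed.

Lemma finite_M : exists n (s : 'I_n -> M),
  (forall i R, R <> zeropt E -> mreg R (s i)) /\
  forall f, (forall R, R <> zeropt E -> mreg R f) ->
  exists b : 'I_n -> {poly k}, f = \sum_i ev1 c (b i) rho * s i.
Proof.
pose s (i : 'I_(12 + 12)) : M :=
  match split i with inl j => X ^+ j | inr j => X ^+ j * Y end.
exists (12 + 12)%N, s; split.
  move=> i R RO; have [rX rY] := reg_X M RO.
  have rXn j : mreg R (X ^+ j).
    elim: j => [|j IH]; first by rewrite expr0 -(rmorph1 c); apply: mreg_cst.
    by rewrite exprS; apply: mreg_mul.
  by rewrite /s; case: (split i) => j //; apply: mreg_mul.
move=> f /(reg_affine kc) [a [b ->]].
have [p pE] := finite_k_rho a; have [q qE] := finite_k_rho b.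
exists (fun i => match split i with inl j => p j | inr j => q j end).
rewrite big_split_ord /= /pe {1}pE {1}qE; congr (_ + _).
  rewrite (big_morph _ (fun u v => ev1D c X u v) (ev1_0 c X)).
  apply: eq_bigr => i _; rewrite /s.
  have -> : split (lshift 12 i) = inl i by exact: (unsplitK (inl i)).
  by rewrite ev1M ev1_comp ev1Xn.
rewrite (big_morph _ (fun u v => ev1D c X u v) (ev1_0 c X)) mulr_suml.
apply: eq_bigr => i _; rewrite /s.
have -> : split (rshift 12 i) = inr i by exact: (unsplitK (inr i)).
by rewrite ev1M ev1_comp ev1Xn mulrA.
Qed.

Lemma rho_regular R : R <> zeropt E -> mreg R rho.
Proof.
move=> RO; have [/mregP [x hx] _] := reg_X M RO.
exact: mreg_val (val_ev1 _ hx).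
Qed.

End Quotient.

(** * The classification of Lame curves *)
Section TheCurve.
Variables (k : fieldType) (kc : alg_closed k) (iota : {rmorphism 'F_2 -> k}).
Local Notation E := (E0 iota).
Let two0 : 2 = 0 :> k := two0_F2 iota.

Lemma E0_supersingular : supersingular E.
Proof.
move=> p pk P; have -> : p = 2%N.
  by have := pk; rewrite (pcharf_eq (pchar2 two0)) => /eqP.
have [//|[x [y e]]] := O_or P; rewrite /mulpt /= e /= eqxx /=.
by rewrite mul0r addr0 (c2_addrr two0) add0r oner_eq0.
Qed.

Lemma E0_quotient : quotient_by_isom (rho iota).
Proof.
move=> f; have [h1 h2] := @quotient_M k kc iota (Mfun E) f; split.
  by move=> inv; exact (h1 (fun p psi h => inv (miso_ec_iso h))).
move=> gh phi; exact (h2 gh (ptmap phi) (mpullback phi) (ec_iso_miso phi)).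
Qed.

Lemma E0_finite : finite_off_zero (rho iota).
Proof.
exact (conj (@rho_regular k iota (Mfun E)) (@finite_M k kc iota (Mfun E))).
Qed.
End TheCurve.

Section LamePairs.
Variables (k : closedFieldType) (iota : {rmorphism 'F_2 -> k}).
Hypothesis k_algebraic : integralRange iota.
Local Notation E := (E0 iota).
Let two0 : 2 = 0 :> k := two0_F2 iota.
Let kc : alg_closed k := @closedField_alg_closed k.

(** The Lame pairs are the nonzero points of the curves with a1 = 0: this
    reduces the theorem to the classification of such pairs. *)
Lemma is_lameP (L : ecpair k) :
  is_lame L <-> a1 (ecurve L) = 0 /\ ecpoint L <> zeropt _.
Proof.
split=> [[n hn]|[a10 PO]].
  have h : mlame (Mfun (ecurve L)) (ecpoint L) n by exact hn.
  split; first exact (lame_a1_eq0 two0 kc h).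
  by have [n1 _ ord _] := h; exact: order_neqO n1 ord.
have [n hn] := supersingular_lame (Mfun (ecurve L)) two0 kc a10 PO
  (torsion_exists k_algebraic (ecpoint L) a10).
by exists n; exact hn.
Qed.

Lemma lame_inv_isom (L : ecpair k) (P : point E) : is_lame L -> P != zeropt E ->
  isomorphic L (EcPair P) -> lame_inv L = rho_at P.
Proof.
move=> /is_lameP [a10 LO] /eqP PO iso; rewrite -(lame_inv_E0 PO).
exact (@lame_inv_isomorphic k two0 kc L (EcPair P) a10 erefl LO iso).
Qed.

Lemma lame_inv_inj (L1 L2 : ecpair k) : is_lame L1 -> is_lame L2 ->
  lame_inv L1 = lame_inv L2 -> isomorphic L1 L2.
Proof.
move=> l1 l2 e; have [a11 O1] := (is_lameP L1).1 l1; have [a12 O2] := (is_lameP L2).1 l2.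
have [P1 P1O i1] := iso_to_E0 two0 kc iota a11 O1.
have [P2 P2O i2] := iso_to_E0 two0 kc iota a12 O2.
rewrite (lame_inv_isom l1 P1O i1) (lame_inv_isom l2 P2O i2) in e.
apply: isomorphic_trans i1 (isomorphic_trans _ (iso_from_E0 two0 kc a12 (elimN eqP P2O) i2)).
exact: (E0_fiber two0 (elimN eqP P1O) (elimN eqP P2O) e).
Qed.

Lemma lame_inv_surj (a : k) : exists2 L, is_lame L & lame_inv L = a.
Proof.
have [b b3] := exists_root3 kc a.
have [x ex] := @exists_artin _ kc 4 b isT.
have [y ey] := @exists_artin _ kc 2 (x ^+ 3) isT.
have on : oncurve E (Some (x, y)).
  by apply/eqP => /=; rewrite -ey; ring.
pose P : point E := exist (oncurve E) _ on.
have PO : P <> zeropt E by [].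
exists (EcPair P); first by apply/is_lameP.
rewrite (lame_inv_E0 PO) /rho_at /= /rho_poly.
by rewrite !(horner_exp, hornerD, hornerXn, hornerX) ex b3.
Qed.

Lemma lame_inv_conj (s : {rmorphism k -> k}) (L : ecpair k) : is_lame L ->
  is_lame (conj_pair s L) /\ lame_inv (conj_pair s L) = s (lame_inv L).
Proof.
move=> /is_lameP [a10 LO]; have [x [y e]] := ptO LO; split.
  apply/is_lameP; split; first by rewrite /= a10 rmorph0.
  by move/(congr1 val) => /=; rewrite e.
rewrite /lame_inv /coords /= e /=.
by rewrite fmorph_div !(rmorphXn, rmorphD, rmorphM).
Qed.
End LamePairs.

Theorem theorem2p4 (k : closedFieldType) (iota : {rmorphism 'F_2 -> k})
    (k_algebraic : integralRange iota) :
  let E := E0 iota in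
  [/\ supersingular E,
      quotient_by_isom (rho iota),
      finite_off_zero (rho iota)
    & exists Phi : ecpair k -> k,
      [/\ (* Phi is induced by rho *)
          forall L, is_lame L ->
            (exists2 P : point E, P != zeropt E & isomorphic L (EcPair P)) /\
            (forall P : point E, P != zeropt E -> isomorphic L (EcPair P) ->
               Phi L = rho_at P),
          (* Phi is well defined and injective on isomorphism classes *)
          forall L1 L2, is_lame L1 -> is_lame L2 ->
            (isomorphic L1 L2 <-> Phi L1 = Phi L2),
          (* Phi is surjective *)
          forall a : k, exists2 L, is_lame L & Phi L = a
        & (* Phi commutes with the Galois action *)
          forall s : {rmorphism k -> k}, bijective s -> s \o iota =1 iota ->
            forall L, is_lame L ->
              is_lame (conj_pair s L) /\ Phi (conj_pair s L) = s (Phi L)]].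
Proof.
move=> E; have two0 := two0_F2 iota; have kc := @closedField_alg_closed k.
split; [exact: E0_supersingular | exact: E0_quotient | exact: E0_finite |].
exists (@lame_inv k); split.
- move=> L l; have [a10 LO] := (is_lameP k_algebraic L).1 l.
  by split=> [|P]; [exact: iso_to_E0 | exact: lame_inv_isom].
- move=> L1 L2 l1 l2; split; last exact: lame_inv_inj.
  have [a11 O1] := (is_lameP k_algebraic L1).1 l1.
  have [a12 _] := (is_lameP k_algebraic L2).1 l2.
  exact: lame_inv_isomorphic.
- exact: lame_inv_surj.
by move=> s _ _ L l; exact: lame_inv_conj.
Qed.
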